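(* Let $1<p<\infty$ and let $X$ be a Banach space with the UMD property. Then there is a constant $C>0$, depending only on the UMD constant $\mathscr U_p(X)$, such that for every $m\in\mathbb Z$, $m\ne0$, every $0\le i\le K(m)$ and every $\delta\in\{0,1\}$ the inequality $$\big\|T_m\circ P_i^{(\delta)}u\big\|_{L_X^p}\le C\cdot\big\|P_i^{(\delta)}u\big\|_{L_X^p}$$ holds for all $u\in L_X^p$. Moreover $K(m)\le 7+2\log_2(1+|m|)$.
   Context: $L_X^p=L^p(\mathbb R;X)$ is the Bochner space with respect to Lebesgue measure. $X$ has the UMD property if for $1<p<\infty$ there is a constant $\mathscr U_p(X)$ (the UMD constant) with $\|\sum_j\varepsilon_jd_j\|_{L^p(\Omega,\mu;X)}\le\mathscr U_p(X)\|\sum_jd_j\|_{L^p(\Omega,\mu;X)}$ for all $X$-valued martingale difference sequences $\{d_j\}$ and all signs $\varepsilon_j\in\{-1,1\}$. For $j\in\mathbb Z$ let $\mathscr D_j=\{[2^{-j}k,2^{-j}(k+1)[\ :k\in\mathbb Z\}$ and $\mathscr D=\bigcup_{j\in\mathbb Z}\mathscr D_j$. The Haar functions are $h_{[0,1[}=1_{[0,1/2[}-1_{[1/2,1[}$ and $h_I(t)=h_{[0,1[}((t-\inf I)/|I|)$ for $I\in\mathscr D$. Let $\tau_m(I)=I+m|I|$. $T_m$ is the linear operator given by $T_mh_I=h_{\tau_m(I)}$, $I\in\mathscr D$ (coefficients in $X$ being carried along; defined on finite linear combinations and extended by continuity). Collections $\mathscr B_i^{(\delta)}$ for fixed $m\neq0$.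 If $|m|\ge2$ let $\lambda$ be the integer with $2^{\lambda-3}\le|m|<2^{\lambda-2}$; if $|m|=1$ let $\lambda=4$. Put $L(m)=\lambda-1$ and $K(m)=2L(m)+1$. For $0\le i\le L(m)$ let $$\mathscr A_i=\bigcup_{j\in\mathbb Z}\{I\in\mathscr D:|I|=2^{-(\lambda j+i)}\},$$ let $\mathscr A_i^{(0)}$ be the set of all $J\in\mathscr A_i$ for which there is $I\in\mathscr A_i$ with $|J|=2^{-\lambda}|I|$, $J\subset I$ and $\tau_m(J)\subset I$, and let $\mathscr A_i^{(1)}=\mathscr A_i\setminus\mathscr A_i^{(0)}$. Let $\mathscr D_{\mathrm{even}}$ (respectively $\mathscr D_{\mathrm{odd}}$) be the set of intervals $[2^{-j}k,2^{-j}(k+1)[\,\in\mathscr D$ for which $\lfloor k/|m|\rfloor$ is even (respectively odd). Then for $0\le i\le L(m)$ and $\delta\in\{0,1\}$ $$\mathscr B_i^{(\delta)}=\mathscr A_i^{(\delta)}\cap\mathscr D_{\mathrm{even}},\qquad \mathscr B_{i+L(m)+1}^{(\delta)}=\mathscr A_i^{(\delta)}\cap\mathscr D_{\mathrm{odd}}.$$ These collections, $0\le i\le K(m)$, $\delta\in\{0,1\}$, partition $\mathscr D$. The associated projections on $L_X^p$ are $$P_i^{(\delta)}u=\sum_{I\in\mathscr B_i^{(\delta)}}\langle u,h_I\rangle\,h_I\,|I|^{-1},\qquad\langle u,h_I\rangle=\int_{\mathbb R}u\,h_I\,dt.$$ *)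

(* Defs.v *)
From HB Require Import structures.
From mathcomp Require Import all_boot all_order all_algebra finmap.
From mathcomp Require Import all_classical all_reals all_analysis.

Set Implicit Arguments.
Unset Strict Implicit.
Unset Printing Implicit Defensive.

Import Order.TTheory GRing.Theory Num.Theory.
Import numFieldNormedType.Exports.

Local Open Scope classical_set_scope.
Local Open Scope ring_scope.

Section Bochner.
Context {d : measure_display} {T : measurableType d} {R : realType}
  {X : completeNormedModType R}.

(* [G] is meant to be a (sub-)sigma-algebra of [T]. *)
Definition simple_fun (G : set (set T)) (s : T -> X) : Prop :=
  finite_set (range s) /\ forall x, G (s @^-1` [set x]).

Definition strongly_measurable (G : set (set T)) (f : T -> X) : Prop :=
  exists s : nat -> T -> X, (forall n, simple_fun G (s n)) /\
    forall t, s n t @[n --> \oo] --> f t.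

(* The level set of the value 0 may have infinite measure; its term vanishes
   since it is a multiple of 0. *)
Definition simple_int (mu : {measure set T -> \bar R}) (s : T -> X) : X :=
  \sum_(x \in range s) fine (mu (s @^-1` [set x])) *: x.

Definition has_bochner_int (mu : {measure set T -> \bar R}) (f : T -> X)
    (v : X) : Prop :=
  strongly_measurable measurable f /\
  exists s : nat -> T -> X,
    [/\ forall n, simple_fun measurable (s n),
        forall n, (\int[mu]_t `|s n t|%:E < +oo)%E,
        (\int[mu]_t `|f t - s n t|%:E)%E @[n --> \oo] --> 0%E
      & simple_int mu (s n) @[n --> \oo] --> v].

(* The default value 0 is only taken when [f] is not Bochner integrable. *)
Definition bochner_int (mu : {measure set T -> \bar R}) (f : T -> X) : X :=
  xget 0 [set v | has_bochner_int mu f v].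

Definition Lp_norm (mu : {measure set T -> \bar R}) (p : R) (f : T -> X) :
    \bar R :=
  Lnorm mu p%:E (fun t => `|f t|%:E).

(* Elements of the Bochner space are handled through representatives that are
   strongly measurable everywhere; each class modulo null sets has one. *)
Definition in_Lp (mu : {measure set T -> \bar R}) (p : R) (f : T -> X) : Prop :=
  strongly_measurable measurable f /\ (Lp_norm mu p f < +oo)%E.

(* Differences of an L^p-martingale (f_n) for the filtration [F], with
   dif 0 = f_0 and dif n.+1 = f_(n+1) - f_n: the last clause says that the
   conditional expectation of dif n.+1 given F n vanishes. *)
Record martingale_difference (mu : {measure set T -> \bar R}) (p : R)
    (F : nat -> set (set T)) (dif : nat -> T -> X) : Prop := {
  md_sigma : forall n, sigma_algebra setT (F n);
  md_sub : forall n, F n `<=` measurable;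
  md_incr : forall n, F n `<=` F n.+1;
  md_adapted : forall n, strongly_measurable (F n) (dif n);
  md_Lp : forall n, in_Lp mu p (dif n);
  md_cond : forall n (A : set T), F n A ->
    has_bochner_int mu (fun t => (\1_A t : R) *: dif n.+1 t) 0 }.

End Bochner.

Section UMD.
Context {R : realType} (X : completeNormedModType R).

Definition UMD_bound (p U : R) : Prop :=
  forall (d : measure_display) (Omega : measurableType d)
    (mu : probability Omega R) (F : nat -> set (set Omega))
    (dif : nat -> Omega -> X) (n : nat) (eps : nat -> bool),
  martingale_difference mu p F dif ->
  (Lp_norm mu p (fun w => \sum_(j < n) (-1 : R) ^+ eps j *: dif j w)%R
     <= U%:E * Lp_norm mu p (fun w => \sum_(j < n) dif j w)%R)%E.

Definition UMD : Prop :=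
  forall p : R, 1 < p -> exists U : R, 0 <= U /\ UMD_bound p U.

(* The least admissible constant. *)
Definition UMD_const (p : R) : R := inf [set U : R | 0 <= U /\ UMD_bound p U].

End UMD.

(* The pair (j, k) stands for the interval [2^-j k, 2^-j (k + 1)[. *)
Definition dyadic : Type := (int * int)%type.

Definition tau (m : int) (I : dyadic) : dyadic := (I.1, I.2 + m).

Section Dyadic.
Variable R : realType.

Definition dlen (I : dyadic) : R := 2 ^ (- I.1).

Definition dinf (I : dyadic) : R := dlen I * I.2%:~R.

Definition ditv (I : dyadic) : set R := `[dinf I, dinf I + dlen I[.

Lemma ditv_tau (m : int) (I : dyadic) :
  ditv (tau m I) = [set t + m%:~R * dlen I | t in ditv I].
Proof.
rewrite /ditv /dinf /dlen /tau /= intrD mulrDr (mulrC m%:~R).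
set l := 2 ^ _; set a := l * _; set b := l * _.
apply/seteqP; split => x /=; rewrite ?in_itv /=.
- move=> /andP[h1 h2]; exists (x - b); last by rewrite subrK.
  by rewrite /= in_itv /= lerBrDr h1 ltrBlDr addrAC.
- move=> [t + <-]; rewrite /= in_itv /= => /andP[h1 h2].
  by rewrite lerD2r h1 /= addrAC ltrD2r.
Qed.

Definition haar01 (t : R) : R :=
  \1_(`[0, 1 / 2[%classic) t - \1_(`[1 / 2, 1[%classic) t.

Definition haar (I : dyadic) (t : R) : R := haar01 ((t - dinf I) / dlen I).

End Dyadic.

Arguments ditv R I : clear implicits.

Section Collections.
Variable m : int.

Definition lam : nat :=
  if `|m|%N == 1%N then 4 else (trunc_log 2 `|m|%N + 3)%N.

Lemma lamP : (2 <= `|m|%N)%N -> (2 ^ (lam - 3) <= `|m|%N < 2 ^ (lam - 2))%N.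
Proof.
rewrite /lam => m2; have -> : (`|m|%N == 1%N) = false.
  by apply/negbTE; rewrite neq_ltn m2 orbT.
rewrite addnK -addnBA// addn1.
by apply: trunc_log_bounds => //; apply: leq_trans m2.
Qed.

Definition Lnum : nat := (lam - 1)%N.

Definition Knum : nat := (2 * Lnum + 1)%N.

(* The integer quotient by the positive integer |m| is the floor of k/|m|. *)
Definition Deven : set dyadic := [set I | (2 %| (I.2 %/ `|m|)%Z)%Z].

Definition Dodd : set dyadic := [set I | ~~ (2 %| (I.2 %/ `|m|)%Z)%Z].

Variable R : realType.

Definition Acal (i : nat) : set dyadic :=
  [set I | exists j : int, dlen R I = 2 ^ (- (lam%:Z * j + i%:Z))].

Definition Acal0 (i : nat) : set dyadic :=
  [set J | Acal i J /\ exists I, [/\ Acal i I,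
     dlen R J = 2 ^ (- lam%:Z) * dlen R I,
     ditv R J `<=` ditv R I & ditv R (tau m J) `<=` ditv R I]].

Definition Acal1 (i : nat) : set dyadic := Acal i `\` Acal0 i.

(* [delta] ranges over {0, 1} = {false, true}. *)
Definition Acald (i : nat) (delta : bool) : set dyadic :=
  if delta then Acal1 i else Acal0 i.

Definition Bcal (i : nat) (delta : bool) : set dyadic :=
  if (i <= Lnum)%N then Acald i delta `&` Deven
  else Acald (i - (Lnum + 1)) delta `&` Dodd.

End Collections.

Section Operators.
Context {R : realType} {X : completeNormedModType R}.
Local Notation mu := (@lebesgue_measure R).

Definition haar_coef (u : R -> X) (I : dyadic) : X :=
  bochner_int mu (fun t => haar I t *: u t).

(* [v] is the sum of the projection series of [u] over the collection
   B_i^(delta): the series converges unconditionally to [v] in L^p. *)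
Definition is_projection (p : R) (m : int) (i : nat) (delta : bool)
    (u v : R -> X) : Prop :=
  in_Lp mu p v /\
  forall e : R, 0 < e -> exists F0 : {fset dyadic},
    forall F : {fset dyadic}, (F0 `<=` F)%fset ->
      (Lp_norm mu p (fun t => v t -
         \sum_(I <- F | I \in Bcal m R i delta)
            (haar I t / dlen R I) *: haar_coef u I)%R < e%:E)%E.

Definition haar_poly (F : {fset dyadic}) (a : dyadic -> X) (t : R) : X :=
  \sum_(I <- F) haar I t *: a I.

Definition shift_haar_poly (m : int) (F : {fset dyadic}) (a : dyadic -> X)
    (t : R) : X :=
  \sum_(I <- F) haar (tau m I) t *: a I.

(* [w] is the value at [v] of the extension by continuity of T_m from the
   finite Haar combinations: [v] is in their L^p-closure, and T_m g tends to
   [w] in L^p as g tends to [v] in L^p among them. *)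
Definition is_shift (p : R) (m : int) (v w : R -> X) : Prop :=
  [/\ in_Lp mu p v, in_Lp mu p w,
    forall e : R, 0 < e -> exists F a,
      (Lp_norm mu p (fun t => v t - haar_poly F a t)%R < e%:E)%E
  & forall e : R, 0 < e -> exists2 r : R, 0 < r & forall F a,
      (Lp_norm mu p (fun t => v t - haar_poly F a t)%R < r%:E)%E ->
      (Lp_norm mu p (fun t => w t - shift_haar_poly m F a t)%R < e%:E)%E].

End Operators.

(* Main.v *)
Require Import Defs.
From HB Require Import structures.
From mathcomp Require Import all_boot all_order all_algebra finmap.
From mathcomp Require Import all_classical all_reals all_analysis.
From mathcomp Require Import measurable_realfun.
From mathcomp Require Import zify ring lra.

(** Let U be an admissible UMD constant, at least 1. Haar functions, listed from long intervals to
    short ones, are martingale differences for a reason that involves no measure theory: the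
    exchange of the two halves of an interval reverses its Haar function and preserves those of all
    other intervals that are not shorter. On a finite uniform space, UMD gives an inequality for all
    sequences of differences with such symmetries ([sym_umd], [sym_umd_of_UMD]), and the estimate
    of T_m on finite Haar sums is a combinatorial consequence of it on the integers, where a
    dyadic interval is a set [cell j t = k].

    Each collection of the theorem lies in a class of intervals I whose lengths are powers of
    2 ^ lam up to a common factor, such that the intervals tau_m I are not in the class. Let r_I be
    independent random signs and write 1_A for indicators. For coefficients a_I the sums with the
    terms

      h_(tau I) a_I,  r_I 1_(tau I) a_I,  r_I 1_(M tau I) a_I,  r_I 1_(E tau I) a_I,
      r_I 1_(E I) a_I,  r_I 1_I a_I,  h_I a_I

    have L^p norms of which each is at most a constant times the next one. Here M I is the middle
    half of I, and E I is a set between M I and I. The first and the last steps exchange a Haar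
    function with a random sign on its support ([detsum_le_radsum], [radsum_le_detsum]). The third
    and the fifth are the contraction principle ([radsum_contract]). The fourth, and
    the second, where it yields a bound for the part of tau I outside of M tau I, replace a set A_I
    by its image B_I under an involution: r_I 1_A and r_I 1_B are the sum and
    the difference of r_I (1_A + 1_B) / 2 and r_I (1_A - 1_B) / 2, and these are symmetric
    differences as soon as the involution preserves the sets of all other intervals that are
    not shorter ([radsum_swap]). The translation which exchanges I with tau I fails to do so, as it
    may cross the boundary of a longer interval. Therefore E I consists of the points of I such
    that for each shorter interval J of the class, if E J or E tau J contains the point, then both
    sets lie in I ([Eset]). The exchange of E J with E tau J then happens inside or outside of E I
    ([Eset_sat]), and since m is small against 2 ^ lam, the middle half of I lies in E I
    ([mid_Eset]). The total constant is 2 U ^ 4, with no dependence on m ([hz_shift],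
    [tsum_class]).

    The rest is functional analysis. Restricting a Haar sum to some of its intervals costs a factor
    of U ([hsum_restrict]). Haar sums are dense in L^p as p is larger than 1 ([haar_dense]), and
    a Haar coefficient is continuous on L^p ([haar_coef_cvg]). Hence for Haar sums converging
    to u, the restrictions to the collection converge to the projection of u, and the images of the
    restrictions under T_m to the value of T_m there, with the same bound ([shift_on_class]). *)

Set Implicit Arguments.
Unset Strict Implicit.
Unset Printing Implicit Defensive.

Import Order.TTheory GRing.Theory Num.Theory.
Import numFieldNormedType.Exports.

Local Open Scope classical_set_scope.
Local Open Scope ring_scope.

(** * Dyadic cells in the integers *)

Definition cell (j : nat) (t : int) : int := (t %/ (2 ^ j)%:Z)%Z.

Lemma pow2_gt0 j : (0 : int) < (2 ^ j)%:Z.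
Proof. by rewrite ltz_nat expn_gt0. Qed.

Lemma cellP j t k : (cell j t == k) = (k * (2 ^ j)%:Z <= t < (k + 1) * (2 ^ j)%:Z).
Proof.
have h := pow2_gt0 j; rewrite /cell; move: (_%:Z) h => a a0.
have := divz_eq t a; have := modz_ge0 t (lt0r_neq0 a0); have := ltz_pmod t a0.
move: (t %/ a)%Z (t %% a)%Z => q r r1 r2 ->.
apply/eqP/idP => [<-|/andP[h1 h2]]; first by nia.
have : (q < k + 1) by nia.
have : (k < q + 1) by nia.
lia.
Qed.

Lemma cellD j t c : cell j (t + c * (2 ^ j)%:Z) = cell j t + c.
Proof.
rewrite /cell; have := lt0r_neq0 (pow2_gt0 j); move: (2 ^ j)%:Z => a a0.
by rewrite [t + _]addrC divzMDl// addrC.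
Qed.

Lemma cell_cell i j t : cell i (cell j t) = cell (i + j) t.
Proof. by rewrite /cell -divzMA_ge0// -PoszM -expnD addnC. Qed.

Lemma cell_coarse i j t : (j <= i)%N -> cell i t = cell (i - j) (cell j t).
Proof. by move=> ji; rewrite cell_cell subnK. Qed.

(** [upper j t] tells whether [t] lies in the upper half of the cell of order [j] that contains it. *)
Definition upper (j : nat) (t : int) : bool := (cell j.-1 t %% 2)%Z == 1.

Definition hswap (j : nat) (k t : int) : int :=
  if cell j t == k then
    if upper j t then t - (2 ^ j.-1)%:Z else t + (2 ^ j.-1)%:Z
  else t.

Lemma cellS j t : cell j.+1 t = (cell j t %/ 2)%Z.
Proof. by rewrite -add1n -cell_cell. Qed.

(** A single formula, linear in the step, which [lia] can follow through quotients. *)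
Lemma hswap_step j k t : hswap j.+1 k t =
  t + (if cell j.+1 t == k then (if upper j.+1 t then -1 else 1) else 0)
        * (2 ^ j)%:Z.
Proof. by rewrite /hswap /=; case: ifP => _; [case: ifP => _|]; lia. Qed.

Lemma cell_hswap i j k t : (0 < j <= i)%N -> cell i (hswap j k t) = cell i t.
Proof.
case: j => // j ji; rewrite hswap_step !(@cell_coarse i j.+1)//; congr cell.
rewrite !cellS cellD /upper /=; case: ifP => _; last by rewrite addr0.
case: ifP => /eqP; move: (cell j t) => a; lia.
Qed.

Lemma upper_hswap j k t : (0 < j)%N -> upper j (hswap j k t) = (cell j t == k) (+) upper j t.
Proof.
case: j => // j _; rewrite hswap_step /upper/= cellD.
case: ifP => _; last by rewrite addr0.
by case: ifP => /eqP; move: (cell j t) => a; lia.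
Qed.

Lemma hswapK j k : (0 < j)%N -> involutive (hswap j k).
Proof.
case: j => // j _ t; rewrite [LHS]hswap_step upper_hswap// cell_hswap ?leqnn//.
rewrite hswap_step; case: ifP => _ /=; last lia.
by case: upper => /=; lia.
Qed.

(** The middle half of a cell. It stays at distance a quarter of the cell from the boundary, and
    [hswap] exchanges it with its complement, the two outer quarters. *)
Definition mid (j : nat) (t : int) : bool :=
  let q := (cell (j - 2) t %% 4)%Z in (q == 1) || (q == 2).

Lemma mid_hswap j k t : (1 < j)%N -> mid j (hswap j k t) = (cell j t == k) (+) mid j t.
Proof.
case: j => [|[|j]] // _; rewrite hswap_step /mid/= subn2 /=.
have -> : (2 ^ j.+1)%:Z = 2 * (2 ^ j)%:Z by rewrite expnS PoszM.
rewrite mulrA cellD /upper/= !cellS.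
case: ifP => _; last by rewrite mul0r addr0.
by case: ifP => /eqP; move: (cell j t) => a; lia.
Qed.

Lemma mid_coarse i j s t : (j <= i - 2)%N -> cell j s = cell j t -> mid i s = mid i t.
Proof. by move=> ji e; rewrite /mid !(@cell_coarse (i - 2) j)// e. Qed.

Lemma upper_coarse i j s t : (j < i)%N -> cell j s = cell j t -> upper i s = upper i t.
Proof. by move=> ji e; rewrite /upper !(@cell_coarse i.-1 j) ?e//; lia. Qed.

(** * Saturated sets inside the cells of a class *)

Section Laminar.
Variables (m : int) (lam r : nat) (act : pred int).
Hypothesis act_disj : forall k, act k -> ~~ act (k + m).

(** The orders of the cells of a class form an arithmetic progression, so that cells of different
    orders differ in size by a factor of at least 2 ^ lam. *)
Definition lv (l : nat) : nat := (lam * l + r)%N.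

Definition pairU (E : nat -> int -> int -> Prop) l k t :=
  E l k t \/ E l (k + m) t.

(** The set E of a cell, by recursion on the order with a counter: the points of the cell for which
    every finer pair set through the point (see [Pset]) stays inside the cell. *)
Fixpoint Efuel (n l : nat) (k t : int) : Prop :=
  if n is n'.+1 then
    cell (lv l) t = k /\
    forall l' k', (l' < l)%N -> act k' -> pairU (Efuel n') l' k' t ->
      forall s, pairU (Efuel n') l' k' s -> cell (lv l) s = k
  else True.

Definition Eset l := Efuel l.+1 l.
(** The union of E for a cell and E for its translate by [m]. These are the sets inside which points
    get moved by the exchange of the cell with its translate. *)
Definition Pset := pairU Eset.

Lemma Efuel_eq n l : (l < n)%N -> Efuel n l = Eset l.
Proof.
have key : forall N a b l, (l < N)%N -> (l < a)%N -> (l < b)%N -> Efuel a l = Efuel b l.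
  elim=> // N IH [|a] [|b] // l' lN la lb; apply/funext => k; apply/funext => t /=.
  congr (_ /\ _); apply/eq_forall => l2; apply/eq_forall => k2.
  apply: propext; split => h l2l ak; have {}h := h l2l ak.
    by rewrite /pairU (IH b a); [exact: h | lia..].
  by rewrite /pairU (IH a b); [exact: h | lia..].
by move=> ln; apply: (key l.+1).
Qed.

Lemma EsetP l k t : Eset l k t <-> cell (lv l) t = k /\
  forall l' k', (l' < l)%N -> act k' -> Pset l' k' t ->
    forall s, Pset l' k' s -> cell (lv l) s = k.
Proof.
rewrite /Eset [in X in X <-> _]/=; split => -[e h]; split => // l' k' l'l ak.
  by have := h l' k' l'l ak; rewrite /pairU Efuel_eq.
by rewrite /pairU Efuel_eq//; exact: h.
Qed.

Lemma Eset_cell l k t : Eset l k t -> cell (lv l) t = k.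
Proof. by case/EsetP. Qed.

Lemma Pset_inj l k k' t : act k -> act k' -> Pset l k t -> Pset l k' t -> k = k'.
Proof.
move=> ak ak' [] /Eset_cell + [] /Eset_cell => -> e.
- by [].
- by have := act_disj ak'; rewrite -e ak.
- by have := act_disj ak; rewrite e ak'.
- lia.
Qed.

(** The sets E are saturated: a finer pair set meeting E lies in E. For a third pair set of order
    below that of E there are three cases; if it is finer than the given one, it is absorbed by the
    given one by induction, if it is coarser, it absorbs the given one, and if it has the same
    order, the two coincide, for active cells have disjoint pair sets. *)
Lemma Eset_sat l l' k' k t : (l' < l)%N -> act k' -> Pset l' k' t -> Eset l k t ->
  forall s, Pset l' k' s -> Eset l k s.
Proof.
elim/ltn_ind: l l' k' k t => l IH l' k' k t l'l ak' Pt Et s Ps.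
have [_ Et2] := (EsetP l k t).1 Et.
have sub := Et2 _ _ l'l ak' Pt.
apply/EsetP; split=> [|l2 k2 l2l ak2 P2s u P2u]; first exact: sub.
case: (ltngtP l2 l') => [l2l'|l'l2|e].
- suff : Pset l' k' u by exact: sub.
  by case: Ps => Es; [left|right]; exact: (IH _ l'l _ _ _ _ l2l' ak2 P2s Es).
- apply: (Et2 l2 k2 l2l ak2) P2u.
  by case: P2s => Es; [left|right]; exact: (IH _ l2l _ _ _ _ l'l2 ak' Ps Es).
- subst l2; have e := Pset_inj ak2 ak' P2s Ps; subst k2; exact: sub.
Qed.

Lemma lvD l l' : (l' <= l)%N -> lv l = (lam * (l - l') + lv l')%N.
Proof. by rewrite /lv => h; rewrite addnA -mulnDr subnK. Qed.

Hypothesis act_even : forall k c, act (k + m * (2 * c)) = act k.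
Hypothesis lam_gt1 : (1 < lam)%N.

(** E is translation invariant. Seen from a finer order, a translation by [m * c] cells is a
    translation by [m] times an even number of cells, since the orders differ by at least one factor
    of 2; this preserves the set of active cells, hence the whole configuration below. *)
Lemma Eset_shift l k c t :
  Eset l k t -> Eset l (k + m * c) (t + m * c * (2 ^ lv l)%:Z).
Proof.
elim/ltn_ind: l k c t => l IH k c t /EsetP[e h].
apply/EsetP; split=> [|l' k' l'l ak' Pt s Ps]; first by rewrite cellD e.
set v := m * c * _ in Pt *.
have vE : v = m * (c * (2 ^ (lam * (l - l')))%:Z) * (2 ^ lv l')%:Z.
  by rewrite /v (lvD (ltnW l'l)) expnD PoszM !mulrA.
set c' := c * _ in vE.
have Psh : forall k1 c1 t1, Pset l' k1 t1 -> Pset l' (k1 + m * c1) (t1 + m * c1 * (2 ^ lv l')%:Z).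
  by move=> k1 c1 t1 [] /(IH _ l'l _ c1) hh; [left|right; rewrite addrAC].
have c'E : exists d, c' = 2 * d.
  have : (0 < lam * (l - l'))%N by rewrite muln_gt0 (ltnW lam_gt1) subn_gt0.
  rewrite /c'; case: (lam * _)%N => // q _; exists (c * (2 ^ q)%:Z).
  by rewrite expnS PoszM mulrCA.
have back : forall u, Pset l' k' u -> Pset l' (k' - m * c') (u - v).
  by move=> u /(Psh _ (- c')); rewrite vE mulrN mulNr.
have := h l' (k' - m * c') l'l _ _ (s - v) (back _ Ps).
move=> <-; last first.
- by have := back _ Pt; rewrite addrK.
- by have [d ->] := c'E; rewrite -mulrN -mulrN act_even.
by rewrite -cellD -/v subrK.
Qed.

Lemma Eset_tau l k t : Eset l k t <-> Eset l (k + m) (t + m * (2 ^ lv l)%:Z).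
Proof.
split=> [/(Eset_shift 1)|/(Eset_shift (-1))]; rewrite ?mulr1// mulrN mulr1.
by rewrite mulNr !addrK.
Qed.

Hypothesis m_small : (`|m| + 1 <= 2 ^ (lam - 2))%N.

(** A finer pair set spans at most [`|m| + 1] of its cells, which is at most a quarter of the
    coarser cell by the choice of [lam]. So no pair set through the middle half can reach the
    boundary. *)
Lemma mid_Eset l k t : (1 < lv l)%N -> cell (lv l) t = k -> mid (lv l) t -> Eset l k t.
Proof.
move=> l2 tk mt; apply/EsetP; split => // l' k' l'l ak' Pt s Ps.
have a0 := pow2_gt0 (lv l - 2); have b0 := pow2_gt0 (lv l').
have ab : (`|m|%N%:Z + 1) * (2 ^ lv l')%:Z <= (2 ^ (lv l - 2))%:Z.
  apply: (@le_trans _ _ ((2 ^ (lam - 2))%:Z * (2 ^ lv l')%:Z)).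
    by rewrite ler_pM2r//; lia.
  rewrite -PoszM -expnD lez_nat leq_exp2l//.
  rewrite (lvD (ltnW l'l)) in l2 *.
  have : (lam <= lam * (l - l'))%N by rewrite leq_pmulr// subn_gt0.
  by move: (lam * _)%N => q; lia.
have Pc u : Pset l' k' u -> cell (lv l') u = k' \/ cell (lv l') u = k' + m.
  by case=> /Eset_cell; [left|right].
have : cell (lv l - 2) t = 4 * k + 1 \/ cell (lv l - 2) t = 4 * k + 2.
  move: mt tk; rewrite /mid (@cell_coarse (lv l) (lv l - 2)) ?leq_subr//.
  rewrite subKn//; move: (cell (lv l - 2) t) => q; rewrite /cell.
  have -> : (2 ^ 2)%N = 4%N by [].
  by lia.
have e4 : (2 ^ lv l)%:Z = 4 * (2 ^ (lv l - 2))%:Z.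
  by rewrite -{1}(subnK l2) expnD PoszM mulrC.
move=> tq; apply/eqP; rewrite cellP e4.
have : exists x, [/\ cell (lv l') s = x, (-`|m|%N%:Z <= x - cell (lv l') t)
  & x - cell (lv l') t <= `|m|%N%:Z].
  by exists (cell (lv l') s); split=> //; case: (Pc _ Pt) (Pc _ Ps) => -> [] ->; lia.
case=> x [/eqP]; have := eqxx (cell (lv l') t); have := eqxx (cell (lv l - 2) t).
rewrite !cellP; move: tq (cell (lv l') t) => + y.
move: (cell _ t) (2 ^ (lv l - 2))%:Z (2 ^ lv l')%:Z a0 b0 ab => q a b a0 b0 ab.
move: `|m|%N%:Z ab => M ab qk /andP[q1 q2] /andP[y1 y2] /andP[x1 x2] h1 h2.
have st : - (M + 1) * b < s - t < (M + 1) * b by apply/andP; split; nia.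
by case: qk => ?; subst q; apply/andP; split; lia.
Qed.

End Laminar.

(** * The UMD inequality for symmetric differences, and random signs *)

Section SymUMD.
Context {R : realType} {X : normedModType R}.
Variables (p U : R).
Hypothesis p1 : 1 < p.
Hypothesis U1 : 1 <= U.

Let p0 : 0 <= p := le_trans ler01 (ltW p1).

Lemma powR_norm_avg (x y : X) :
  `|2^-1 *: (x + y)| `^ p <= 2^-1 * (`|x| `^ p + `|y| `^ p).
Proof.
have key (a b : R) : 0 <= a -> 0 <= b ->
    (2^-1 * a + 2^-1 * b) `^ p <= 2^-1 * a `^ p + 2^-1 * b `^ p.
  move=> a0 b0; rewrite {2 4}(_ : 2^-1 = 1 - 2^-1); last by rewrite {2}(splitr 1) div1r addrK.
  by apply: (convex_powR (ltW p1) (Itv01 _ _)) => //=;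
    rewrite ?inE/= ?in_itv/= ?a0 ?b0// ?invr_ge0// invf_le1 ?ler1n.
have := key _ _ (normr_ge0 x) (normr_ge0 y).
rewrite -!mulrDr => /(le_trans _); apply.
rewrite ge0_ler_powR ?nnegrE ?mulr_ge0 ?addr_ge0//.
by rewrite normrZ ger0_norm// ler_wpM2l// ler_normD.
Qed.

Lemma powR_normZ (c : R) (x : X) : `|c *: x| `^ p = `|c| `^ p * `|x| `^ p.
Proof. by rewrite normrZ powRM. Qed.

(** The UMD inequality on a finite uniform space, for differences whose martingale property comes
    from a symmetry: the involution [phi k] reverses [d k] and preserves the earlier differences,
    so [d k] has mean 0 on each atom of the past. *)
Definition sym_umd : Prop :=
  forall (T : eqType) (s : seq T) (n : nat) (d : nat -> T -> X)
    (phi : nat -> T -> T) (eps : nat -> bool), uniq s ->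
    (forall k, (k < n)%N -> involutive (phi k)) ->
    (forall k, (k < n)%N -> {in s, forall x, phi k x \in s}) ->
    (forall k, (k < n)%N -> {in s, forall x, d k (phi k x) = - d k x}) ->
    (forall j k, (j < k < n)%N -> {in s, forall x, d j (phi k x) = d j x}) ->
  \sum_(x <- s) `|\sum_(j < n) (-1 : R) ^+ eps j *: d j x| `^ p
    <= U `^ p * \sum_(x <- s) `|\sum_(j < n) d j x| `^ p.

Hypothesis umd : sym_umd.

Lemma sum_avg (T : eqType) (s : seq T) (f g : T -> X) :
  \sum_(x <- s) `|2^-1 *: (f x + g x)| `^ p
    <= 2^-1 * (\sum_(x <- s) `|f x| `^ p + \sum_(x <- s) `|g x| `^ p).
Proof.
rewrite -big_split/= mulr_sumr; apply: ler_sum => x _; exact: powR_norm_avg.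
Qed.

Lemma Up1 : 1 <= U `^ p.
Proof. by rewrite -(powRr0 U) ler_powR. Qed.

Lemma big_double (V : zmodType) n (F : nat -> V) :
  \sum_(k < n.*2) F k = \sum_(j < n) (F j.*2 + F j.*2.+1).
Proof.
elim: n => [|n IH]; first by rewrite !big_ord0.
by rewrite doubleS !big_ord_recr/= IH -addrA.
Qed.

(** Keeping only the indices in [theta] is averaging the sum with the one in which the signs of the
    other indices are reversed. *)
Lemma sym_umd_restrict (T : eqType) (s : seq T) (n : nat) (d : nat -> T -> X)
    (phi : nat -> T -> T) (theta : nat -> bool) : uniq s ->
    (forall k, (k < n)%N -> involutive (phi k)) ->
    (forall k, (k < n)%N -> {in s, forall x, phi k x \in s}) ->
    (forall k, (k < n)%N -> {in s, forall x, d k (phi k x) = - d k x}) ->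
    (forall j k, (j < k < n)%N -> {in s, forall x, d j (phi k x) = d j x}) ->
  \sum_(x <- s) `|\sum_(j < n | theta j) d j x| `^ p
    <= U `^ p * \sum_(x <- s) `|\sum_(j < n) d j x| `^ p.
Proof.
move=> us phiK phis dphi djphi.
have hU := @umd T s n d phi (fun j => ~~ theta j) us phiK phis dphi djphi.
set A := \sum_(x <- s) _ in hU; set B := \sum_(x <- s) _ in hU *.
have -> : \sum_(x <- s) `|\sum_(j < n | theta j) d j x| `^ p =
   \sum_(x <- s) `|2^-1 *: (\sum_(j < n) d j x +
       \sum_(j < n) (-1 : R) ^+ (~~ theta j) *: d j x)| `^ p.
  apply: eq_bigr => x _; congr (`| _ | `^ _).
  rewrite -big_split/= scaler_sumr big_mkcond/=; apply: eq_bigr => j _.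
  case: (theta j) => /=; last by rewrite expr1 scaleN1r subrr scaler0.
  by rewrite expr0 scale1r -mulr2n -(scaler_nat 2 (d j x)) scalerA mulVf// scale1r.
apply: le_trans (sum_avg _ _ _) _; rewrite -/A -/B.
have B0 : 0 <= B by apply: sumr_ge0 => x _; rewrite powR_ge0.
have := ler_wpM2r B0 Up1; nra.
Qed.

Section Rademacher.
Variables (N : nat) (P : eqType) (w : seq P) (n : nat) (a : nat -> X).
Hypotheses (uw : uniq w) (nN : (n <= N.+1)%N).

Local Notation signs := {ffun 'I_N.+1 -> bool}.

Definition sg (e : signs) (j : nat) : R := (-1) ^+ e (inord j).

Definition sgflip (k : nat) (e : signs) : signs :=
  [ffun i => (i == inord k) (+) e i].

Lemma sgflipK k : involutive (sgflip k).
Proof. by move=> e; apply/ffunP => i; rewrite !ffunE addbA addbb. Qed.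

Lemma sg_flip k e j : (k < n)%N -> (j < n)%N ->
  sg (sgflip k e) j = if j == k then - sg e j else sg e j.
Proof.
move=> kn jn; rewrite /sg ffunE -val_eqE/= !inordK ?(leq_trans _ nN)//.
by case: eqP => _ /=; rewrite ?addTb ?addFb// signrN.
Qed.

(** Unnormalised p-th moment of the sum with coefficients [f] and independent random signs. *)
Definition radsum (f : nat -> P -> R) : R :=
  \sum_(t <- w) \sum_(e : signs) `|\sum_(j < n) (sg e j * f j t) *: a j| `^ p.

Lemma radsum_ge0 f : 0 <= radsum f.
Proof. by apply: sumr_ge0 => t _; apply: sumr_ge0 => e _; rewrite powR_ge0. Qed.

(** With a random sign attached, the coefficient A is the sum of the differences (A + B) / 2 and
    (A - B) / 2, and B is obtained by reversing the sign of the second one. The first is odd under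
    the reversal of the random sign; the second is odd under [psi], which exchanges A and B. So
    these are symmetric differences on the product with the space of signs, twice as many, which
    [d] lists in turn. *)
Lemma radsum_swap (A B : nat -> P -> R) (psi : nat -> P -> P) :
    (forall j, (j < n)%N -> involutive (psi j)) ->
    (forall j, (j < n)%N -> {in w, forall t, psi j t \in w}) ->
    (forall j, (j < n)%N -> {in w, forall t, A j (psi j t) = B j t}) ->
    (forall i j, (i < j < n)%N -> {in w, forall t, A i (psi j t) = A i t}) ->
    (forall i j, (i < j < n)%N -> {in w, forall t, B i (psi j t) = B i t}) ->
  radsum B <= U `^ p * radsum A.
Proof.
clear p0 p1 U1.
move=> psiK psiw AB Apsi Bpsi.
have BA j t : (j < n)%N -> t \in w -> B j (psi j t) = A j t.
  by move=> jn tw; rewrite -AB ?psiw// psiK.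
pose d (k : nat) (x : P * signs) : X :=
  (2^-1 * (sg x.2 k./2 * (A k./2 x.1 + (-1) ^+ odd k * B k./2 x.1))) *: a k./2.
pose phi (k : nat) (x : P * signs) : P * signs :=
  if odd k then (psi k./2 x.1, x.2) else (x.1, sgflip k./2 x.2).
pose s := [seq (t, e) | t <- w, e <- index_enum {ffun 'I_N.+1 -> bool}].
have us : uniq s by apply: allpairs_uniq => //; [exact: index_enum_uniq|case=> ? ? []].
have sP x : x \in s = (x.1 \in w).
  apply/idP/idP => [/allpairsP[y [yw _ ->]]//|xw].
  by apply/allpairsP; exists x; rewrite xw mem_index_enum; split=> //; case: x {xw}.
have hk k : (k < n.*2)%N -> (k./2 < n)%N by rewrite ltn_half_double.
have := @umd _ s n.*2 d phi odd us.
have eA x : \sum_(k < n.*2) d k x = \sum_(j < n) (sg x.2 j * A j x.1) *: a j.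
  rewrite (@big_double _ n (d^~ x)); apply: eq_bigr => j _.
  rewrite /d/= doubleK uphalf_double odd_double/= -scalerDl; congr (_ *: _).
  by rewrite expr0 expr1; field.
have eB x : \sum_(k < n.*2) (-1 : R) ^+ odd k *: d k x =
    \sum_(j < n) (sg x.2 j * B j x.1) *: a j.
  rewrite (@big_double _ n (fun k => (-1 : R) ^+ odd k *: d k x)).
  apply: eq_bigr => j _.
  rewrite /d/= doubleK uphalf_double odd_double/= !scalerA -scalerDl; congr (_ *: _).
  by rewrite expr0 expr1; field.
under eq_bigr do rewrite eB.
under [X in _ -> _ -> _ -> _ -> _ <= _ * X]eq_bigr do rewrite eA.
rewrite !big_allpairs; apply => {eA eB}.
- move=> k /hk kn [t e]; rewrite /phi; case: ifP => ok /=; rewrite ok/=.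
    by rewrite psiK.
  by rewrite sgflipK.
- move=> k /hk kn [t e]; rewrite !sP /phi; case: ifP => ok //= tw; exact: psiw.
- move=> k /hk kn [t e]; rewrite sP /phi /d /= => tw; case: ifP => ok /=.
    by rewrite expr1 AB// BA// -scaleNr; congr (_ *: _); ring.
  by rewrite expr0 sg_flip// eqxx -scaleNr; congr (_ *: _); ring.
- move=> j k /andP[jk kn] [t e]; rewrite sP /phi /d /= => tw.
  case: ifP => ok /=.
    have [e2|ne] := eqVneq j./2 k./2.
      have oj : ~~ odd j by move: ok; have := odd_double_half j; have := odd_double_half k; lia.
      by rewrite (negbTE oj) e2 expr0 !mul1r AB ?BA ?hk// [B _ _ + _]addrC.
    have jk2 : (j./2 < k./2 < n)%N.
      by rewrite hk// andbT ltn_neqAle ne half_leq// ltnW.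
    by rewrite (Apsi _ _ jk2)// (Bpsi _ _ jk2).
  have jk2 : (j./2 < k./2)%N.
    by move: ok; have := odd_double_half j; have := odd_double_half k; lia.
  rewrite sg_flip ?hk ?(ltn_trans jk)//.
  by rewrite (ltn_eqF jk2).
Qed.

(** Contraction principle: at a fixed point, deleting terms is averaging over the reversal of their
    signs. *)
Lemma radsum_contract (A B : nat -> P -> bool) :
    (forall j t, (j < n)%N -> A j t -> B j t) ->
  radsum (fun j t => (A j t)%:R) <= radsum (fun j t => (B j t)%:R).
Proof.
move=> AB; apply: ler_sum => t _.
pose eta (e : signs) : signs := [ffun i : 'I_N.+1 => (~~ A i t) (+) e i].
have etaK : involutive eta by move=> e; apply/ffunP=> i; rewrite !ffunE addbA addbb.
have sge e j : (j < n)%N -> sg (eta e) j = (-1) ^+ (~~ A j t) * sg e j.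
  by move=> jn; rewrite /sg ffunE signr_addb inordK// (leq_trans jn).
set F := fun e : signs => \sum_(j < n) (sg e j * (B j t)%:R) *: a j.
have -> : \sum_(e : signs) `|\sum_(j < n) (sg e j * (A j t)%:R) *: a j| `^ p =
     \sum_(e : signs) `|2^-1 *: (F e + F (eta e))| `^ p.
  apply: eq_bigr => e _; congr (`| _ | `^ _).
  rewrite -big_split/= scaler_sumr; apply: eq_bigr => j _.
  rewrite -scalerDl scalerA sge//; congr (_ *: _).
  have := AB j t (ltn_ord j); case: (A j t) => /=; last by move=> _; rewrite expr1; ring.
  by move=> ->//; rewrite expr0 /=; field.
apply: le_trans (sum_avg _ _ _) _.
have -> : \sum_(e : signs) `|F (eta e)| `^ p = \sum_(e : signs) `|F e| `^ p.
  by rewrite [RHS](reindex_inj (inv_inj etaK)).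
by move: (\sum_(e : signs) _) => S; lra.
Qed.

Lemma radsum_avg (A B C : nat -> P -> R) :
    (forall j t, (j < n)%N -> t \in w -> A j t = B j t + C j t) ->
  radsum A <= 2 `^ p * (2^-1 * (radsum B + radsum C)).
Proof.
move=> ABC; rewrite /radsum -big_split/= mulr_sumr mulr_sumr big_seq [leRHS]big_seq.
apply: ler_sum => t tw; rewrite -big_split/= !mulr_sumr; apply: ler_sum => e _.
have {1}-> : \sum_(j < n) (sg e j * A j t) *: a j = (2 : R) *: (2^-1 *:
   (\sum_(j < n) (sg e j * B j t) *: a j + \sum_(j < n) (sg e j * C j t) *: a j)).
  rewrite scalerA divff// scale1r -big_split/=; apply: eq_bigr => j _.
  by rewrite ABC// mulrDr scalerDl.
rewrite powR_normZ ger0_norm// ler_wpM2l ?powR_ge0//; exact: powR_norm_avg.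
Qed.

Definition detsum (f : nat -> P -> R) : R :=
  \sum_(t <- w) `|\sum_(j < n) f j t *: a j| `^ p.

(** Functions with values in {-1, 0, 1} that are symmetric differences can be exchanged with random
    signs on their supports: reversing signs costs a factor of U in both directions, and a fixed
    sign pattern is absorbed by the random one. *)
Section HaarLike.
Variables (A : nat -> P -> bool) (sgm : nat -> P -> bool) (psi : nat -> P -> P).
Let h j t : R := (-1) ^+ sgm j t * (A j t)%:R.
Hypothesis psiK : forall j, (j < n)%N -> involutive (psi j).
Hypothesis psiw : forall j, (j < n)%N -> {in w, forall t, psi j t \in w}.
Hypothesis hpsi : forall j, (j < n)%N -> {in w, forall t, h j (psi j t) = - h j t}.
Hypothesis hipsi : forall i j, (i < j < n)%N -> {in w, forall t, h i (psi j t) = h i t}.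

Let radsum_h : radsum (fun j t => (A j t)%:R) = radsum h.
Proof.
apply: eq_bigr => t _.
pose eta (e : signs) : signs := [ffun i : 'I_N.+1 => sgm i t (+) e i].
have etaK : involutive eta by move=> e; apply/ffunP=> i; rewrite !ffunE addbA addbb.
rewrite (reindex_inj (inv_inj etaK))/=; apply: eq_bigr => e _; congr (`| _ | `^ _).
apply: eq_bigr => j _; congr (_ *: _).
rewrite /sg ffunE signr_addb inordK ?(leq_trans (ltn_ord j))//.
by rewrite mulrAC mulrC mulrA /h; ring.
Qed.

Let signs_mul (e : signs) : 
  detsum (fun j t => sg e j * h j t) <= U `^ p * detsum h /\
  detsum h <= U `^ p * detsum (fun j t => sg e j * h j t).
Proof.
have sg2 j : sg e j * sg e j = 1 by rewrite -expr2 sqrr_sign.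
split.
- have := @umd _ w n (fun j t => h j t *: a j) psi (fun j => e (inord j)) uw psiK psiw.
  move=> H; apply: le_trans (H _ _) => //.
  + by apply: ler_sum => t _; under eq_bigr do rewrite -scalerA.
  + by move=> k kn t tw; rewrite hpsi// scaleNr.
  + by move=> j k jkn t tw; rewrite (hipsi jkn).
- have := @umd _ w n (fun j t => (sg e j * h j t) *: a j) psi (fun j => e (inord j)) uw psiK psiw.
  move=> H; apply: le_trans (H _ _) => //.
  + apply: ler_sum => t _; rewrite le_eqVlt; apply/orP; left; apply/eqP.
    congr (`| _ | `^ _); apply: eq_bigr => j _.
    by rewrite scalerA mulrA sg2 mul1r.
  + by move=> k kn t tw; rewrite hpsi// mulrN scaleNr.
  + by move=> j k jkn t tw; rewrite (hipsi jkn).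
Qed.

Let radsumE f : radsum f = \sum_(e : signs) detsum (fun j t => sg e j * f j t).
Proof. by rewrite /radsum exchange_big. Qed.

Lemma radsum_le_detsum :
  radsum (fun j t => (A j t)%:R) <= #|{: signs}|%:R * (U `^ p * detsum h).
Proof.
rewrite radsum_h radsumE mulr_natl -sumr_const [leRHS](eq_bigl xpredT)//.
by apply: ler_sum => e _; case: (signs_mul e).
Qed.

Lemma detsum_le_radsum :
  #|{: signs}|%:R * detsum h <= U `^ p * radsum (fun j t => (A j t)%:R).
Proof.
rewrite radsum_h radsumE mulr_natl -sumr_const [leLHS](eq_bigl xpredT)// mulr_sumr.
by apply: ler_sum => e _; case: (signs_mul e).
Qed.

End HaarLike.
End Rademacher.
End SymUMD.

(** * Haar functions on the integers and their translates *)

Section GridHaar.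
Context {R : realType}.

(** The Haar function of a dyadic interval, seen on the points of a grid finer than its halves. *)
Definition hz (j : nat) (k t : int) : R := (-1) ^+ upper j t * (cell j t == k)%:R.

Lemma hz_anti j k t : (0 < j)%N -> hz j k (hswap j k t) = - hz j k t.
Proof.
move=> j0; have e1 : cell j (hswap j k t) = cell j t by apply: cell_hswap; rewrite j0 leqnn.
rewrite /hz e1 upper_hswap//.
by case: eqP => _ /=; rewrite ?mulr0 ?oppr0// !mulr1 signrN.
Qed.

Lemma hz_inv i j ki kj t : (0 < j <= i)%N -> (i, ki) != (j, kj) ->
  hz i ki (hswap j kj t) = hz i ki t.
Proof.
move=> /andP[j0]; rewrite leq_eqVlt => /predU1P[<-{i}|ji] ne; last first.
  have e1 : cell j (hswap j kj t) = cell j t by apply: cell_hswap; rewrite j0 leqnn.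
  have e2 : cell i (hswap j kj t) = cell i t by apply: cell_hswap; rewrite j0 ltnW.
  by rewrite /hz (upper_coarse ji e1) e2.
have kne : ki != kj by apply: contraNN ne => /eqP ->.
have [tk|tk] := eqVneq (cell j t) kj; last by rewrite /hswap (negbTE tk).
have e1 : cell j (hswap j kj t) = cell j t by apply: cell_hswap; rewrite j0 leqnn.
by rewrite /hz e1 tk [kj == _]eq_sym (negbTE kne) !mulr0.
Qed.

Context {X : normedModType R}.
Variables (p U : R).
Hypothesis p1 : 1 < p.
Hypothesis U1 : 1 <= U.
Hypothesis umd : sym_umd (X := X) p U.

Lemma hz_restrict (w : seq int) (n : nat) (J : nat -> nat * int) (a : nat -> X)
    (theta : nat -> bool) : uniq w ->
    (forall j t, (j < n)%N -> cell (J j).1 t = (J j).2 -> t \in w) ->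
    (forall j, (j < n)%N -> (0 < (J j).1)%N) ->
    (forall i j, (i < j < n)%N -> ((J j).1 <= (J i).1)%N /\ J i != J j) ->
  \sum_(t <- w) `|\sum_(j < n | theta j) hz (J j).1 (J j).2 t *: a j| `^ p
    <= U `^ p * \sum_(t <- w) `|\sum_(j < n) hz (J j).1 (J j).2 t *: a j| `^ p.
Proof.
move=> uw ww J0 Js.
apply: (sym_umd_restrict p1 U1 umd (d := fun j t => hz (J j).1 (J j).2 t *: a j)
  (phi := fun j => hswap (J j).1 (J j).2)) => //.
- by move=> k kn; apply: hswapK; exact: J0.
- move=> k kn t tw /=; have [e|ne] := eqVneq (cell (J k).1 t) (J k).2.
    by apply: (ww k _ kn); rewrite -{2}e; apply: cell_hswap; rewrite J0 ?leqnn.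
  by rewrite /hswap (negbTE ne).
- by move=> k kn t tw; rewrite hz_anti ?J0// scaleNr.
- move=> i j ij t tw; have [ji ne] := Js i j ij; have /andP[ij' jn] := ij.
  by congr (_ *: _); apply: hz_inv; rewrite ?J0// -!surjective_pairing.
Qed.

Section Shift.
Variables (m : int) (lam r : nat) (act : pred int).
Hypothesis lam_gt1 : (1 < lam)%N.
Hypothesis act_disj : forall k, act k -> ~~ act (k + m).
Hypothesis act_even : forall k c, act (k + m * (2 * c)) = act k.
Hypothesis m_small : (`|m| + 1 <= 2 ^ (lam - 2))%N.
Local Notation lv := (lv lam r).
Local Notation Eset := (Eset m lam r act).
Local Notation Pset := (Pset m lam r act).

Variables (w : seq int) (n : nat) (l : nat -> nat) (k : nat -> int) (a : nat -> X).
Hypothesis uw : uniq w.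
Hypothesis ww : forall j t, (j < n)%N ->
  cell (lv (l j)) t = k j \/ cell (lv (l j)) t = k j + m -> t \in w.
Hypothesis lv1 : forall j, (j < n)%N -> (1 < lv (l j))%N.
Hypothesis actk : forall j, (j < n)%N -> act (k j).
Hypothesis sorted : forall i j, (i < j < n)%N -> (l j <= l i)%N.
Hypothesis distinct : forall i j, (i < j < n)%N -> (l i, k i) != (l j, k j).

Local Notation RS := (radsum p n w n a).
Local Notation DS := (detsum p w n a).
Let c : R := #|{: {ffun 'I_n.+1 -> bool}}|%:R.
Let lam0 : (0 < lam)%N := ltnW lam_gt1.

Let lv_le i j : (l j <= l i)%N -> (lv (l j) <= lv (l i))%N.
Proof. by move=> h; rewrite leq_add2r leq_mul2l h orbT. Qed.

Let lv_lt i j : (l j < l i)%N -> (lv (l j) + 2 <= lv (l i))%N.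
Proof. by rewrite /lv; nia. Qed.

Section Off.
Variable o : int.
Hypothesis oE : o = 0 \/ o = m.
Let I j t := cell (lv (l j)) t == k j + o.
Let M j t := I j t && mid (lv (l j)) t.
Let sw j := hswap (lv (l j)) (k j + o).

Let swK j : (j < n)%N -> involutive (sw j).
Proof. by move=> jn; apply: hswapK; rewrite ltnW ?lv1. Qed.

Let sw_cell i j t : (j < n)%N -> (lv (l j) <= lv (l i))%N ->
  cell (lv (l i)) (hswap (lv (l j)) (k j + o) t) = cell (lv (l i)) t.
Proof. by move=> jn ji; apply: cell_hswap; rewrite ltnW ?lv1. Qed.

Let sww j : (j < n)%N -> {in w, forall t, sw j t \in w}.
Proof.
move=> jn t tw; rewrite /sw; have [e|ne] := eqVneq (cell (lv (l j)) t) (k j + o).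
  apply: (ww jn); rewrite sw_cell// e.
  by case: oE => ->; [left; rewrite addr0|right].
by rewrite /hswap (negbTE ne).
Qed.

Let ne_o i j : (i < j < n)%N -> (lv (l i), k i + o) != (lv (l j), k j + o).
Proof.
move=> ij; have := distinct ij; apply: contraNneq => -[e ke].
have -> : k i = k j by lia.
have -> // : l i = l j.
by move: e => /addIn/eqP; rewrite eqn_mul2l eqn0Ngt lam0/= => /eqP.
Qed.

Let lv_ok i j : (i < j < n)%N -> (0 < lv (l j) <= lv (l i))%N.
Proof.
move=> ij; have /andP[_ jn] := ij.
by rewrite ltnW ?lv1//= lv_le// sorted.
Qed.

Lemma shift_hz_anti j : (j < n)%N -> {in w, forall t,
   hz (lv (l j)) (k j + o) (sw j t) = - hz (lv (l j)) (k j + o) t}.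
Proof. by move=> jn t tw; rewrite hz_anti// ltnW ?lv1. Qed.

Lemma shift_hz_inv i j : (i < j < n)%N -> {in w, forall t,
   hz (lv (l i)) (k i + o) (sw j t) = hz (lv (l i)) (k i + o) t}.
Proof. by move=> ij t tw; rewrite hz_inv ?lv_ok ?ne_o. Qed.

Lemma radsum_le_hz : RS (fun j t => (I j t)%:R) <=
  c * (U `^ p * DS (fun j t => hz (lv (l j)) (k j + o) t)).
Proof.
exact: (radsum_le_detsum umd a uw (leqnSn n) swK sww shift_hz_anti shift_hz_inv).
Qed.

Lemma hz_le_radsum : c * DS (fun j t => hz (lv (l j)) (k j + o) t) <=
  U `^ p * RS (fun j t => (I j t)%:R).
Proof.
exact: (detsum_le_radsum umd a uw (leqnSn n) swK sww shift_hz_anti shift_hz_inv).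
Qed.

(** The outer quarters of a cell are the image of its middle half under the exchange of the two
    halves, so that [radsum_swap] applies. Here it matters that the middle half of a coarser cell
    is a union of the finer cells of the class. *)
Lemma radsum_mid : RS (fun j t => (I j t)%:R) <=
  2 `^ p * (U `^ p * RS (fun j t => (M j t)%:R)).
Proof.
have h1 : RS (fun j t => (I j t && ~~ mid (lv (l j)) t)%:R) <=
          U `^ p * RS (fun j t => (M j t)%:R).
  apply: (radsum_swap umd a uw (leqnSn n) (psi := sw)) => //.
  - move=> j jn t tw; rewrite /M /I /sw sw_cell//.
    by rewrite mid_hswap ?lv1//; case: eqP.
  - move=> i j ij t tw; have /andP[ij' jn] := ij.
    rewrite /M /I /sw sw_cell ?lv_le ?sorted//.
    have := sorted ij; rewrite leq_eqVlt => /predU1P[e|lt].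
      case ci : (cell (lv (l i)) t == k i + o) => //=.
      rewrite /hswap; case: ifP => // /eqP cj.
      by have := ne_o ij; rewrite -(eqP ci) -cj e eqxx.
    have lt2 : (lv (l j) <= lv (l i) - 2)%N by have := lv_lt lt; lia.
    by rewrite (mid_coarse lt2 (sw_cell t jn (leqnn _))).
  - move=> i j ij t tw; have /andP[ij' jn] := ij.
    rewrite /M /I /sw sw_cell ?lv_le ?sorted//.
    have := sorted ij; rewrite leq_eqVlt => /predU1P[e|lt].
      case ci : (cell (lv (l i)) t == k i + o) => //=.
      rewrite /hswap; case: ifP => // /eqP cj.
      by have := ne_o ij; rewrite -(eqP ci) -cj e eqxx.
    have lt2 : (lv (l j) <= lv (l i) - 2)%N by have := lv_lt lt; lia.
    by rewrite (mid_coarse lt2 (sw_cell t jn (leqnn _))).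
have h2 : RS (fun j t => (I j t)%:R) <= 2 `^ p * (2^-1 *
   (RS (fun j t => (M j t)%:R) + RS (fun j t => (I j t && ~~ mid (lv (l j)) t)%:R))).
  apply: (radsum_avg p1 n a) => j t jn tw; rewrite /M.
  by case: (I j t); case: mid => //=; rewrite ?addr0 ?add0r.
apply: (le_trans h2); rewrite ler_wpM2l ?powR_ge0//.
have := radsum_ge0 p n w n a (fun j t => (M j t)%:R).
have := Up1 p1 U1; move: h1; move: (RS _) (RS _) (U `^ p) => x y V; nra.
Qed.

End Off.

Definition memE (o : int) (j : nat) (t : int) : bool :=
  `[< Eset (l j) (k j + o) t >].

Lemma memE_cell o j t : memE o j t -> cell (lv (l j)) t == k j + o.
Proof. by move/asboolP/Eset_cell => ->. Qed.

Lemma mid_memE o j t : (j < n)%N ->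
  (cell (lv (l j)) t == k j + o) && mid (lv (l j)) t -> memE o j t.
Proof. by move=> jn /andP[/eqP e h]; apply/asboolP; apply: mid_Eset => //; exact: lv1. Qed.

Lemma memE_sat o i j s t : (l j < l i)%N -> (j < n)%N ->
  Pset (l j) (k j) s -> Pset (l j) (k j) t -> memE o i s = memE o i t.
Proof.
move=> lt jn Ps Pt; apply/asboolP/asboolP => Es.
- exact: (Eset_sat act_disj lt (actk jn) Ps Es Pt).
- exact: (Eset_sat act_disj lt (actk jn) Pt Es Ps).
Qed.

Lemma memE_Pset o j t : o = 0 \/ o = m -> memE o j t -> Pset (l j) (k j) t.
Proof. by case=> -> /asboolP; [rewrite addr0; left|right]. Qed.

Lemma memE_tau j t : memE m j (t + m * (2 ^ lv (l j))%:Z) = memE 0 j t.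
Proof.
have h := Eset_tau r act_even lam_gt1 (l j) (k j) t.
by apply/asboolP/asboolP; rewrite addr0 => /h.
Qed.

(** Exchanges E of a cell with E of its translate. The use of E instead of the full cell is what
    leaves all coarser sets E invariant: by saturation, they contain both points or neither. *)
Definition tauswap (j : nat) (t : int) : int :=
  if memE 0 j t then t + m * (2 ^ lv (l j))%:Z
  else if memE m j t then t - m * (2 ^ lv (l j))%:Z else t.

Lemma m_neq0 j : (j < n)%N -> m != 0.
Proof.
by move=> /actk ak; apply: contraTneq (act_disj ak) => ->; rewrite addr0 ak.
Qed.

Lemma memE_disj j t : (j < n)%N -> memE 0 j t -> ~~ memE m j t.
Proof.
move=> jn /memE_cell/eqP h; apply/negP => /memE_cell; rewrite h => /eqP.
by have := m_neq0 jn; lia.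
Qed.

Lemma memE_tauswap j t : (j < n)%N -> memE 0 j (tauswap j t) = memE m j t.
Proof.
move=> jn; rewrite /tauswap; case: ifP => h0.
  rewrite (negbTE (memE_disj jn h0)); apply/negbTE/negP => /(memE_disj jn).
  by rewrite memE_tau h0.
by case: ifP => hm //; rewrite -memE_tau subrK.
Qed.

Lemma memE_tauswap' j t : (j < n)%N -> memE m j (tauswap j t) = memE 0 j t.
Proof.
move=> jn; rewrite /tauswap; case: ifP => h0; first by rewrite memE_tau.
case: ifP => hm; last by rewrite hm.
by apply/negbTE/negP => h; have := memE_disj jn; move/(_ (t - m * (2 ^ lv (l j))%:Z));
 rewrite -memE_tau subrK hm h => /(_ isT).
Qed.

Lemma tauswapK j : (j < n)%N -> involutive (tauswap j).
Proof.
move=> jn t; rewrite [LHS]/tauswap memE_tauswap// memE_tauswap'//.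
rewrite /tauswap; case h0 : (memE 0 j t); first by rewrite (negbTE (memE_disj jn h0)) addrK.
by case: (memE m j t); rewrite ?subrK.
Qed.

Lemma tauswap_Pset j t : (j < n)%N -> tauswap j t = t \/
  (Pset (l j) (k j) t /\ Pset (l j) (k j) (tauswap j t)).
Proof.
move=> jn; case h0 : (memE 0 j t).
  right; split; first by apply: memE_Pset h0; left.
  by apply: (@memE_Pset m); [right|rewrite memE_tauswap'].
case hm : (memE m j t); last by left; rewrite /tauswap h0 hm.
right; split; first by apply: memE_Pset hm; right.
by apply: (@memE_Pset 0); [left|rewrite memE_tauswap].
Qed.

Lemma memE_tauswap_coarse o i j t : o = 0 \/ o = m -> (i < j < n)%N ->
  memE o i (tauswap j t) = memE o i t.
Proof.
move=> oE ij; have /andP[ij' jn] := ij.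
case: (tauswap_Pset t jn) => [-> //|[P1 P2]].
have := sorted ij; rewrite leq_eqVlt => /predU1P[e|lt]; last exact: (memE_sat _ lt jn).
have F s : Pset (l j) (k j) s -> memE o i s = false.
  move=> Ps; apply/negP => /(memE_Pset oE); rewrite -e => Pi.
  have := distinct ij; rewrite -e; have -> := Pset_inj act_disj (actk (ltn_trans ij' jn)) (actk jn) Pi Ps.
  by rewrite eqxx.
by rewrite !F.
Qed.

(** The chain of comparisons leads from the Haar function of the translate to the indicator of its
    cell, of the middle half, and of E of the translate, then to the indicators of E and of the
    cell, and to its Haar function. The factors are U, 2 U, 1, U, 1 and U. *)
Lemma hz_shift :
  DS (fun j t => hz (lv (l j)) (k j + m) t) <=
  (2 * U ^+ 4) `^ p * DS (fun j t => hz (lv (l j)) (k j) t).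
Proof.
have s1 : c * DS (fun j t => hz (lv (l j)) (k j + m) t) <= _ := hz_le_radsum (or_intror erefl).
have s2 := radsum_mid (or_intror (erefl m)).
have s3 := radsum_contract p1 w a (leqnSn n)
   (A := fun j t => (cell (lv (l j)) t == k j + m) && mid (lv (l j)) t) (@mid_memE m).
have s4 : RS (fun j t => (memE m j t)%:R) <= U `^ p * RS (fun j t => (memE 0 j t)%:R).
  apply: (radsum_swap umd a uw (leqnSn n) (psi := tauswap)).
  - exact: tauswapK.
  - move=> j jn t tw; case: (tauswap_Pset t jn) => [-> //|[_]].
    by move=> [/Eset_cell|/Eset_cell] h; apply: (ww jn); [left|right].
  - by move=> j jn t tw; rewrite memE_tauswap.
  - by move=> i j ij t tw; rewrite memE_tauswap_coarse//; left.
  - by move=> i j ij t tw; rewrite memE_tauswap_coarse//; right.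
have s5 := radsum_contract p1 w a (leqnSn n) (fun j t (_ : (j < n)%N) => @memE_cell 0 j t).
have s6 := radsum_le_hz (or_introl (erefl 0)).
have c0 : 0 < c by rewrite ltr0n; apply/card_gt0P; exists [ffun=> false].
rewrite -(ler_pM2l c0).
have -> : DS (fun j t => hz (lv (l j)) (k j) t) = DS (fun j t => hz (lv (l j)) (k j + 0) t).
  by apply: eq_bigr => t _; under eq_bigr do rewrite -[k _]addr0.
have U0 : 0 <= U := le_trans ler01 U1.
have -> : c * ((2 * U ^+ 4) `^ p * DS (fun j t => hz (lv (l j)) (k j + 0) t)) =
    U `^ p * (2 `^ p * (U `^ p * (U `^ p *
      (c * (U `^ p * DS (fun j t => hz (lv (l j)) (k j + 0) t)))))).
  by rewrite !exprS expr0 mulr1 !powRM ?mulr_ge0//; ring.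
apply: (le_trans s1); rewrite ler_wpM2l ?powR_ge0//.
apply: (le_trans s2); rewrite ler_wpM2l ?powR_ge0// ler_wpM2l ?powR_ge0//.
apply: (le_trans s3); apply: (le_trans s4); rewrite ler_wpM2l ?powR_ge0//.
by apply: (le_trans s5); apply: (le_trans s6).
Qed.

End Shift.
End GridHaar.

(** * Functions with finitely many values and their integrals *)

Section FinMeas.
Context {d : measure_display} {T : measurableType d}.

(** This is [simple_fun measurable] with values in an arbitrary type, so that Boolean functions and
    pairs of functions can be combined. *)
Definition finmeas {Y : Type} (f : T -> Y) : Prop :=
  finite_set (range f) /\ forall y, measurable (f @^-1` [set y]).

Lemma finmeas_preimage {Y : Type} (f : T -> Y) (B : set Y) :
  finmeas f -> measurable (f @^-1` B).
Proof.
move=> [ff mf].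
have -> : f @^-1` B = \bigcup_(y in range f `&` B) (f @^-1` [set y]).
  apply/seteqP; split=> [t Bt|t [y [_ By] /= ->]//].
  by exists (f t) => //; split=> //; exists t.
apply: fin_bigcup_measurable => //; exact: finite_setIl.
Qed.

Lemma finmeas_comp {Y Z : Type} (f : T -> Y) (h : Y -> Z) :
  finmeas f -> finmeas (h \o f).
Proof.
move=> ff; split=> [|z]; last by rewrite comp_preimage; exact: finmeas_preimage.
by rewrite -(image_comp f h); apply: finite_image; case: ff => + _.
Qed.

Lemma finmeas_pair {Y Z : Type} (f : T -> Y) (g : T -> Z) :
  finmeas f -> finmeas g -> finmeas (fun t => (f t, g t)).
Proof.
move=> [ff mf] [fg mg]; split=> [|[y z]].
  apply: (@sub_finite_set _ _ (range f `*` range g)); last exact: finite_setX.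
  by move=> _ [t _ <-]; split; exists t.
have -> : (fun t => (f t, g t)) @^-1` [set (y, z)] = f @^-1` [set y] `&` g @^-1` [set z].
  by apply/seteqP; split=> t /=; [case|case=> -> ->].
exact: measurableI.
Qed.

Lemma finmeas_comp2 {Y Z V : Type} (f : T -> Y) (g : T -> Z) (h : Y -> Z -> V) :
  finmeas f -> finmeas g -> finmeas (fun t => h (f t) (g t)).
Proof.
move=> ff fg; exact: (finmeas_comp (fun yz => h yz.1 yz.2) (finmeas_pair ff fg)).
Qed.

Lemma finmeas_cst {Y : Type} (y : Y) : finmeas (fun _ : T => y).
Proof.
split=> [|z]; first by apply: (@sub_finite_set _ _ [set y]) => // _ [t _ <-].
rewrite preimage_cst; case: ifP => _ //; exact: measurable0.
Qed.

Lemma finmeas_set (A : set T) : measurable A -> finmeas (fun t => `[< A t >]).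
Proof.
move=> mA; split=> [|b]; first exact: finite_finset.
have -> : (fun t => `[< A t >]) @^-1` [set b] = if b then A else ~` A.
  apply/seteqP; split=> t /=.
    by case: b => [/asboolP//|/asboolPn].
  by case: b => h; [exact/asboolP|exact/asboolPn].
by case: b => //; exact: measurableC.
Qed.

Lemma finmeas_measurable {R : realType} {Y : Type} (f : T -> Y) (h : Y -> R) :
  finmeas f -> measurable_fun setT (fun t => h (f t)).
Proof.
move=> ff _ B mB; rewrite setTI.
exact: (finmeas_preimage (h @^-1` B) ff).
Qed.

End FinMeas.

Section Fibre.
Context {d : measure_display} {T : measurableType d} {R : realType}.
Variable mu : {measure set T -> \bar R}.
Context {K : choiceType}.
Variables (phi : T -> K) (W : seq K).
Hypothesis uW : uniq W.
Hypothesis mphi : forall k, k \in W -> measurable (phi @^-1` [set k]).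

Lemma integral_fibre (g : K -> R) : (forall k, 0 <= g k) ->
    (forall k, k \notin W -> g k = 0) ->
  (\int[mu]_t (g (phi t))%:E =
   \sum_(k <- W) (g k)%:E * mu (phi @^-1` [set k]))%E.
Proof.
move=> g0 gW.
have -> : (fun t => (g (phi t))%:E) = (fun t => \sum_(k <- W)
    if k \in W then (g k)%:E * (\1_(phi @^-1` [set k]) t)%:E else 0)%E.
  apply/funext => t; have [tW|tW] := boolP (phi t \in W); last first.
    rewrite gW// big1_seq// => k /andP[_ kW]; rewrite kW.
    by rewrite indicE memNset ?mule0//= => e; rewrite e kW in tW.
  rewrite (bigD1_seq (phi t))//= tW indicE mem_set//= mule1 big1 ?adde0//.
  move=> k kt; case: ifP => // _.
  by rewrite indicE memNset ?mule0//= => e; rewrite e eqxx in kt.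
rewrite ge0_integral_sum//.
- rewrite big_seq [RHS]big_seq; apply: eq_bigr => k kW; rewrite kW.
  rewrite ge0_integralZl//.
  + by rewrite integral_indic ?setIT//; exact: mphi.
  + by apply/measurable_EFinP/measurable_indic; exact: mphi.
  + by rewrite lee_fin.
- move=> k; case kW : (k \in W); last exact: measurable_cst.
  by apply: measurable_funeM; apply/measurable_EFinP/measurable_indic; exact: mphi.
- by move=> k t _; case: ifP => // _; rewrite -EFinM lee_fin mulr_ge0// indicE; case: (_ \in _).
Qed.

Lemma mu_fibre (P : pred K) : (forall k, P k -> k \in W) ->
  mu (phi @^-1` [set k | P k]) =
    (\sum_(k <- W | P k) mu (phi @^-1` [set k]))%E.
Proof.
move=> PW.
have mP : measurable (phi @^-1` [set k | P k]).
  have -> : phi @^-1` [set k | P k] = \big[setU/set0]_(k <- W | P k) (phi @^-1` [set k]).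
    apply/seteqP; split=> t /=.
      by move=> Pt; rewrite -bigcup_seq_cond; exists (phi t) => //=; rewrite PW.
    by rewrite -bigcup_seq_cond => -[k /= /andP[_ Pk] ->].
  by apply: bigsetU_measurable => k /PW /mphi.
have := @integral_fibre (fun k => (P k)%:R).
rewrite (_ : (fun t => _) = fun t => (\1_(phi @^-1` [set k | P k]) t)%:E); last first.
  apply/funext => t; rewrite indicE; congr ((nat_of_bool _)%:R%:E).
  by apply/idP/idP => [h|/set_mem//]; exact/mem_set.
rewrite integral_indic ?setIT// => ->//.
- by rewrite [RHS]big_mkcond; apply: eq_bigr => k _; case: (P k); rewrite ?mul1e ?mul0e.
- by move=> k; apply: contraNeq; rewrite pnatr_eq0 eqb0 negbK; exact: PW.
Qed.

(** The integral of a simple function may be computed along any function [phi] through which it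
    factors, for instance along a common refinement of two simple functions. *)
Lemma simple_int_fibre {X : completeNormedModType R} (g : K -> X) :
    (forall k, k \notin W -> g k = 0) ->
    (forall k, k \in W -> (mu (phi @^-1` [set k]) < +oo)%E) ->
  simple_int mu (fun t => g (phi t)) =
    \sum_(k <- W) fine (mu (phi @^-1` [set k])) *: g k.
Proof.
move=> gW fW; rewrite /simple_int; set s := fun t => _.
pose V := undup (0 :: map g W).
have sV t : s t \in V.
  rewrite mem_undup inE; have [tW|tW] := boolP (phi t \in W).
    by apply/orP; right; exact: map_f.
  by rewrite /s gW// eqxx.
rewrite (@fsbig_widen _ _ _ _ _ [set` V]); last 2 first.
- by move=> _ [t _ <-] /=.
- move=> x [_ xs] /=; have -> : s @^-1` [set x] = set0.
    by apply/seteqP; split=> t //= e; apply: xs; exists t.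
  by rewrite measure0 scale0r.
rewrite -fsbig_seq ?undup_uniq//.
have E x : x != 0 -> fine (mu (s @^-1` [set x])) =
    \sum_(k <- W | g k == x) fine (mu (phi @^-1` [set k])).
  move=> x0; have -> : s @^-1` [set x] = phi @^-1` [set k | g k == x].
    by apply/seteqP; split=> t /= /eqP.
  rewrite mu_fibre; last first.
    by move=> k /eqP kx; apply: contraNT x0 => /gW <-; rewrite kx.
  rewrite [RHS]big_seq_cond sum_fine -?big_seq_cond//.
  by move=> k /andP[kW _]; rewrite ge0_fin_numE// fW.
transitivity (\sum_(x <- V) \sum_(k <- W | g k == x) fine (mu (phi @^-1` [set k])) *: g k).
  apply: eq_bigr => x _; have [->|x0] := eqVneq x 0.
    by rewrite scaler0 big1// => k /eqP ->; rewrite scaler0.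
  by rewrite E// scaler_suml; apply: eq_bigr => k /eqP ->.
under eq_bigr do rewrite big_mkcond/=.
rewrite exchange_big/= big_seq [RHS]big_seq; apply: eq_bigr => k kW.
rewrite (bigD1_seq (g k))/= ?undup_uniq//; last first.
  by rewrite mem_undup inE map_f ?orbT.
by rewrite eqxx big1 ?addr0// => x; rewrite eq_sym => /negbTE ->.
Qed.

End Fibre.

(** * From martingales to symmetric differences *)

Section LpPow.
Context {d : measure_display} {T : measurableType d} {R : realType}
  {X : completeNormedModType R}.
Variables (mu : {measure set T -> \bar R}) (p : R).
Hypothesis p1 : 1 < p.

Let p0 : 0 < p := lt_trans ltr01 p1.

Lemma Lp_normE (f : T -> X) :
  (Lp_norm mu p f = (\int[mu]_t (`|f t| `^ p)%:E) `^ p^-1)%E.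
Proof.
rewrite /Lp_norm Lnorm.unlock.
by under eq_integral => t _ do rewrite /= normr_id.
Qed.

Lemma Lp_norm_pow (f : T -> X) :
  (Lp_norm mu p f `^ p = \int[mu]_t (`|f t| `^ p)%:E)%E.
Proof.
rewrite Lp_normE -poweRrM mulVf ?gt_eqF// poweRe1//.
by apply: integral_ge0 => t _; rewrite lee_fin powR_ge0.
Qed.

Lemma Lp_norm_leP (f g : T -> X) (c : R) : 0 <= c ->
  ((Lp_norm mu p f <= c%:E * Lp_norm mu p g) <->
  (\int[mu]_t (`|f t| `^ p)%:E <= (c `^ p)%:E * \int[mu]_t (`|g t| `^ p)%:E))%E.
Proof.
move=> c0; rewrite -!Lp_norm_pow.
have Lf : (0 <= Lp_norm mu p f)%E by exact: Lnorm_ge0.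
have Lg : (0 <= Lp_norm mu p g)%E by exact: Lnorm_ge0.
have E : ((c `^ p)%:E * Lp_norm mu p g `^ p = (c%:E * Lp_norm mu p g) `^ p)%E.
  by rewrite poweRM ?lee_fin// poweR_EFin.
rewrite E; split => h.
  by apply: gt0_ler_poweR => //; rewrite ?in_itv/= ?leey ?andbT ?Lf ?mule_ge0// ltW.
have pV : (0 <= p^-1)%R by rewrite invr_ge0 ltW.
have := @gt0_ler_poweR R p^-1 pV _ _ _ _ h.
rewrite -!poweRrM !mulfV ?gt_eqF// !poweRe1 ?mule_ge0//.
by apply; rewrite in_itv/= leey poweR_ge0.
Qed.

End LpPow.

Section FiniteUMD.
Context {R : realType} {X : completeNormedModType R}.
Variables (p U : R).
Hypothesis p1 : 1 < p.
Hypothesis U0 : 0 <= U.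

(** The uniform probability on the first [n] naturals; the Dirac measure is the value that
    [mnormalize] takes for [n = 0]. *)
Definition unif (n : nat) : probability nat R :=
  mnormalize (msum (fun i : nat => \d_i : {measure set nat -> \bar R}) n) (\d_0%N).

Lemma unif_fibre n i : (i < n)%N -> unif n [set i] = (n%:R^-1)%:E.
Proof.
move=> lt_in; have n0 : (0 < n)%N by apply: leq_ltn_trans lt_in.
have tot : msum (fun i : nat => \d_i : {measure set nat -> \bar R}) n setT = n%:R%:E.
  rewrite /msum (eq_bigr (fun=> 1%:E)); last by move=> j _; exact: diracT.
  by rewrite sumEFin sumr_const card_ord.
set m := msum _ n in tot.
rewrite [LHS](_ : _ = (if (m setT == 0) || (m setT == +oo) then
   (\d_0%N : set nat -> \bar R) else fun A => m A * ((fine (m setT))^-1)%:E) [set i])%E//.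
rewrite tot eqe pnatr_eq0 eqn0Ngt n0/= /m.
rewrite /msum (bigD1 (Ordinal lt_in))//= big1 ?adde0.
  by rewrite [X in (X * _)%E]diracE mem_set// mul1e.
move=> j ji; rewrite [LHS]diracE memNset//= => e.
by move: ji; rewrite -val_eqE/= e eqxx.
Qed.

(** Points are numbered by their index in the list [s], and the filtration is the one generated by the
    differences, encoded by saturation: a set is in [F k] if it contains with a point all points
    where the first differences agree. The involution [phi k.+1] preserves the sets of [F k] and
    reverses the difference, whence the conditional mean 0. *)
Lemma sym_umd_of_UMD : UMD_bound X p U -> sym_umd (X := X) p U.
Proof.
move=> umd T s n d phi eps us phiK phis dphi djphi.
case: s us phis dphi djphi => [|x0 s'] us phis dphi djphi; first by rewrite !big_nil mulr0.
set s := x0 :: s' in us phis dphi djphi *.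
have [N NE] : exists N, N = size s by exists (size s).
have N0 : (0 < N)%N by rewrite NE.
pose dif j i := if (i < N)%N && (j < n)%N then d j (nth x0 s i) else 0 : X.
pose F k : set (set nat) := [set A | forall i i',
  (forall j, (j <= k)%N -> dif j i = dif j i') -> A i -> A i'].
have fin_dif j : finite_set (range (dif j)).
  apply: (@sub_finite_set _ _ [set` 0 :: map (d j) s]); last exact: finite_seq.
  move=> _ [i _ <-]; rewrite /mkset /dif in_cons; case: ifP => [/andP[iN _]|_]; last by rewrite eqxx.
  by rewrite map_f ?orbT// mem_nth// -NE.
have simple_dif G j : (forall x, G (dif j @^-1` [set x])) -> strongly_measurable G (dif j).
  move=> h; exists (fun=> dif j); split; first by move=> _; split.
  by move=> t; exact: cvg_cst.
have mnat (A : set nat) : measurable A by [].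
have fibre k : (k < N)%N -> (unif N (id @^-1` [set k]) = (N%:R^-1)%:E)%E.
  by move=> kN; rewrite preimage_id unif_fibre.
have intG (g : nat -> R) : (forall i, 0 <= g i) -> (forall i, (N <= i)%N -> g i = 0) ->
    (\int[unif N]_t (g t)%:E = (N%:R^-1 * \sum_(i < N) g i)%:E)%E.
  move=> g0 gN; rewrite (@integral_fibre _ _ _ (unif N) _ id (iota 0 N) (iota_uniq _ _) _ g)//.
  - rewrite mulr_sumr -sumEFin -[in RHS](big_mkord xpredT (fun i => (N%:R^-1 * g i)%:E)).
    rewrite /index_iota subn0 big_seq [RHS]big_seq; apply: eq_bigr => i /=.
    rewrite mem_iota add0n => iN; rewrite mulrC EFinM; congr (_ * _)%E.
    exact: fibre.
  - by move=> k; rewrite mem_iota add0n -leqNgt => /gN.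
have difN j i : (N <= i)%N -> dif j i = 0 by move=> iN; rewrite /dif ltnNge iN.
have saturated k (A : set nat) : F k A -> (k.+1 < n)%N ->
    \sum_(i < N) (\1_A (i : nat) : R) *: dif k.+1 i = 0.
  move=> FA kn; pose c x : R := \1_A (index x s).
  have -> : \sum_(i < N) (\1_A (i : nat) : R) *: dif k.+1 i = \sum_(x <- s) c x *: d k.+1 x.
    rewrite (big_nth x0) -NE big_mkord; apply: eq_bigr => i _.
    by rewrite /c /dif ltn_ord kn index_uniq// -NE.
  set S := \sum_(x <- s) _.
  suff : S = - S by move/eqP; rewrite -addr_eq0 -mulr2n -scaler_nat scaler_eq0 pnatr_eq0/= => /eqP.
  have Ps : perm_eq (map (phi k.+1) s) s.
    apply: uniq_perm => //.
      by rewrite map_inj_uniq//; apply: can_inj (phiK _ kn).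
    move=> x; apply/mapP/idP => [[y ys ->]|xs]; first exact: phis.
    by exists (phi k.+1 x); rewrite ?phiK// phis.
  rewrite {1}/S -(perm_big _ Ps) big_map -sumrN big_seq [RHS]big_seq.
  apply: eq_bigr => x xs; rewrite dphi// scalerN; congr (- (_ *: _)).
  have e j : (j <= k)%N -> dif j (index x s) = dif j (index (phi k.+1 x) s).
    move=> jk; rewrite /dif NE !index_mem xs phis// !nth_index ?phis//.
    by case: ifP => // jn; rewrite djphi// ltnS jk.
  rewrite /c !indicE; congr (nat_of_bool _)%:R.
  apply/idP/idP => /set_mem h; apply/mem_set.
    by apply: FA h => j jk; rewrite e.
  by apply: FA h => j jk; rewrite e.
have md : martingale_difference (unif N) p F dif.
  split.
  - move=> k; split=> /=.
    + by [].
    + move=> A FA i i' ii'; rewrite setTD => + Ai'; apply.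
      by apply: FA Ai' => j jk; rewrite ii'.
    + move=> A FA i i' ii' [m _ Am]; exists m => //; exact: FA Am.
  - by move=> k A _.
  - by move=> k A FA i i' ii'; apply: FA => j jk; apply: ii'; exact: leqW.
  - by move=> k; apply: simple_dif => x i i' ii' /= <-; rewrite ii'.
  - move=> k; split; first exact: simple_dif.
    rewrite Lp_normE poweR_lty// (@intG (fun t => `|dif k t| `^ p)) ?ltry//.
    by move=> i /(difN k) ->; rewrite normr0 powR0// gt_eqF// (lt_trans ltr01).
  - move=> k A FA; set f := fun t => _.
    have sf : simple_fun measurable f.
      split=> //; apply: (@sub_finite_set _ _ (range (dif k.+1) `|` [set 0])).
        move=> _ [i _ <-]; rewrite /f indicE; case: (_ \in _); rewrite ?scale1r ?scale0r.
          by left; exists i.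
        by right.
      by rewrite finite_setU.
    have fN i : (N <= i)%N -> f i = 0 by move=> /(difN k.+1) h; rewrite /f h scaler0.
    split; first by exists (fun=> f); split=> // t; exact: cvg_cst.
    exists (fun=> f); split=> // [m||].
    + rewrite (@intG (fun t => `|f t|)) ?ltry// => i.
      by move=> /fN ->; rewrite normr0.
    + have -> : (\int[unif N]_t (`|f t - f t|)%:E = 0)%E.
        by under eq_integral do rewrite subrr normr0; rewrite integral0.
      exact: cvg_cst.
    + suff -> : simple_int (unif N) f = 0 by exact: cvg_cst.
      rewrite (@simple_int_fibre _ _ _ (unif N) _ id (iota 0 N) (iota_uniq _ _) _ _ f)//.
      * rewrite (eq_big_seq (fun i => N%:R^-1 *: f i)); last first.
          move=> i; rewrite mem_iota add0n => iN; congr (_ *: _).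
          by rewrite -[RHS]/(fine (N%:R^-1)%:E); congr fine; exact: fibre.
        have -> : iota 0 N = index_iota 0 N by rewrite /index_iota subn0.
        rewrite -scaler_sumr big_mkord.
        case: (ltnP k.+1 n) => kn; first by rewrite saturated// scaler0.
        rewrite big1 ?scaler0// => i _.
        by rewrite /f /dif [(k.+1 < n)%N]ltnNge kn andbF scaler0.
      * by move=> i; rewrite mem_iota add0n -leqNgt; exact: fN.
      * move=> i; rewrite mem_iota add0n => iN.
        by apply: (@le_lt_trans _ _ (N%:R^-1)%:E); rewrite ?ltry// le_eqVlt; apply/orP; left; apply/eqP; exact: fibre.
have := umd _ _ (unif N) F dif n eps md.
rewrite (Lp_norm_leP _ p1 _ _ U0).
have z0 : 0 `^ p = 0 by rewrite powR0// gt_eqF// (lt_trans ltr01).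
rewrite (@intG (fun t => `|\sum_(j < n) (-1 : R) ^+ eps j *: dif j t| `^ p)); last 2 first.
- by move=> i; exact: powR_ge0.
- by move=> i iN; rewrite big1 ?normr0// => j _; rewrite difN// scaler0.
rewrite (@intG (fun t => `|\sum_(j < n) dif j t| `^ p)); last 2 first.
- by move=> i; exact: powR_ge0.
- by move=> i iN; rewrite big1 ?normr0// => j _; rewrite difN.
rewrite -EFinM lee_fin mulrCA ler_pM2l ?invr_gt0 ?ltr0n//.
congr (_ <= _ * _); rewrite (big_nth x0) -NE big_mkord; apply: eq_bigr => i _;
  by congr (`| _ | `^ _); apply: eq_bigr => j _; rewrite /dif !ltn_ord.
Qed.

End FiniteUMD.

(** * The Bochner space L^p *)

Lemma cvge0_lt (R : realType) (u : nat -> \bar R) : (forall n, 0 <= u n)%E ->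
  (u n @[n --> \oo] --> 0%E) <->
  forall e : R, 0 < e -> exists N, forall n, (N <= n)%N -> (u n < e%:E)%E.
Proof.
move=> u0; split.
  move=> /fine_cvgP[fu /cvgrPdist_lt h] e e0.
  have [N _ HN] := fu; have [M _ HM] := h _ e0.
  exists (maxn N M) => n; rewrite geq_max => /andP[Nn Mn].
  have := HM _ Mn; rewrite /= sub0r normrN -lte_fin => h1.
  rewrite -(fineK (HN _ Nn)); apply: le_lt_trans h1.
  by rewrite lee_fin ler_norm.
move=> h; apply/fine_cvgP; split.
  have [N HN] := h _ ltr01; exists N => // n /= /HN un.
  by rewrite ge0_fin_numE// (lt_trans un) ?ltry.
apply/cvgrPdist_lt => e e0; have [N HN] := h _ e0; exists N => // n /= /HN un.
rewrite sub0r normrN ger0_norm ?fine_ge0// -lte_fin fineK//.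
by rewrite ge0_fin_numE// (lt_trans un) ?ltry.
Qed.

Lemma cvg_of_dist (R : realType) (V : completeNormedModType R) (u : nat -> V)
    (r : nat -> R) : (r n @[n --> \oo] --> (0 : R)) ->
  (forall n m, `|u n - u m| <= r n + r m) -> cvgn u.
Proof.
move=> r0 ur; apply/cauchy_cvgP/cauchy_exP => e e0.
have e20 : 0 < e / 2 by rewrite divr_gt0.
move/cvgrPdist_lt: r0 => /(_ _ e20)[N _ HN].
exists (u N); exists N => // n /= Nn.
rewrite -ball_normE/=; apply: le_lt_trans (ur _ _) _.
have := HN _ Nn; have := HN _ (leqnn N); rewrite /= !sub0r !normrN.
by move=> /(le_lt_trans (ler_norm _)) h1 /(le_lt_trans (ler_norm _)) h2; lra.
Qed.

Lemma powR_cvg_seq (R : realType) (p : R) (u : nat -> R) (l : R) : 0 < p ->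
  (forall n, 0 <= u n) -> u n @[n --> \oo] --> l ->
  u n `^ p @[n --> \oo] --> l `^ p.
Proof.
move=> p0 u0 ul.
have l0 : 0 <= l.
  by rewrite -(cvg_lim _ ul)//; apply: limr_ge; [apply/cvg_ex; exists l|exact: nearW].
move: l0; rewrite le_eqVlt => /predU1P[l0|l0]; last first.
  have c : {for l, continuous (@powR R ^~ p)}.
    apply: differentiable_continuous; apply/derivable1_diffP.
    by apply: derivable_powR; rewrite in_itv/= l0.
  exact: (@cvg_comp _ _ _ u (@powR R ^~ p) _ _ _ ul c).
rewrite -l0 powR0 ?gt_eqF//; apply/cvgrPdist_lt => e e0.
have d0 : 0 < e `^ p^-1 by exact: powR_gt0.
move: ul; rewrite -l0 => /cvgrPdist_lt /(_ _ d0)[N _ HN]; exists N => // n /= /HN/=.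
rewrite !sub0r !normrN !ger0_norm ?powR_ge0// => h.
have -> : e = (e `^ p^-1) `^ p by rewrite -powRrM mulVf ?gt_eqF// powRr1// ltW.
by apply: gt0_ltr_powR => //; rewrite nnegrE ?u0// ltW.
Qed.

Section LpSpace.
Context {d : measure_display} {T : measurableType d} {R : realType}
  {X : completeNormedModType R}.
Variables (mu : {measure set T -> \bar R}).

Local Notation smeas := (@strongly_measurable d T R X measurable).

Lemma smeas_simple (s : T -> X) : simple_fun measurable s -> smeas s.
Proof. by move=> ss; exists (fun=> s); split=> // t; exact: cvg_cst. Qed.

Lemma smeasD (f g : T -> X) : smeas f -> smeas g -> smeas (fun t => f t + g t).
Proof.
move=> [s [ss sf]] [s' [ss' sg]]; exists (fun n t => s n t + s' n t); split.
  by move=> n; exact: (finmeas_comp2 +%R (ss n) (ss' n)).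
by move=> t; apply: cvgD.
Qed.

Lemma smeasZ (c : R) (f : T -> X) : smeas f -> smeas (fun t => c *: f t).
Proof.
move=> [s [ss sf]]; exists (fun n t => c *: s n t); split.
  by move=> n; exact: (finmeas_comp ( *:%R c) (ss n)).
by move=> t; apply: cvgZr.
Qed.

Lemma smeasB (f g : T -> X) : smeas f -> smeas g -> smeas (fun t => f t - g t).
Proof.
move=> ff gg; have := smeasD ff (smeasZ (-1) gg).
by under eq_fun do rewrite scaleN1r.
Qed.

Lemma smeas_norm (f : T -> X) : smeas f -> measurable_fun setT (fun t => `|f t|).
Proof.
move=> [s [ss sf]].
apply: (measurable_fun_cvg (h := fun n t => `|s n t|)).
  by move=> n; exact: (finmeas_measurable Num.norm (ss n)).
by move=> t _; apply: cvg_norm.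
Qed.

Lemma smeas_norm_pow (p : R) (f : T -> X) : smeas f ->
  measurable_fun setT (fun t => (`|f t| `^ p)%:E).
Proof.
move=> ff; apply/measurable_EFinP.
exact: (@measurableT_comp _ _ _ _ _ _ (@powR R ^~ p) _ (fun t => `|f t|) (measurable_powR _) (smeas_norm ff)).
Qed.

Lemma smeas_enorm (f : T -> X) : smeas f -> measurable_fun setT (fun t => (`|f t|)%:E).
Proof. by move=> ff; apply/measurable_EFinP; exact: smeas_norm. Qed.

Variable p : R.
Hypothesis p1 : 1 < p.
Let p0 : 0 < p := lt_trans ltr01 p1.
Local Notation nrm := (Lp_norm mu p).

Lemma Lp_ge0 (f : T -> X) : (0 <= nrm f)%E.
Proof. exact: Lnorm_ge0. Qed.

Lemma Lp_le (f g : T -> X) : smeas f -> smeas g -> (forall t, `|f t| <= `|g t|) ->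
  (nrm f <= nrm g)%E.
Proof.
move=> mf mg fg; rewrite -[leRHS]mul1e; apply/(Lp_norm_leP _ p1) => //.
rewrite powR1 mul1e; apply: ge0_le_integral => //.
- exact: smeas_norm_pow.
- exact: smeas_norm_pow.
- by move=> t _; rewrite lee_fin ge0_ler_powR ?nnegrE// ltW.
Qed.

Lemma eq_Lp (f g : T -> X) : f =1 g -> nrm f = nrm g.
Proof. by move=> fg; congr Lp_norm; exact/funext. Qed.

Lemma LpD (f g : T -> X) : smeas f -> smeas g ->
  (nrm (fun t => (f t + g t)%R) <= nrm f + nrm g)%E.
Proof.
move=> mf mg.
apply: le_trans (minkowski_EFin mu (smeas_norm mf) (smeas_norm mg) (ltW p1)).
rewrite Lp_normE Lnorm.unlock; apply: gt0_ler_poweR.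
- by rewrite invr_ge0 ltW.
- by rewrite in_itv/= leey andbT integral_ge0// => t _; rewrite lee_fin powR_ge0.
- by rewrite in_itv/= leey andbT integral_ge0// => t _; exact: poweR_ge0.
- apply: ge0_le_integral => //.
  + exact: (smeas_norm_pow p (smeasD mf mg)).
  + apply/measurable_EFinP.
    apply: (@measurableT_comp _ _ _ _ _ _ (@powR R ^~ p) _ _ (measurable_powR _)).
    apply: measurableT_comp => //; apply: measurable_funD; exact: smeas_norm.
  + move=> t _; rewrite /= lee_fin ge0_ler_powR ?nnegrE ?(ltW p0)//.
    exact: le_trans (ler_normD _ _) (ler_norm _).
Qed.

Lemma LpZ (c : R) (f : T -> X) : smeas f -> nrm (fun t => c *: f t) = (`|c|%:E * nrm f)%E.
Proof.
move=> mf; rewrite !Lp_normE.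
under eq_integral do rewrite powR_normZ EFinM.
rewrite ge0_integralZl ?lee_fin ?powR_ge0//; last exact: smeas_norm_pow.
rewrite poweRM ?lee_fin ?powR_ge0//; last first.
  by apply: integral_ge0 => t _; rewrite lee_fin powR_ge0.
by rewrite poweR_EFin -powRrM mulfV ?gt_eqF// powRr1.
Qed.

Lemma LpN (f : T -> X) : nrm (fun t => - f t) = nrm f.
Proof. by rewrite /Lp_norm; congr Lnorm; apply/funext => t; rewrite normrN. Qed.

Lemma Lp0 : nrm (fun=> 0 : X) = 0%E.
Proof.
rewrite Lp_normE; under eq_integral do rewrite normr0 powR0 ?gt_eqF//.
by rewrite integral0 poweR0r// invr_neq0// gt_eqF.
Qed.

Lemma LpBC (f g : T -> X) : nrm (fun t => f t - g t) = nrm (fun t => g t - f t).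
Proof. by rewrite -LpN; apply: eq_Lp => t; rewrite opprB. Qed.

Lemma LpB_tri (h f g : T -> X) : smeas f -> smeas g -> smeas h ->
  (nrm (fun t => (f t - g t)%R) <= nrm (fun t => (f t - h t)%R) + nrm (fun t => (h t - g t)%R))%E.
Proof.
move=> mf mg mh; rewrite (eq_Lp (g := fun t => (f t - h t) + (h t - g t))).
  by apply: LpD; exact: smeasB.
by move=> t; rewrite addrA subrK.
Qed.

Lemma Lp_sum (I : Type) (s : seq I) (f : I -> T -> X) : (forall i, smeas (f i)) ->
  smeas (fun t => \sum_(i <- s) f i t) /\
  (nrm (fun t => (\sum_(i <- s) f i t)%R) <= \sum_(i <- s) nrm (f i))%E.
Proof.
move=> mf; elim: s => [|i s [IH1 IH2]].
  split; first by under eq_fun do rewrite big_nil; exact: (smeas_simple (finmeas_cst _)).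
  by under eq_fun do rewrite big_nil; rewrite Lp0 big_nil.
under eq_fun do rewrite big_cons; split; first exact: smeasD.
rewrite big_cons; apply: (le_trans (LpD (mf i) IH1)); exact: leeD2l.
Qed.

(** The classical proof of completeness. With increments of norm at most a constant times 4 ^- k,
    the p-th powers of 2 ^+ k times the increments have a finite sum of integrals. Hence almost
    everywhere their sum is finite and the increments are bounded by a multiple of 2 ^- k, which
    gives pointwise convergence; Fatou's lemma gives the rate in norm. Off this conull set, the
    limit is set to 0, which keeps it strongly measurable everywhere. *)
Lemma Lp_complete (s : nat -> T -> X) (K : R) : 0 <= K ->
    (forall n, simple_fun measurable (s n)) -> (forall n, (nrm (s n) < +oo)%E) ->
    (forall n m, (n <= m)%N -> (nrm (fun t => (s m t - s n t)%R) <= (K * 4 ^- n)%:E)%E) ->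
  exists f, in_Lp mu p f /\
    forall n, (nrm (fun t => (f t - s n t)%R) <= (K * 4 ^- n)%:E)%E.
Proof.
move=> K0 ss sfin scau.
pose dl k t : R := (2 ^+ k * `|s k.+1 t - s k t|) `^ p.
have dl0 k t : 0 <= dl k t by exact: powR_ge0.
have dlE k t : dl k t = `|2 ^+ k *: (s k.+1 t - s k t)| `^ p.
  by rewrite /dl normrZ ger0_norm// exprn_ge0.
have mdl k : measurable_fun setT (fun t => (dl k t)%:E).
  have := smeas_norm_pow p (smeasZ (2 ^+ k) (smeasB (smeas_simple (ss k.+1)) (smeas_simple (ss k)))).
  by congr measurable_fun; apply/funext => t; rewrite dlE.
pose Phi t := (\sum_(k <oo) (dl k t)%:E)%E.
have Phi0 t : (0 <= Phi t)%E by apply: nneseries_ge0 => k _ _; rewrite lee_fin.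
have mPhi : measurable_fun setT Phi.
  by apply: ge0_emeasurable_sum => // k t _ _; rewrite lee_fin.
have intPhi : (\int[mu]_t Phi t < +oo)%E.
  rewrite integral_nneseries//; last by move=> k t _; rewrite lee_fin.
  apply: (@le_lt_trans _ _ (\sum_(k <oo) (2 * K `^ p / (2 ^ (k + 1))%:R)%:E)%E); last first.
    have /cvg_lim := @cvg_geometric_eseries_half R (2 * K `^ p) 0.
    by move=> ->//; rewrite ltry.
  apply: lee_nneseries => [k _ _|k _].
    by apply: integral_ge0 => t _; rewrite lee_fin.
  have -> : (\int[mu]_t (dl k t)%:E = nrm (fun t => 2 ^+ k *: (s k.+1 t - s k t))%R `^ p)%E.
    by rewrite (Lp_norm_pow _ p1); under eq_integral do rewrite dlE.
  rewrite LpZ; last by apply: smeasB; exact: smeas_simple.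
  rewrite ger0_norm ?exprn_ge0//.
  apply: (@le_trans _ _ ((K * 2 ^- k)%:E `^ p)%E).
    apply: gt0_ler_poweR; rewrite ?in_itv/= ?leey ?andbT ?mule_ge0 ?lee_fin ?exprn_ge0 ?Lp_ge0 ?mulr_ge0 ?invr_ge0 ?exprn_ge0 ?(ltW p0)//.
    apply: (@le_trans _ _ ((2 ^+ k)%:E * (K * 4 ^- k)%:E)%E).
      by rewrite lee_wpmul2l ?lee_fin ?exprn_ge0//; exact: scau.
    rewrite -EFinM lee_fin mulrCA ler_wpM2l// (_ : 4 = 2 * 2 :> R); last by lra.
    by rewrite exprMn invfM mulrA mulfV ?mul1r// expf_neq0.
  rewrite poweR_EFin lee_fin powRM ?invr_ge0 ?exprn_ge0// natrX exprD expr1.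
  rewrite [leRHS](_ : _ = K `^ p * 2 ^- k); last by field; rewrite expf_neq0.
  have k1 : 0 < (2 : R) ^- k <= 1.
    by rewrite invr_gt0 exprn_gt0//= invf_le1 ?exprn_gt0// exprn_ege1// ler1n.
  by rewrite ler_wpM2l ?powR_ge0//; exact: ge1r_powR k1 (ltW p1).
have iPhi : mu.-integrable setT Phi.
  apply/integrableP; split=> //.
  by under eq_integral do rewrite gee0_abs//.
pose B := Phi @^-1` (~` [set +oo%E]).
have mB : measurable B by rewrite -[B]setTI; apply: mPhi => //; apply: measurableC.
have aeB : {ae mu, forall t, B t}.
  have := integrable_ae measurableT iPhi; apply: filterS => t /(_ I) /=.
  by move=> ft e; move: ft; rewrite /= e.
pose s' n t := if `[< B t >] then s n t else 0.
have ss' n : simple_fun measurable (s' n).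
  exact: (finmeas_comp2 (fun (b : bool) (x : X) => if b then x else 0) (finmeas_set mB) (ss n)).
have cvgs' t : cvgn (s' ^~ t).
  rewrite /s'; case: asboolP => Bt; last exact: is_cvg_cst.
  have fin : Phi t \is a fin_num.
    by rewrite ge0_fin_numE// ltey; apply/eqP => e; exact: Bt.
  pose A := 1 + fine (Phi t).
  have A1 : 1 <= A by rewrite lerDl fine_ge0.
  have step k : `|s k.+1 t - s k t| <= A * 2 ^- k.
    rewrite ler_pdivlMr ?exprn_gt0// mulrC; set x := _ * _.
    have xM : x `^ p <= fine (Phi t).
      rewrite -lee_fin fineK//.
      have := @nneseries_lim_ge R (fun k => (dl k t)%:E) xpredT 0 k.+1 (fun n _ _ => dl0 n t).
      apply: le_trans; rewrite big_nat_recr//= -/(dl k t) leeDr//.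
      by apply: sume_ge0 => i _; rewrite lee_fin.
    case: (lerP x 1) => x1; first exact: le_trans A1.
    by apply: (le_trans (le1r_powR (ltW x1) (ltW p1))); rewrite (le_trans xM)// lerDr.
  have tel n k : `|s (n + k)%N t - s n t| <= 2 * A * (2 ^- n - 2 ^- (n + k)%N).
    elim: k => [|k IH]; first by rewrite addn0 !subrr normr0 mulr0.
    rewrite addnS -[_ - s n t](subrKA (s (n + k)%N t)).
    apply: (le_trans (ler_normD _ _)); apply: (le_trans (lerD (step _) IH)).
    by rewrite exprS invfM; lra.
  apply: (@cvg_of_dist _ _ _ (fun n => 2 * A * 2^-1 ^+ n)).
    by apply: cvg_geometric; rewrite ger0_norm//; lra.
  have half n m : (n <= m)%N -> `|s n t - s m t| <= 2 * A * 2^-1 ^+ n + 2 * A * 2^-1 ^+ m.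
    move=> /subnKC <-; rewrite distrC; apply: (le_trans (tel _ _)).
    rewrite -mulrDr ler_wpM2l//; first by rewrite mulr_ge0// (le_trans _ A1).
    by rewrite !exprVn lerD// (@le_trans _ _ 0)// ?oppr_le0 invr_ge0 exprn_ge0.
  move=> n m /=; case: (leqP n m) => [nm|/ltnW mn]; first exact: half.
  by rewrite distrC [leRHS]addrC; exact: half.
pose f t : X := lim (s' n t @[n --> \oo]).
have s'f t : s' n t @[n --> \oo] --> f t by exact: cvgs'.
have mf : smeas f by exists s'.
have fs n : (nrm (fun t => (f t - s n t)%R) <= (K * 4 ^- n)%:E)%E.
  have K4 : 0 <= K * 4 ^- n by rewrite mulr_ge0// invr_ge0 exprn_ge0.
  suff : (\int[mu]_t (`|f t - s n t| `^ p)%:E <= (K * 4 ^- n)%:E `^ p)%E.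
    rewrite -(Lp_norm_pow _ p1) => h; have pV : (0 <= p^-1)%R by rewrite invr_ge0 ltW.
    have := @gt0_ler_poweR R p^-1 pV _ _ _ _ h.
    rewrite -!poweRrM !mulfV ?gt_eqF// !poweRe1 ?Lp_ge0//.
    by apply; rewrite in_itv/= leey ?poweR_ge0 ?lee_fin ?powR_ge0.
  pose h m t := (`|s' m t - s n t| `^ p)%:E.
  have mh m : measurable_fun setT (h m).
    by apply: smeas_norm_pow; apply: smeasB; exact: smeas_simple.
  have h0 m t : (0 <= h m t)%E by rewrite lee_fin powR_ge0.
  have inth m : (n <= m)%N -> (\int[mu]_t h m t <= (K * 4 ^- n)%:E `^ p)%E.
    move=> nm; rewrite (@ge0_ae_eq_integral _ _ _ mu setT (h m)
      (fun t => (`|s m t - s n t| `^ p)%:E))//.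
    - rewrite -(Lp_norm_pow _ p1); apply: gt0_ler_poweR;
        rewrite ?in_itv/= ?leey ?andbT ?lee_fin ?Lp_ge0 ?(ltW p0)//.
      exact: scau.
    - by apply: smeas_norm_pow; apply: smeasB; exact: smeas_simple.
    - case: aeB => N [mN N0 sN]; exists N; split=> // t /= nt; apply: sN => Bt; apply: nt => _.
      by rewrite /h /s' asboolT.
  have lim_h t : (`|f t - s n t| `^ p)%:E = limn_einf (h ^~ t).
    have c : h m t @[m --> \oo] --> (`|f t - s n t| `^ p)%:E.
      apply: cvg_EFin; first by apply: nearW.
      apply: powR_cvg_seq => //; apply: cvg_norm; apply: cvgB => //; exact: cvg_cst.
    by rewrite (cvg_limn_einf_sup c).1.
  under eq_integral do rewrite lim_h.
  apply: (le_trans (fatou mu measurableT mh (fun m t _ => h0 m t))).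
  rewrite limn_einf_lim; apply: lime_le; first exact: is_cvg_einfs.
  apply: nearW => k; apply: (@le_trans _ _ (\int[mu]_t h (maxn n k) t)%E).
    by apply: ereal_inf_lbound; exists (maxn n k) => //=; rewrite leq_maxr.
  by apply: inth; rewrite leq_maxl.
exists f; split=> //; split=> //.
rewrite (eq_Lp (g := fun t => (f t - s 0%N t) + s 0%N t)); last by move=> t; rewrite subrK.
apply: (le_lt_trans (LpD (smeasB mf (smeas_simple (ss 0%N))) (smeas_simple (ss 0%N)))).
by apply: lte_add_pinfty; [exact: le_lt_trans (fs 0%N) (ltry _)|exact: sfin].
Qed.

End LpSpace.

(** * The Bochner integral *)

Section Bochner.
Context {d : measure_display} {T : measurableType d} {R : realType}
  {X : completeNormedModType R}.
Variables (mu : {measure set T -> \bar R}).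
Local Notation smeas := (@strongly_measurable d T R X measurable).

Lemma level_lty (s : T -> X) (x : X) : simple_fun measurable s ->
  (\int[mu]_t (`|s t|)%:E < +oo)%E -> x != 0 -> (mu (s @^-1` [set x]) < +oo)%E.
Proof.
move=> ss ints x0.
have mA : measurable (s @^-1` [set x]) by case: ss.
have : (\int[mu]_t (`|x|%:E * (\1_(s @^-1` [set x]) t)%:E) < +oo)%E.
  apply: le_lt_trans ints; apply: ge0_le_integral => //.
  - by apply: measurable_funeM; apply/measurable_EFinP/measurable_indic.
  - exact: smeas_enorm (smeas_simple ss).
  - move=> t _; rewrite -EFinM lee_fin indicE; have [|] := boolP (t \in _).
      by rewrite inE /= => ->; rewrite mulr1.
    by rewrite mulr0.
rewrite ge0_integralZl//; last by apply/measurable_EFinP/measurable_indic.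
rewrite integral_indic// setIT; case: (mu _) (measure_ge0 mu (s @^-1` [set x])) => [r| |]//= _.
  by move=> _; rewrite ltry.
by rewrite gt0_muley// lte_fin normr_gt0.
Qed.

(** The two functions are written on the level sets of their pair. The pair (0, 0) is discarded,
    since its level set may have infinite measure. *)
Lemma simple_int_dist (s s' : T -> X) : simple_fun measurable s -> simple_fun measurable s' ->
  (\int[mu]_t (`|s t|)%:E < +oo)%E -> (\int[mu]_t (`|s' t|)%:E < +oo)%E ->
  ((`|simple_int mu s - simple_int mu s'|)%:E <= \int[mu]_t (`|(s t - s' t)%R|)%:E)%E.
Proof.
move=> ss ss' is_ is'.
pose phi t := (s t, s' t).
have fphi : finmeas phi := finmeas_pair ss ss'.
pose W : seq (X * X) := [seq k <- fset_set (range phi) | k != (0, 0)].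
have uW : uniq W by apply: filter_uniq; exact: fset_uniq.
have Wphi t : phi t \notin W -> phi t = (0, 0).
  rewrite mem_filter in_fset_set; last by case: fphi.
  have -> : phi t \in range phi by apply/mem_set; exists t.
  by rewrite andbT negbK => /eqP.
have mphi k : k \in W -> measurable (phi @^-1` [set k]) by move=> _; case: fphi.
have fin k : k \in W -> (mu (phi @^-1` [set k]) < +oo)%E.
  rewrite mem_filter => /andP[k0 _]; case: k k0 => x y.
  have [->|x0] := eqVneq x 0; last first.
    move=> _; apply: le_lt_trans (level_lty ss is_ x0).
    apply: le_measure; rewrite ?inE; [by case: fphi|by case: ss|].
    by move=> t /= [].
  have [->|y0] := eqVneq y 0; first by rewrite eqxx.
  move=> _; apply: le_lt_trans (level_lty ss' is' y0).
  apply: le_measure; rewrite ?inE; [by case: fphi|by case: ss'|].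
  by move=> t /= [].
have E (g : X * X -> X) : g (0, 0) = 0 -> simple_int mu (g \o phi) =
    \sum_(k <- W) fine (mu (phi @^-1` [set k])) *: g k.
  move=> g0; pose g' k := if k \in W then g k else 0.
  have -> : g \o phi = fun t => g' (phi t).
    by apply/funext => t; rewrite /g' /=; case: ifPn => // /Wphi ->.
  rewrite (simple_int_fibre uW mphi)//; last by move=> k; rewrite /g' => /negbTE ->.
  by rewrite big_seq [RHS]big_seq; apply: eq_bigr => k kW; rewrite /g' kW.
have -> : simple_int mu s = simple_int mu (fst \o phi) by [].
have -> : simple_int mu s' = simple_int mu (snd \o phi) by [].
rewrite !E// -sumrB.
pose N k : R := if k \in W then `|k.1 - k.2| else 0.
have -> : (\int[mu]_t (`|s t - s' t|%R)%:E = \int[mu]_t (N (phi t))%:E)%E.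
  apply: eq_integral => t _; congr EFin; rewrite /N; case: ifPn => // /Wphi [-> ->].
  by rewrite subrr normr0.
rewrite (integral_fibre mu uW mphi).
- apply: (@le_trans _ _ (\sum_(k <- W) (fine (mu (phi @^-1` [set k])) * `|k.1 - k.2|)%:E)%E).
    rewrite sumEFin lee_fin; apply: (le_trans (ler_norm_sum _ _ _)).
    apply: ler_sum => k _; have f0 : 0 <= fine (mu (phi @^-1` [set k])) by rewrite fine_ge0.
    by rewrite -scalerBr normrZ (ger0_norm f0).
  rewrite le_eqVlt; apply/orP; left; apply/eqP.
  rewrite big_seq [RHS]big_seq; apply: eq_bigr => k kW.
  by rewrite /N kW EFinM fineK 1?muleC// ge0_fin_numE// fin.
- by move=> k; rewrite /N; case: ifP.
- by move=> k; rewrite /N => /negbTE ->.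
Qed.

Lemma int_normD (f g h : T -> X) : smeas f -> smeas g -> smeas h ->
  (\int[mu]_t (`|(f t - g t)%R|)%:E <= \int[mu]_t (`|(h t - f t)%R|)%:E + \int[mu]_t (`|(h t - g t)%R|)%:E)%E.
Proof.
move=> mf mg mh; rewrite -ge0_integralD//.
- apply: ge0_le_integral => //.
  + exact: smeas_enorm (smeasB _ _).
  + by apply: emeasurable_funD; apply: smeas_enorm (smeasB _ _).
  + move=> t _; rewrite -EFinD lee_fin (distrC (h t) (f t)).
    by rewrite -[f t - g t](subrKA (h t)) ler_normD.
- exact: smeas_enorm (smeasB _ _).
- exact: smeas_enorm (smeasB _ _).
Qed.

Lemma has_bochner_unique (f : T -> X) (v v' : X) :
  has_bochner_int mu f v -> has_bochner_int mu f v' -> v = v'.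
Proof.
move=> [mf [s [ss is_ sf sv]]] [_ [s' [ss' is' s'f s'v]]].
apply/eqP; rewrite -subr_eq0 -normr_le0; apply/ler_addgt0Pl => e e0; rewrite addr0.
have e20 : 0 < e / 2 by rewrite divr_gt0.
have nn (u : nat -> T -> X) n : (0 <= \int[mu]_t (`|(f t - u n t)%R|)%:E)%E.
  by apply: integral_ge0 => t _; rewrite lee_fin.
have [N1 H1] := (cvge0_lt (nn s)).1 sf _ e20.
have [N2 H2] := (cvge0_lt (nn s')).1 s'f _ e20.
have c : `|simple_int mu (s n) - simple_int mu (s' n)| @[n --> \oo] --> `|v - v'|.
  by apply: cvg_norm; apply: cvgB.
rewrite -(cvg_lim _ c)//; apply: limr_le; first by apply/cvg_ex; exists `|v - v'|.
exists (maxn N1 N2) => // n /=; rewrite geq_max => /andP[n1 n2].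
rewrite -lee_fin; apply: (le_trans (simple_int_dist (ss n) (ss' n) (is_ n) (is' n))).
apply: (le_trans (int_normD (smeas_simple (ss n)) (smeas_simple (ss' n)) mf)).
by rewrite (splitr e) EFinD; apply: leeD; apply: ltW; [exact: H1|exact: H2].
Qed.

(** Integrals of approximants form a Cauchy sequence by [simple_int_dist], so that every approximating
    sequence computes the integral. *)
Lemma bochner_int_cvg (f : T -> X) (s : nat -> T -> X) :
    smeas f -> (forall n, simple_fun measurable (s n)) ->
    (forall n, (\int[mu]_t `|s n t|%:E < +oo)%E) ->
    ((\int[mu]_t `|f t - s n t|%:E)%E @[n --> \oo] --> 0%E) ->
  simple_int mu (s n) @[n --> \oo] --> bochner_int mu f.
Proof.
move=> mf ss is_ sf.
have nn n : (0 <= \int[mu]_t (`|(f t - s n t)%R|)%:E)%E.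
  by apply: integral_ge0 => t _; rewrite lee_fin.
have [N HN] := (cvge0_lt nn).1 sf _ ltr01.
pose r n : R := fine (\int[mu]_t `|f t - s (n + N)%N t|%:E)%E.
have rfin n : ((r n)%:E = \int[mu]_t `|f t - s (n + N)%N t|%:E)%E.
  rewrite fineK// ge0_fin_numE//; apply: lt_trans (HN _ (leq_addl _ _)) _.
  exact: ltry.
have r0 : r n @[n --> \oo] --> (0 : R).
  have h := sf; rewrite -(cvg_shiftn N) in h; exact: (fine_cvg h).
have c : cvgn (fun n => simple_int mu (s (n + N)%N)).
  apply: (cvg_of_dist r0) => n m; rewrite -lee_fin EFinD !rfin.
  apply: (le_trans (simple_int_dist (ss _) (ss _) (is_ _) (is_ _))).
  exact: int_normD (smeas_simple (ss _)) (smeas_simple (ss _)) mf.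
have sc : simple_int mu (s n) @[n --> \oo] --> lim (simple_int mu (s (n + N)%N) @[n --> \oo]).
  by rewrite -(cvg_shiftn N).
suff -> : bochner_int mu f = lim (simple_int mu (s (n + N)%N) @[n --> \oo]) by [].
have hv : has_bochner_int mu f (lim (simple_int mu (s (n + N)%N) @[n --> \oo])).
  by split=> //; exists s.
apply: (@has_bochner_unique f) => //.
exact: (xgetI _ hv).
Qed.

Lemma bochner_int_simple (s : T -> X) : simple_fun measurable s ->
  (\int[mu]_t `|s t|%:E < +oo)%E -> bochner_int mu s = simple_int mu s.
Proof.
move=> ss is_.
have c := @bochner_int_cvg s (fun=> s) (smeas_simple ss) (fun=> ss) (fun=> is_).
have {}c : simple_int mu s @[n --> \oo] --> bochner_int mu s.
  apply: c; have -> : (\int[mu]_t (`|(s t - s t)%R|)%:E = 0)%E.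
    by under eq_integral do rewrite subrr normr0; rewrite integral0.
  exact: cvg_cst.
by rewrite -(cvg_lim _ c)//; apply: cvg_lim => //; exact: cvg_cst.
Qed.

End Bochner.

(** * The dyadic grids of the line *)

Section Grid.
Context {R : realType}.
Local Notation mu := (@lebesgue_measure R).

Definition grid (N : nat) (x : R) : int := Num.floor (2 ^+ N * x).

(** The order, in the grid of length 2 ^- N, of the dyadic interval [I]. Larger orders mean longer
    intervals. *)
Definition lev (N : nat) (I : dyadic) : nat := `|N%:Z - I.1|%N.

Lemma intr_pow2 (k : int) j : (k * (2 ^ j)%:Z)%:~R = k%:~R * 2 ^+ j :> R.
Proof. by rewrite intrM -pmulrn natrX. Qed.

Lemma cell_grid j k N (x : R) : (cell j (grid N x) == k) =
  (k%:~R * 2 ^+ j <= 2 ^+ N * x < (k + 1)%:~R * 2 ^+ j).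
Proof. by rewrite cellP /grid floor_ge_int floor_lt_int !intr_pow2. Qed.

Lemma lev_dlen N I : (I.1 <= N%:Z)%R -> 2 ^+ N * dlen R I = 2 ^+ lev N I.
Proof.
move=> h; rewrite /dlen /lev !exprnP -expfzDr//; congr (_ ^ _).
by rewrite gez0_abs// subr_ge0.
Qed.

Lemma dlen_gt0 (I : dyadic) : 0 < dlen R I.
Proof. by rewrite /dlen exprz_gt0. Qed.

Lemma half_interval_out (a Q K P : R) : Q + 1 <= K \/ K + 1 <= Q ->
  2 * Q + P <= 2 * a -> 2 * a < 2 * Q + P + 1 -> P = 0 \/ P = 1 ->
  (0 <= a - K < 1 / 2) = false /\ (1 / 2 <= a - K < 1) = false.
Proof.
move=> QK h1 h2 hP; split; apply/negP => /andP[h3 h4];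
  by case: QK => h5; case: hP => hP; rewrite hP in h1 h2; lra.
Qed.

Lemma haar_grid N I (x : R) : (I.1 < N%:Z)%R ->
  haar I x = hz (lev N I) I.2 (grid N x).
Proof.
move=> IN; have l0 := dlen_gt0 I.
have lev0 : (0 < lev N I)%N by rewrite /lev absz_gt0 subr_eq0 gt_eqF.
have lE := lev_dlen (ltW IN).
set j := (lev N I).-1; have jE : lev N I = j.+1 by rewrite /j prednK.
set k := I.2; pose a := x / dlen R I.
have xE : 2 ^+ N * x = 2 ^+ j * (2 * a).
  have xa : x = a * dlen R I by rewrite divfK// lt0r_neq0.
  by rewrite xa mulrCA lE jE exprS; ring.
have -> : haar I x = haar01 (a - k%:~R).
  by rewrite /haar /dinf mulrBl [dlen R I * _]mulrC mulfK// lt0r_neq0.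
rewrite /hz jE /upper /= cellS.
have := eqxx (cell j (grid N x)); rewrite cell_grid xE.
set c := cell j _; rewrite ![_ * 2 ^+ j]mulrC !ler_pM2l ?ltr_pM2l ?exprn_gt0// intrD mulr1z.
have := divz_eq c 2; have : (c %% 2)%Z = 0 \/ (c %% 2)%Z = 1.
  by have := modz_ge0 c (isT : (2 : int) != 0); have := @ltz_pmod c 2 isT; lia.
set q := (c %/ 2)%Z; set rho := (c %% 2)%Z => rhoE cE /andP[c1 c2].
have cR : c%:~R = 2 * q%:~R + rho%:~R :> R by rewrite cE intrD intrM mulrC.
rewrite cR in c1 c2.
rewrite /haar01 !indicE.
have mem (u v : R) : ((a - k%:~R) \in `[u, v[%classic) = (u <= a - k%:~R < v).
  by apply/idP/idP => [/set_mem|h]; [|apply/mem_set]; rewrite /= in_itv.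
rewrite !mem.
have qk : q = k \/ q + 1 <= k \/ k + 1 <= q by lia.
have qk' : q = k \/ (q%:~R + 1 <= k%:~R :> R) \/ (k%:~R + 1 <= q%:~R :> R).
  case: qk => [->|[h|h]]; [by left|right; left|right; right];
  by rewrite -(intrD _ _ 1) ler_int.
case: qk' => [qk'|qk'].
  rewrite qk' eqxx mulr1; rewrite qk' in c1 c2.
  case: rhoE => rE; rewrite rE /= in c1 c2 *.
    have -> : (0 <= a - k%:~R < 1 / 2) by lra.
    have -> : (1 / 2 <= a - k%:~R < 1) = false by lra.
    by rewrite subr0.
  have -> : (0 <= a - k%:~R < 1 / 2) = false by lra.
  have -> : (1 / 2 <= a - k%:~R < 1) by lra.
  by rewrite sub0r expr1.
have -> : (q == k) = false.
  by apply/eqP => e; rewrite e in qk'; case: qk'; lra.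
have rR : rho%:~R = 0 :> R \/ rho%:~R = 1 :> R by case: rhoE => ->; [left|right].
by have [-> ->] := half_interval_out qk' c1 c2 rR; rewrite subr0 mulr0.
Qed.

Lemma grid_fibre N t : grid N @^-1` [set t] =
  `[t%:~R / 2 ^+ N, (t%:~R + 1) / 2 ^+ N[%classic.
Proof.
have N0 : 0 < 2 ^+ N :> R by rewrite exprn_gt0.
apply/seteqP; split=> x /=; rewrite in_itv/= ler_pdivrMr// ltr_pdivlMr// [x * _]mulrC.
  by move=> /eqP; rewrite /grid floor_eq intrD.
by move=> h; apply/eqP; rewrite /grid floor_eq intrD.
Qed.

Lemma grid_measurable N t : measurable (grid N @^-1` [set t]).
Proof. by rewrite grid_fibre; exact: measurable_itv. Qed.

Lemma mu_grid N t : (mu (grid N @^-1` [set t]) = (2 ^- N)%:E)%E.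
Proof.
rewrite grid_fibre lebesgue_measure_itv /= lte_fin.
have N0 : 0 < 2 ^+ N :> R by rewrite exprn_gt0.
by rewrite ltr_pM2r ?invr_gt0// ltrDl ltr01 -EFinB -mulrBl addrAC subrr add0r mul1r.
Qed.

(** Outside such finite lists of integers, the functions on the grid considered below vanish. *)
Definition cellpts (J : nat * int) : seq int :=
  [seq J.2 * (2 ^ J.1)%:Z + i%:Z | i <- iota 0 (2 ^ J.1)].

Lemma mem_cellpts j k t : cell j t = k -> t \in cellpts (j, k).
Proof.
move=> /eqP; rewrite cellP => h; apply/mapP => /=.
exists (absz (t - k * (2 ^ j)%:Z)%R); last by lia.
by rewrite mem_iota; lia.
Qed.

Definition window (s : seq (nat * int)) : seq int := undup (flatten (map cellpts s)).

Lemma window_uniq s : uniq (window s). Proof. exact: undup_uniq. Qed.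

Lemma mem_window s J t : J \in s -> cell J.1 t = J.2 -> t \in window s.
Proof.
move=> Js /mem_cellpts tJ; rewrite mem_undup; apply/flattenP.
by exists (cellpts J); [exact: map_f|case: J tJ {Js}].
Qed.

Context {X : completeNormedModType R}.
Variable p : R.
Hypothesis p1 : 1 < p.
Local Notation nrm := (Lp_norm mu p).

Lemma grid_int N (w : seq int) (g : int -> X) : uniq w ->
    (forall t, t \notin w -> g t = 0) ->
  (\int[mu]_x (`|g (grid N x)| `^ p)%:E =
    (2 ^- N * \sum_(t <- w) `|g t| `^ p)%:E)%E.
Proof.
move=> uw g0.
rewrite (integral_fibre mu uw (fun t _ => grid_measurable N t) (g := fun t => `|g t| `^ p)).
- rewrite mulr_sumr -sumEFin; apply: eq_bigr => t _; rewrite mulrC EFinM.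
  by congr (_ * _)%E; exact: mu_grid.
- by move=> t; exact: powR_ge0.
- by move=> t /g0 ->; rewrite normr0 powR0// gt_eqF// (lt_trans ltr01).
Qed.

(** Norm inequalities for functions on the grid are inequalities of finite sums. *)
Lemma grid_leP N (w : seq int) (f g : int -> X) (c : R) : uniq w -> 0 <= c ->
    (forall t, t \notin w -> f t = 0) -> (forall t, t \notin w -> g t = 0) ->
    \sum_(t <- w) `|f t| `^ p <= c `^ p * \sum_(t <- w) `|g t| `^ p ->
  (nrm (fun x => f (grid N x)) <= c%:E * nrm (fun x => g (grid N x)))%E.
Proof.
move=> uw c0 f0 g0 h; apply/(Lp_norm_leP _ p1) => //.
rewrite (grid_int _ uw f0) (grid_int _ uw g0) -EFinM lee_fin mulrCA.
by rewrite ler_wpM2l// invr_ge0 exprn_ge0.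
Qed.

End Grid.

(** * Haar sums and their shifts *)

Section HaarSums.
Context {R : realType} {X : completeNormedModType R}.
Local Notation mu := (@lebesgue_measure R).

(** [hsum] and [tsum m] are a finite Haar sum and its image under T_m, for a list of intervals; on
    the list of elements of a finite set they are [haar_poly] and [shift_haar_poly]. *)
Definition hsum (L : seq dyadic) (a : dyadic -> X) (x : R) : X :=
  \sum_(I <- L) haar I x *: a I.

Definition tsum (m : int) (L : seq dyadic) (a : dyadic -> X) (x : R) : X :=
  \sum_(I <- L) haar (tau m I) x *: a I.

Lemma hsum_perm L L' a : perm_eq L L' -> hsum L a =1 hsum L' a.
Proof. by move=> LL' x; exact: perm_big. Qed.

Lemma tsum_perm m L L' a : perm_eq L L' -> tsum m L a =1 tsum m L' a.
Proof. by move=> LL' x; exact: perm_big. Qed.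

Lemma tsum_grid m N L a (x : R) : (forall I, I \in L -> I.1 < N%:Z) ->
  tsum m L a x = \sum_(I <- L) hz (lev N I) (I.2 + m) (grid N x) *: a I.
Proof.
by move=> h; apply: eq_big_seq => I /h IN; rewrite (@haar_grid _ N).
Qed.

Lemma hsum_grid N L a (x : R) : (forall I, I \in L -> I.1 < N%:Z) ->
  hsum L a x = \sum_(I <- L) hz (lev N I) I.2 (grid N x) *: a I.
Proof.
by move=> h; apply: eq_big_seq => I /h IN; rewrite (@haar_grid _ N).
Qed.

(** The grid size is taken in the multiples of [lam], so that an order [lev N I] in it has modulo
    [lam] the residue of [- I.1]. *)
Lemma fine_scale (lam : nat) (L : seq dyadic) : (0 < lam)%N ->
  exists N, forall I, I \in L -> I.1 + 2 <= (lam * N)%N%:Z.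
Proof.
move=> lam0; exists (2 + \sum_(I <- L) `|I.1|)%N => I IL.
have h : (`|I.1| <= \sum_(I <- L) `|I.1|)%N by rewrite (big_rem I IL)/= leq_addr.
set S := (\sum_(I <- L) _)%N in h *.
have : I.1 <= `|I.1|%N%:Z by rewrite abszE ler_norm.
move: h; case: I IL => i k _ /=; nia.
Qed.

Lemma lev_inj N (I J : dyadic) : I.1 < N%:Z -> J.1 < N%:Z ->
  (lev N I, I.2) = (lev N J, J.2) -> I = J.
Proof. by case: I J => [i k] [i' k'] /= h h' [e ->]; congr pair; move: e; rewrite /lev /=; lia. Qed.

Lemma lev_le N (I J : dyadic) : I.1 <= J.1 -> J.1 < N%:Z -> (lev N J <= lev N I)%N.
Proof. by case: I J => [i k] [i' k'] /=; rewrite /lev /=; lia. Qed.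

(** Longer intervals first: the order in which Haar functions are martingale differences. *)
Definition lsort (L : seq dyadic) := sort (fun I J : dyadic => I.1 <= J.1) L.

Lemma lsort_nth (L : seq dyadic) i j : (i < j < size L)%N ->
  (nth (0, 0) (lsort L) i).1 <= (nth (0, 0) (lsort L) j).1.
Proof.
move=> /andP[ij jL].
have tr : transitive (fun I J : dyadic => I.1 <= J.1) by move=> ? ? ?; exact: le_trans.
have so : sorted (fun I J : dyadic => I.1 <= J.1) (lsort L).
  by apply: sort_sorted => ? ?; exact: le_total.
apply: (sorted_ltn_nth tr (0, 0) so i j) => //; rewrite unfold_in /= size_sort//.
exact: ltn_trans jL.
Qed.

Lemma finmeas_grid N (w : seq int) (f : int -> X) : uniq w ->
  (forall t, t \notin w -> f t = 0) -> simple_fun measurable (fun x : R => f (grid N x)).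
Proof.
move=> uw f0; split.
  apply: (@sub_finite_set _ _ [set` 0 :: map f w]); last exact: finite_seq.
  move=> _ [x _ <-]; rewrite /mkset in_cons.
  have [xw|xw] := boolP (grid N x \in w); first by rewrite map_f ?orbT.
  by rewrite f0// eqxx.
have m (P : pred int) : measurable (\big[setU/set0]_(t <- w | P t) (grid N @^-1` [set t] : set R)).
  by apply: bigsetU_measurable => t _; exact: grid_measurable.
move=> y; have [->|y0] := eqVneq y 0.
  have -> : (fun x : R => f (grid N x)) @^-1` [set 0] =
      ~` \big[setU/set0]_(t <- w | f t != 0) (grid N @^-1` [set t]).
    rewrite -bigcup_seq_cond; apply/seteqP; split=> x /=.
      by move=> e [t /= /andP[_ ft] xt]; move: ft; rewrite -xt e eqxx.
    move=> nx; apply/eqP; apply: contra_notT nx => fx; exists (grid N x) => //=.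
    by rewrite fx andbT; apply: contraNT fx => /f0 ->.
  exact: measurableC.
have -> : (fun x : R => f (grid N x)) @^-1` [set y] =
    \big[setU/set0]_(t <- w | f t == y) (grid N @^-1` [set t]).
  rewrite -bigcup_seq_cond; apply/seteqP; split=> x /=.
    move=> e; exists (grid N x) => //=; rewrite e eqxx andbT.
    by apply: contraNT y0 => /f0 <-; rewrite e.
  by move=> [t /= /andP[_ /eqP <-] ->].
exact: m.
Qed.

Lemma hsum_step L a : exists N w (f : int -> X),
  [/\ uniq w, forall t, t \notin w -> f t = 0 & forall x, hsum L a x = f (grid N x)].
Proof.
have [N HN] := fine_scale L (ltn0Sn 0); rewrite mul1n in HN.
have {}HN I : I \in L -> I.1 < N%:Z by move=> /HN; lia.
exists N, (window (map (fun I : dyadic => (lev N I, I.2)) L)),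
  (fun t => \sum_(I <- L) hz (lev N I) I.2 t *: a I); split.
- exact: window_uniq.
- move=> t tw; rewrite big_seq big1// => I IL.
  rewrite /hz; case: eqP => [e|_]; last by rewrite mulr0 scale0r.
  by rewrite (@mem_window _ (lev N I, I.2)) ?(map_f (fun I : dyadic => (lev N I, I.2)))// in tw.
- by move=> x; exact: hsum_grid.
Qed.

Lemma hsum_simple L a : simple_fun measurable (hsum L a).
Proof.
have [N [w [f [uw f0 e]]]] := hsum_step L a.
by have := finmeas_grid N uw f0; congr simple_fun; apply/funext => x; rewrite e.
Qed.

Lemma hsum_smeas L a : strongly_measurable measurable (hsum L a).
Proof. exact: smeas_simple (hsum_simple L a). Qed.

Lemma tsumE m L a x :
  tsum m L a x = hsum (map (tau m) L) (fun J => a (tau (- m) J)) x.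
Proof.
rewrite /tsum /hsum big_map; apply: eq_bigr => -[i k] _.
by rewrite /tau /= addrK.
Qed.

Lemma tsum_simple m L a : simple_fun measurable (tsum m L a).
Proof. by rewrite (funext (tsumE m L a)); exact: hsum_simple. Qed.

End HaarSums.

Section Classes.
Variable m : int.
Hypothesis m0 : m != 0.
Local Notation lam := (lam m).

Lemma lam_gt2 : (2 < lam)%N.
Proof. by rewrite /Defs.lam; case: ifP => // _; rewrite addnC. Qed.

Lemma absm_lt : (`|m| + 1 <= 2 ^ (lam - 2))%N.
Proof.
have [m2|] := leqP 2 `|m|; first by have /andP[_] := lamP m2; rewrite addn1.
rewrite ltnS leq_eqVlt => /predU1P[e|]; last by rewrite ltnS leqn0 absz_eq0 (negbTE m0).
by rewrite /Defs.lam e eqxx.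
Qed.

Definition parity (k : int) : bool := (2 %| (k %/ `|m|)%Z)%Z.

(** Adding [m] changes the quotient by [`|m|] by one unit. This is why [parity] separates each
    interval from its translate. *)
Lemma divm_shift k c : ((k + m * c) %/ `|m|)%Z = (k %/ `|m|)%Z + sgz m * c.
Proof.
have -> : k + m * c = (sgz m * c) * `|m| + k.
  by rewrite addrC {1}[m]intEsg abszE; ring.
by rewrite divzMDl ?normr_eq0// addrC.
Qed.

Lemma parity_shift k : parity (k + m) = ~~ parity k.
Proof.
have := divm_shift k 1; rewrite mulr1 /parity => ->.
have : sgz m = 1 \/ sgz m = -1 by case: sgzP m0 => //; [left|right].
by move: (k %/ `|m|)%Z (sgz m) => q s [] ->; lia.
Qed.

Lemma parity_even k c : parity (k + m * (2 * c)) = parity k.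
Proof.
rewrite /parity divm_shift.
have -> : sgz m * (2 * c) = 2 * (sgz m * c) by ring.
by move: (k %/ `|m|)%Z (sgz m * c) => q s; lia.
Qed.

Definition in_class (c : int * bool) (I : dyadic) : bool :=
  ((I.1 %% lam%:Z)%Z == c.1) && (parity I.2 == c.2).

Definition classes : seq (int * bool) :=
  allpairs (fun (r : nat) (b : bool) => (r%:Z, b)) (iota 0 lam) [:: true; false].

Lemma classes_uniq : uniq classes.
Proof. by apply: allpairs_uniq; [exact: iota_uniq|by []|move=> [? ?] [? ?] _ _ /= [-> ->]]. Qed.

Lemma in_class_sum (V : zmodType) (F : V) (I : dyadic) : \sum_(c <- classes | in_class c I) F = F.
Proof.
pose c := ((I.1 %% lam%:Z)%Z, parity I.2).
rewrite (eq_bigl (pred1 c)); last first.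
  by move=> [r b]; rewrite /in_class /c /= xpair_eqE [r == _]eq_sym [b == _]eq_sym.
rewrite -big_filter filter_pred1_uniq ?classes_uniq ?big_seq1//.
apply/allpairsP; exists (`|(I.1 %% lam%:Z)%Z|%N, parity I.2); split => //=.
- have l0 : lam%:Z != 0 by have := lam_gt2; lia.
  have := modz_ge0 I.1 l0; have := @ltz_pmod I.1 lam; rewrite mem_iota.
  by have := lam_gt2; move: (_ %% _)%Z => q; lia.
- by case: parity.
- by rewrite /c gez0_abs// modz_ge0//; have := lam_gt2; lia.
Qed.

End Classes.

Section HaarNorms.
Context {R : realType} {X : completeNormedModType R}.
Local Notation mu := (@lebesgue_measure R).

Lemma tsum_classes m (L : seq dyadic) (a : dyadic -> X) (x : R) : m != 0 ->
  tsum m L a x = \sum_(c <- classes m) tsum m [seq I <- L | in_class m c I] a x.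
Proof.
move=> m0; rewrite /tsum; under [RHS]eq_bigr do rewrite big_filter.
rewrite (exchange_big_dep xpredT)//=.
by apply: eq_bigr => I _; rewrite in_class_sum.
Qed.

Variable p : R.
Hypothesis p1 : 1 < p.
Local Notation nrm := (Lp_norm mu p).

Lemma hsum_lty L (a : dyadic -> X) : (nrm (hsum L a) < +oo)%E.
Proof.
have [N [w [f [uw f0 e]]]] := hsum_step L a.
by rewrite (eq_Lp mu p e) Lp_normE (grid_int p1 _ uw f0) poweR_lty// ltry.
Qed.

Lemma tsum_lty m L (a : dyadic -> X) : (nrm (tsum m L a) < +oo)%E.
Proof. by rewrite (funext (tsumE m L a)); exact: hsum_lty. Qed.

Variable U : R.
Hypothesis U1 : 1 <= U.
Hypothesis umd : sym_umd (X := X) p U.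
Let U0 : 0 <= U := le_trans ler01 U1.

Lemma hsum_restrict (P : pred dyadic) L (a : dyadic -> X) : uniq L ->
  (nrm (hsum [seq I <- L | P I] a) <= U%:E * nrm (hsum L a))%E.
Proof.
move=> uL; pose L' := lsort L.
have LL' : perm_eq L L' by rewrite perm_sym perm_sort.
have uL' : uniq L' by rewrite -(perm_uniq LL').
rewrite (eq_Lp mu p (hsum_perm a LL')).
rewrite (eq_Lp mu p (hsum_perm a (perm_filter P LL'))).
have [N HN] := fine_scale L (ltn0Sn 0); rewrite mul1n in HN.
have {}HN I : I \in L' -> I.1 < N%:Z.
  by rewrite -(perm_mem LL') => /HN; lia.
pose n := size L'; pose x0 : dyadic := (0, 0).
pose J j := (lev N (nth x0 L' j), (nth x0 L' j).2).
pose w := window (map (fun I : dyadic => (lev N I, I.2)) L').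
have hw t j : (j < n)%N -> cell (J j).1 t = (J j).2 -> t \in w.
  by move=> jn; apply: mem_window; apply: (map_f (fun I : dyadic => (lev N I, I.2))); exact: mem_nth.
have out (t : int) I : t \notin w -> I \in L' -> hz (lev N I) I.2 t = 0 :> R.
  move=> tw IL; rewrite /hz; case: eqP => [e|_]; last by rewrite mulr0.
  by rewrite (@mem_window _ (lev N I, I.2)) ?map_f// in tw.
pose f (Q : pred dyadic) t : X := \sum_(I <- L' | Q I) hz (lev N I) I.2 t *: a I.
have f0 Q t : t \notin w -> f Q t = 0.
  move=> tw; rewrite /f big_seq_cond big1// => I /andP[IL _].
  by rewrite out// scale0r.
have e1 x : hsum [seq I <- L' | P I] a x = f P (grid N x).
  rewrite (@hsum_grid _ _ N); first by rewrite big_filter.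
  by move=> I; rewrite mem_filter => /andP[_ /HN].
have e2 x : hsum L' a x = f xpredT (grid N x) by rewrite (@hsum_grid _ _ N).
rewrite (eq_Lp mu p e1) (eq_Lp mu p e2).
apply: (grid_leP p1 N (window_uniq _) U0 (f0 P) (f0 xpredT)).
have fE Q t : f Q t = \sum_(j < n | Q (nth x0 L' j)) hz (J j).1 (J j).2 t *: a (nth x0 L' j).
  by rewrite /f (big_nth x0) big_mkord.
under eq_bigr do rewrite fE; under [X in _ <= _ * X]eq_bigr do rewrite fE.
apply: (@hz_restrict R X p U p1 U1 umd w n J (fun j => a (nth x0 L' j))
  (fun j => P (nth x0 L' j)) (window_uniq _)).
- by move=> j t; exact: hw.
- move=> j jn; have := HN _ (mem_nth x0 jn); rewrite /J /lev /=.
  by move: (nth x0 L' j) => [i k] /=; lia.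
- move=> i j ij; have /andP[ij' jn] := ij; have in_ := ltn_trans ij' jn; split.
    apply: lev_le (HN _ (mem_nth x0 jn)).
    by apply: lsort_nth; rewrite ij' (perm_size LL').
  apply/eqP => /(lev_inj (HN _ (mem_nth x0 in_)) (HN _ (mem_nth x0 jn))) /eqP.
  by rewrite nth_uniq// ltn_eqF.
Qed.

(** Translation of [hz_shift] to the line: within a class, orders are [lv lam r l] for a common
    residue [r], and an interval is active if it has the parity of the class. *)
Lemma tsum_class (m r0 : int) (b : bool) L (a : dyadic -> X) : m != 0 -> uniq L ->
    (forall I, I \in L -> (I.1 %% (lam m)%:Z)%Z = r0 /\ parity m I.2 = b) ->
  (nrm (tsum m L a) <= (2 * U ^+ 4)%:E * nrm (hsum L a))%E.
Proof.
move=> m0 uL Lc; set lam := Defs.lam m in Lc *; pose L' := lsort L.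
have LL' : perm_eq L L' by rewrite perm_sym perm_sort.
have uL' : uniq L' by rewrite -(perm_uniq LL').
rewrite (eq_Lp mu p (hsum_perm a LL')) (eq_Lp mu p (tsum_perm m a LL')).
have lam0 : (0 < lam)%N by have := lam_gt2 m; lia.
have [N0 HN0] := fine_scale L lam0; set N := (lam * N0)%N in HN0.
have HN2 I : I \in L' -> I.1 + 2 <= N%:Z.
  by rewrite -(perm_mem LL') => /HN0.
have HN I : I \in L' -> I.1 < N%:Z by move=> /HN2; lia.
pose n := size L'; pose x0 : dyadic := (0, 0).
pose J j := nth x0 L' j.
have JL j : (j < n)%N -> J j \in L' by move=> jn; exact: mem_nth.
pose r := `|((- r0) %% lam%:Z)%Z|%N.
pose l j := (lev N (J j) %/ lam)%N.
have lvE j : (j < n)%N -> lv lam r (l j) = lev N (J j).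
  move=> /JL h; have := HN _ h; rewrite -(perm_mem LL') in h; have [e _] := Lc _ h.
  rewrite /lv /l => IN; rewrite [RHS](divn_eq _ lam) mulnC; congr addn.
  apply/eqP; rewrite -eqz_nat -modz_nat /r gez0_abs; last by apply: modz_ge0; lia.
  rewrite /lev gez0_abs; last by rewrite subr_ge0 ltW.
  by rewrite -e modzNm /N PoszM mulrC modzMDl.
pose w := window ((map (fun I : dyadic => (lev N I, I.2)) L') ++ (map (fun I : dyadic => (lev N I, I.2 + m)) L')).
have hw o t I : o = 0 \/ o = m -> I \in L' -> cell (lev N I) t = I.2 + o -> t \in w.
  move=> oE IL; apply: (@mem_window _ (lev N I, I.2 + o)); rewrite mem_cat.
  by case: oE => ->; rewrite ?addr0 ?(map_f (fun I : dyadic => (lev N I, I.2)) IL)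
     ?(map_f (fun I : dyadic => (lev N I, I.2 + m)) IL) ?orbT.
pose f (o : int) t : X := \sum_(I <- L') hz (lev N I) (I.2 + o) t *: a I.
have f0 o t : o = 0 \/ o = m -> t \notin w -> f o t = 0.
  move=> oE tw; rewrite /f big_seq big1// => I IL.
  rewrite /hz; case: eqP => [e'|_]; last by rewrite mulr0 scale0r.
  by move/negP: tw; case; exact: (hw o _ I).
have e1 x : tsum m L' a x = f m (grid N x) by rewrite (@tsum_grid _ _ _ N).
have e2 x : hsum L' a x = f 0 (grid N x).
  by rewrite (@hsum_grid _ _ N)//; apply: eq_bigr => I _; rewrite addr0.
rewrite (eq_Lp mu p e1) (eq_Lp mu p e2).
have C0 : 0 <= 2 * U ^+ 4 by rewrite mulr_ge0// exprn_ge0.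
apply: (grid_leP p1 N (window_uniq _) C0 (fun t => f0 m t (or_intror erefl)) (fun t => f0 0 t (or_introl erefl))).
have fE o t : f o t = \sum_(j < n) hz (lv lam r (l j)) ((J j).2 + o) t *: a (J j).
  rewrite /f (big_nth x0) big_mkord; apply: eq_bigr => j _.
  by rewrite lvE.
under eq_bigr do rewrite fE; under [X in _ <= _ * X]eq_bigr do rewrite fE.
have lev_lv i j : (i < j < n)%N -> (lev N (J j) <= lev N (J i))%N.
  move=> ij; have /andP[ij' jn] := ij.
  apply: lev_le (HN _ (JL _ jn)).
  by apply: lsort_nth; rewrite ij' (perm_size LL').
have := @hz_shift R X p U p1 U1 umd m lam r (fun k => parity m k == b) _ _ _ (absm_lt m0) w n l
  (fun j => (J j).2) (fun j => a (J j)) (window_uniq _).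
rewrite /detsum.
under [X in _ -> _ -> _ -> _ -> _ -> _ -> _ -> _ -> _ <= _ * X]eq_bigr do
  under eq_bigr do rewrite -[(J _).2]addr0.
apply.
- by have := lam_gt2 m; lia.
- by move=> k /eqP e; rewrite (parity_shift m0) e; case: (b).
- by move=> k c; rewrite (parity_even m0).
- move=> j t jn; rewrite lvE// => h.
  case: h => h; first by apply: (hw 0 _ (J j)) (JL _ jn) _; [left|rewrite addr0].
  by apply: (hw m _ (J j)) (JL _ jn) _; [right|].
- move=> j jn; rewrite lvE//; have := HN2 _ (JL _ jn); rewrite /lev.
  by move: (J j) => [i k] /=; lia.
- move=> j jn; apply/eqP; have := JL _ jn; rewrite -(perm_mem LL') => /Lc[].
  by [].
- by move=> i j ij; apply: leq_div2r; exact: lev_lv.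
- move=> i j ij; have /andP[ij' jn] := ij; have in_ := ltn_trans ij' jn.
  apply/eqP => -[e1' e2'].
  have : (lev N (J i), (J i).2) = (lev N (J j), (J j).2).
    by rewrite -!lvE// e1' e2'.
  move=> /(lev_inj (HN _ (JL _ in_)) (HN _ (JL _ jn))) /eqP.
  by rewrite nth_uniq// ltn_eqF.
Qed.

(** There are finitely many classes, so that T_m is bounded for each [m], with a constant that depends
    on [m]. Its use is to extend T_m by continuity. *)
Lemma tsum_bound m : m != 0 -> exists2 C : R, 0 <= C & forall L (a : dyadic -> X), uniq L ->
  (nrm (tsum m L a) <= C%:E * nrm (hsum L a))%E.
Proof.
move=> m0; have C0 : 0 <= 2 * U ^+ 4 * U by rewrite !mulr_ge0// exprn_ge0.
exists (\sum_(c <- classes m) (2 * U ^+ 4 * U)) => [|L a uL]; first exact: sumr_ge0.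
rewrite (eq_Lp mu p (fun x => tsum_classes L a x m0)).
have [_ h] := Lp_sum mu p1 (classes m)
  (fun c => smeas_simple (tsum_simple m [seq I <- L | in_class m c I] a)).
apply: (le_trans h); rewrite -sumEFin ge0_sume_distrl; last by move=> c _; rewrite lee_fin.
apply: lee_sum => c _.
have hc I : I \in [seq I <- L | in_class m c I] ->
    (I.1 %% (lam m)%:Z)%Z = c.1 /\ parity m I.2 = c.2.
  by rewrite mem_filter => /andP[/andP[/eqP ? /eqP ?] _].
apply: (le_trans (tsum_class a m0 (filter_uniq _ uL) hc)).
rewrite [X in (_ <= X * _)%E]EFinM -muleA; apply: lee_wpmul2l; first by rewrite lee_fin mulr_ge0// exprn_ge0.
exact: hsum_restrict.
Qed.

End HaarNorms.

(** * Density of the Haar sums *)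

Section Density.
Context {d : measure_display} {T : measurableType d} {R : realType}
  {X : completeNormedModType R}.
Variables (mu : {measure set T -> \bar R}) (p : R).
Hypothesis p1 : 1 < p.
Let p0 : 0 < p := lt_trans ltr01 p1.
Local Notation nrm := (Lp_norm mu p).

Lemma indic_simple (A : set T) (x : X) : measurable A ->
  simple_fun measurable (fun t => (\1_A t : R) *: x).
Proof.
move=> mA; have := finmeas_comp (fun b : bool => (b%:R : R) *: x) (finmeas_set mA).
congr simple_fun; apply/funext => t; rewrite indicE /=; congr ((nat_of_bool _)%:R *: _).
Qed.

Lemma Lp_indic (A : set T) (x : X) : measurable A ->
  nrm (fun t => (\1_A t : R) *: x) = (((`|x| `^ p)%:E * mu A) `^ p^-1)%E.
Proof.
move=> mA; rewrite Lp_normE.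
have -> : (\int[mu]_t (`|(\1_A t : R) *: x| `^ p)%:E =
   \int[mu]_t ((`|x| `^ p)%:E * (\1_A t)%:E))%E.
  apply: eq_integral => t _; rewrite -EFinM indicE; case: (_ \in _).
    by rewrite scale1r mulr1.
  by rewrite scale0r normr0 powR0 ?gt_eqF// mulr0.
rewrite ge0_integralZl//.
- by rewrite integral_indic// setIT.
- by apply/measurable_EFinP/measurable_indic.
Qed.

(** Approximants are cut to 0 where their norm exceeds twice that of [u], so that dominated
    convergence applies. *)
Lemma Lp_simple_dense (u : T -> X) (e : R) : in_Lp mu p u -> 0 < e ->
  exists s, [/\ simple_fun measurable s, (nrm s < +oo)%E &
    (nrm (fun t => (u t - s t)%R) < e%:E)%E].
Proof.
move=> [mu_ fin] e0; have [s [ss su]] := mu_.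
have mn : measurable_fun setT (fun t => `|u t|) := smeas_norm mu_.
(* Where [u] is nonzero, this holds eventually; where [u] is 0, it forces the value 0. *)
pose B n := [set t | `|s n t| <= 2 * `|u t|].
have mB n : measurable (B n).
  have m1 : measurable_fun setT (fun t => `|s n t| <= 2 * `|u t|).
    apply: measurable_fun_ler; first exact: smeas_norm (smeas_simple (ss n)).
    exact: measurable_funM.
  have -> : B n = (fun t => `|s n t| <= 2 * `|u t|) @^-1` [set true] by apply/seteqP; split.
  by rewrite -[X in measurable X]setTI; apply: m1.
pose s' n t := if `[< B n t >] then s n t else 0.
have ss' n : simple_fun measurable (s' n).
  exact: (finmeas_comp2 (fun (b : bool) (x : X) => if b then x else 0) (finmeas_set (mB n)) (ss n)).
have s'u t : s' n t @[n --> \oo] --> u t.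
  have [u0|u0] := eqVneq (u t) 0.
    have -> : (fun n => s' n t) = fun=> u t.
      apply/funext => n; rewrite /s'; case: asboolP => //; rewrite /B /= u0 normr0 mulr0.
      by rewrite normr_le0 => /eqP.
    exact: cvg_cst.
  apply: (cvg_trans _ (su t)); apply: near_eq_cvg.
  have nu : 0 < `|u t| by rewrite normr_gt0.
  have /cvgrPdist_lt/(_ _ nu)[N _ HN] := su t.
  exists N => // n /= /HN h; rewrite /s' asboolT//= /B /=.
  have : `|s n t| <= `|u t| + `|u t - s n t|.
    by rewrite -[X in `|X|](subKr (u t)) ler_normB.
  by lra.
have s'le n t : `|s' n t| <= 2 * `|u t|.
  by rewrite /s'; case: asboolP => // _; rewrite normr0 mulr_ge0.
pose h n t := (`|u t - s' n t| `^ p)%:E.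
have mh n : measurable_fun setT (h n).
  by apply: smeas_norm_pow; apply: smeasB => //; exact: smeas_simple.
have int3 : mu.-integrable setT (fun t => (`|(3 : R) *: u t| `^ p)%:E).
  apply/integrableP; split; first by apply: smeas_norm_pow; exact: smeasZ.
  under eq_integral do rewrite gee0_abs ?lee_fin ?powR_ge0//.
  rewrite -(Lp_norm_pow _ p1) LpZ//; apply: poweR_lty.
  by rewrite lte_mul_pinfty// ?lee_fin// normr_ge0.
have dc := @dominated_convergence _ _ _ mu setT measurableT h (cst 0%E) _ mh _ _ int3 _.
have [] := dc.
- exact: measurable_cst.
- apply/nearW => t _; rewrite -[X in _ --> X](_ : (0 `^ p)%:E = 0%E); last first.
    by rewrite powR0 ?gt_eqF.
  apply: cvg_EFin; first exact: nearW.
  apply: powR_cvg_seq => //; rewrite -(@normr0 _ X) -(subrr (u t)).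
  by apply: cvg_norm; apply: cvgB => //; exact: cvg_cst.
- apply/nearW => t n _; rewrite gee0_abs ?lee_fin ?powR_ge0// ge0_ler_powR ?nnegrE ?(ltW p0)//.
  rewrite normrZ ger0_norm//; apply: (le_trans (ler_normB _ _)).
  by have := s'le n t; lra.
move=> _ _; rewrite integral0 => c.
have e0p : 0 < e `^ p by exact: powR_gt0.
have hn n : (0 <= \int[mu]_t h n t)%E.
  by apply: integral_ge0 => t _; rewrite lee_fin powR_ge0.
have [N HN] := (cvge0_lt hn).1 c _ e0p.
have lt : (nrm (fun t => (u t - s' N t)%R) < e%:E)%E.
  rewrite ltNge; apply/negP => le.
  have := HN _ (leqnn N); rewrite ltNge => /negP; apply.
  rewrite /h -(Lp_norm_pow _ p1) -poweR_EFin; apply: gt0_ler_poweR => //;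
    by rewrite ?in_itv/= ?leey ?andbT ?lee_fin ?Lp_ge0 ?(ltW p0) ?(ltW e0).
exists (s' N); split => //.
have md : strongly_measurable measurable (fun t => u t - s' N t).
  by apply: smeasB => //; exact: smeas_simple.
rewrite (eq_Lp mu p (g := fun t => u t + (-1) *: (u t - s' N t))); last first.
  by move=> t; rewrite scaleN1r opprB addrC subrK.
apply: (le_lt_trans (LpD mu p1 mu_ (smeasZ (-1) md))).
rewrite LpZ// normrN1 mul1e lte_add_pinfty//.
by apply: (lt_trans lt); rewrite ltry.
Qed.

End Density.

Section DyadicDensity.
Context {R : realType} {X : completeNormedModType R}.
Local Notation mu := (@lebesgue_measure R).
Variable p : R.
Hypothesis p1 : 1 < p.
Let p0 : 0 < p := lt_trans ltr01 p1.
Local Notation nrm := (Lp_norm mu p).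

(** Haar sums given by a list of terms, where intervals may be repeated: these are closed under
    concatenation. *)
Definition psum (P : seq (dyadic * X)) (x : R) : X := \sum_(q <- P) haar q.1 x *: q.2.

Lemma psum_hsum P : exists L a, uniq L /\ psum P =1 hsum L a.
Proof.
exists (undup (map fst P)), (fun I => \sum_(q <- P | q.1 == I) q.2).
split=> [|x]; first exact: undup_uniq.
rewrite /hsum; under eq_bigr do rewrite scaler_sumr big_mkcond/=.
rewrite exchange_big/= /psum big_seq [RHS]big_seq; apply: eq_bigr => q qP.
rewrite (bigD1_seq q.1)/= ?undup_uniq// ?mem_undup ?map_f// eqxx big1 ?addr0//.
by move=> I; rewrite eq_sym => /negbTE ->.
Qed.

Lemma psum_smeas P : strongly_measurable measurable (psum P).
Proof. by have [L [a [_ h]]] := psum_hsum P; rewrite (funext h); exact: hsum_smeas. Qed.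

Lemma psum_cat P Q x : psum (P ++ Q) x = psum P x + psum Q x.
Proof. exact: big_cat. Qed.

Lemma psum_scale c P x : psum (map (fun q => (q.1, c *: q.2)) P) x = c *: psum P x.
Proof.
rewrite /psum big_map scaler_sumr; apply: eq_bigr => q _ /=.
by rewrite !scalerA mulrC.
Qed.

Definition parent (I : dyadic) : dyadic := (I.1 - 1, (I.2 %/ 2)%Z).

Lemma ditv_measurable I : measurable (ditv R I).
Proof. exact: measurable_itv. Qed.

Lemma mu_ditv I : (mu (ditv R I) = (dlen R I)%:E)%E.
Proof.
rewrite /ditv lebesgue_measure_itv /= lte_fin ltrDl dlen_gt0.
by rewrite -EFinB addrAC subrr add0r.
Qed.

Lemma dlen_parent I : dlen R (parent I) = 2 * dlen R I.
Proof. by rewrite /dlen /parent /= opprB -[in RHS](expr1z 2) -expfzDr. Qed.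

Lemma indic_ditv N I x : I.1 <= N%:Z ->
  \1_(ditv R I) x = (cell (lev N I) (grid N x) == I.2)%:R :> R.
Proof.
move=> IN; rewrite indicE; congr (nat_of_bool _)%:R.
rewrite cell_grid -(lev_dlen IN) ![_ * (2 ^+ N * _)]mulrCA.
have N0 : 0 < 2 ^+ N :> R by rewrite exprn_gt0.
rewrite ler_pM2l// ltr_pM2l//.
have -> : (I.2%:~R * dlen R I <= x < (I.2 + 1)%:~R * dlen R I) =
    (dinf R I <= x < dinf R I + dlen R I).
  by rewrite /dinf intrD mulrDl mul1r [dlen R I * _]mulrC.
by apply/idP/idP => [/set_mem|h]; [|apply/mem_set]; rewrite /ditv /= in_itv.
Qed.

(** A half of an interval is the mean of the interval and of its Haar function up to sign. *)
Lemma indic_parent I (x : R) : \1_(ditv R I) x =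
  2^-1 * \1_(ditv R (parent I)) x +
    2^-1 * (-1) ^+ ((I.2 %% 2)%Z == 1) * haar (parent I) x :> R.
Proof.
pose N := `|I.1|%N.
have IN : I.1 <= N%:Z by rewrite /N abszE ler_norm.
have PN : (parent I).1 < N%:Z by rewrite /parent/=; lia.
rewrite (indic_ditv x IN) (indic_ditv x (ltW PN)) (haar_grid x PN).
have -> : lev N (parent I) = (lev N I).+1.
  by move: IN; rewrite /lev /parent /=; case: (I) => i k /=; lia.
rewrite /hz /upper cellS /=; set c := cell _ _; set k := I.2.
have := divz_eq c 2; have := divz_eq k 2.
have cP : (c %% 2)%Z = 0 \/ (c %% 2)%Z = 1 by lia.
have kP : (k %% 2)%Z = 0 \/ (k %% 2)%Z = 1 by lia.
move: cP kP; move: (c %% 2)%Z (k %% 2)%Z (c %/ 2)%Z (k %/ 2)%Z => r r' q q' rP rP' kE cE.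
have [qq|qq] := eqVneq q q'; last first.
  by rewrite (_ : (c == k) = false) ?mulr0 ?addr0//; apply/eqP; lia.
have -> : (c == k) = (r == r') by rewrite kE cE qq; apply/eqP/eqP; lia.
by case: rP => ->; case: rP' => ->; rewrite /= ?expr0 ?expr1 ?mulr1; lra.
Qed.

Lemma Lp_ditv I (v : X) : nrm (fun x => (\1_(ditv R I) x : R) *: v) =
  ((`|v| `^ p * dlen R I) `^ p^-1)%:E.
Proof.
rewrite (Lp_indic mu p1 v (ditv_measurable I)) -[RHS]poweR_EFin EFinM.
by congr ((_ * _) `^ _)%E; exact: mu_ditv.
Qed.

Lemma Lp_parent I (v : X) : nrm (fun x => (\1_(ditv R (parent I)) x : R) *: v) =
  ((2 `^ p^-1)%:E * nrm (fun x => ((\1_(ditv R I) x : R) *: v)%R))%E.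
Proof.
rewrite !Lp_ditv dlen_parent.
have a0 : 0 <= `|v| `^ p * dlen R I by rewrite mulr_ge0 ?powR_ge0// ltW ?dlen_gt0.
by rewrite -EFinM -powRM// mulrCA.
Qed.

(** Iteration of [indic_parent]. After [n] steps, what remains is 2 ^- n times the indicator of the
    n-th ancestor, whose norm has grown by the n-th power of 2 `^ p^-1; this tends to 0 since p is
    larger than 1. *)
Lemma ditv_psum_le n I (v : X) : exists P,
  (nrm (fun x => ((\1_(ditv R I) x : R) *: v - psum P x)%R) <=
    ((2^-1 * 2 `^ p^-1) ^+ n)%:E * nrm (fun x => ((\1_(ditv R I) x : R) *: v)%R))%E.
Proof.
elim: n I => [|n IH] I.
  by exists [::]; rewrite expr0 mul1e /psum; under eq_fun do rewrite big_nil subr0.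
have [P hP] := IH (parent I).
exists ((parent I, (2^-1 * (-1) ^+ ((I.2 %% 2)%Z == 1)) *: v) ::
        map (fun q => (q.1, 2^-1 *: q.2)) P).
rewrite (eq_Lp mu p (g := fun x => (2^-1 : R) *: ((\1_(ditv R (parent I)) x : R) *: v - psum P x))); last first.
  move=> x; rewrite -cat1s psum_cat psum_scale /psum big_seq1 /= indic_parent.
  by rewrite scalerDl scalerBr !scalerA [haar _ _ * _]mulrC opprD addrA addrK.
have mI J : strongly_measurable measurable (fun x => (\1_(ditv R J) x : R) *: v).
  by apply: smeas_simple; apply: indic_simple; exact: ditv_measurable.
rewrite LpZ//; last by apply: smeasB; [exact: mI|exact: psum_smeas].
rewrite ger0_norm ?invr_ge0//.
apply: (@le_trans _ _ ((2^-1)%:E * (((2^-1 * 2 `^ p^-1) ^+ n)%:E *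
   nrm (fun x => ((\1_(ditv R (parent I)) x : R) *: v)%R)))%E).
  by rewrite lee_wpmul2l// lee_fin invr_ge0.
rewrite Lp_parent !muleA -!EFinM le_eqVlt; apply/orP; left; apply/eqP.
by congr (_%:E * _)%E; rewrite exprS; ring.
Qed.

Lemma ditv_psum I (v : X) (e : R) : 0 < e -> exists P,
  (nrm (fun x => ((\1_(ditv R I) x : R) *: v - psum P x)%R) < e%:E)%E.
Proof.
move=> e0; pose D := fine (nrm (fun x => ((\1_(ditv R I) x : R) *: v)%R)).
have DE : nrm (fun x => ((\1_(ditv R I) x : R) *: v)%R) = D%:E.
  by rewrite /D Lp_ditv.
pose q := 2^-1 * 2 `^ p^-1 : R.
have q0 : 0 <= q by rewrite mulr_ge0 ?powR_ge0.
have q1 : q < 1.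
  rewrite /q mulrC ltr_pdivrMr// mul1r -[ltRHS](@powRr1 _ 2)//.
  by rewrite /powR pnatr_eq0 /= ltr_expR ltr_pM2r ?ln_gt0 ?ltr1n// invf_lt1.
have c : (fun n => D * q ^+ n) n @[n --> \oo] --> (0 : R).
  by apply: cvg_geometric; rewrite ger0_norm.
move/cvgrPdist_lt: c => /(_ _ e0)[n _ Hn].
have [P hP] := ditv_psum_le n I v; exists P; apply: (le_lt_trans hP).
rewrite DE -EFinM lte_fin mulrC.
by have := Hn n (leqnn n); rewrite /= sub0r normrN => /(le_lt_trans (ler_norm _)).
Qed.

End DyadicDensity.

Section Regularity.
Context {R : realType}.
Local Notation mu := (@lebesgue_measure R).

Lemma grid_dist N (x y : R) : grid N x = grid N y -> `|x - y| < 2 ^- N.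
Proof.
move=> e; have N0 : 0 < 2 ^+ N :> R by rewrite exprn_gt0.
have := floor_itv (2 ^+ N * x); have := floor_itv (2 ^+ N * y).
move: e; rewrite /grid => ->; rewrite intrD mulr1z => /andP[y1 y2] /andP[x1 x2].
rewrite -[2 ^- N]mul1r ltr_pdivlMr// -{1}[2 ^+ N]gtr0_norm// -normrM mulrC mulrBr.
by rewrite ltr_norml; apply/andP; split; lra.
Qed.

Lemma gridS N (x y : R) : grid N.+1 x = grid N.+1 y -> grid N x = grid N y.
Proof.
have key (z : R) : grid N z = cell 1 (grid N.+1 z).
  apply/esym/eqP; rewrite cell_grid expr1 exprS -mulrA ![_%:~R * 2]mulrC.
  by rewrite ler_pM2l// ltr_pM2l//; exact: floor_itv.
by rewrite !key => ->.
Qed.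

Lemma finite_grid N (K : set R) (M : R) : (forall x, K x -> `|x| <= M) ->
  finite_set (grid N @` K).
Proof.
move=> KM; pose F := Num.floor (2 ^+ N * `|M|); pose B := (absz F).+1.
have F0 : 0 <= F by rewrite /F floor_ge_int mulr_ge0// exprn_ge0.
apply: (@sub_finite_set _ _ ((fun i : nat => i%:Z - B%:Z) @` `I_(2 * B).+1)); last first.
  by apply: finite_image; exact: finite_II.
have N0 : 0 < 2 ^+ N :> R by rewrite exprn_gt0.
move=> _ [x Kx <-]; have xM : `|x| <= `|M| by apply: le_trans (ler_norm M); exact: KM.
have up : grid N x <= F.
  by apply: le_floor; rewrite ler_pM2l// (le_trans (ler_norm x)).
have lo : - (F + 1) <= grid N x.
  rewrite /grid floor_ge_int mulrNz.
  have /andP[_ h] := floor_itv (2 ^+ N * `|M|); rewrite -/F in h.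
  rewrite lerNl -mulrN; apply: (le_trans _ (ltW h)); rewrite ler_pM2l//.
  by apply: le_trans xM; rewrite -normrN ler_norm.
have BE : B%:Z = F + 1 by rewrite /B; lia.
exists (absz (grid N x + B%:Z)%R); rewrite /=; lia.
Qed.

Definition cover N (w : seq int) : set R :=
  \big[setU/set0]_(t <- w) (grid N @^-1` [set t]).

Lemma coverE N w x : cover N w x <-> grid N x \in w.
Proof.
rewrite /cover -bigcup_seq; split=> [[t /= tw ->]//|xw].
by exists (grid N x).
Qed.

Lemma cover_measurable N w : measurable (cover N w).
Proof. by apply: bigsetU_measurable => t _; exact: grid_measurable. Qed.

(** A is approximated from inside by a compact set, which is the decreasing intersection of its covers
    by grid cells. *)
Lemma dyadic_approx (A : set R) (e : R) : measurable A -> (mu A < +oo)%E -> 0 < e ->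
  exists N w D, [/\ uniq w, measurable D, (mu D < e%:E)%E
    & forall x, ~ D x -> (A x <-> cover N w x)].
Proof.
move=> mA fA e0; have e20 : 0 < e / 2 by rewrite divr_gt0.
have [K [cK KA muK]] := lebesgue_regularity_inner mA fA e20.
have clK : closed K by apply: compact_closed => //; exact: Rhausdorff.
have mK : measurable K by apply: closed_measurable.
have [M KM] : exists M : R, forall x, K x -> `|x| <= M.
  have [M [_ HM]] := compact_bounded cK; exists (M + 1) => x Kx.
  by apply: HM => //; rewrite ltrDl.
pose w N : seq int := fset_set (grid N @` K).
have wP N t : (t \in w N) <-> (grid N @` K) t.
  rewrite /w in_fset_set; last exact: finite_grid KM.
  by split => [/set_mem|/mem_set].
pose V N := cover N (w N).
have VP N x : V N x <-> exists2 y, K y & grid N y = grid N x.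
  by rewrite /V coverE wP; split=> -[y Ky e1]; exists y.
have mV N : measurable (V N) by exact: cover_measurable.
have KV N : K `<=` V N by move=> x Kx; apply/VP; exists x.
have capV : \bigcap_N V N = K.
  apply/seteqP; split=> [x Vx|x Kx N _]; last exact: KV.
  have -> : K = closure K by apply/closure_id.
  move=> B /nbhs_ballP[e1 e1_gt0 Be1].
  have [n _ Hn] := near_infty_natSinv_expn_lt (PosNum e1_gt0).
  have /VP[y Ky /grid_dist yx] := Vx n I; exists y; split=> //; apply: Be1.
  rewrite -ball_normE /= distrC; apply: (lt_trans yx).
  by have := Hn n (leqnn n); rewrite /= div1r.
have V0 : (mu (V 0%N) < +oo)%E.
  apply: (@le_lt_trans _ _ (mu `[- (M + 1), M + 1]%classic)); last first.
    by rewrite lebesgue_measure_itv /=; case: ifP => // _; rewrite -EFinB ltry.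
  apply: le_measure; [apply: mem_set; exact: mV|apply: mem_set; exact: measurable_itv|].
  move=> x /VP[y Ky /grid_dist]; rewrite expr0 invr1 => h /=.
  rewrite in_itv /= -ler_norml; have := KM _ Ky.
  have := ler_distD y x 0; rewrite !subr0 distrC; lra.
have decV : {homo V : n m / (n <= m)%N >-> (m <= n)%O}.
  apply/nonincreasing_seqP => n; apply/subsetPset => x /VP[y Ky /gridS exy].
  by apply/VP; exists y.
have := nonincreasing_cvg_mu V0 mV _ decV; rewrite capV => /(_ mK) c.
have fK : (mu K \is a fin_num)%E.
  by rewrite ge0_fin_numE//; apply: le_lt_trans fA; apply: le_measure => //; apply: mem_set.
have [N HN] : exists N, (mu (V N) < mu K + (e / 2)%:E)%E.
  have lt : (mu K < mu K + (e / 2)%:E)%E by rewrite -(fineK fK) -EFinD lte_fin ltrDl.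
  have : \forall n \near \oo, ((mu \o V) n < mu K + (e / 2)%:E)%E.
    by apply: (c [set u | (u < mu K + (e / 2)%:E)%E]); exact: open_ereal_lt'.
  by move=> [N _ HN]; exists N; exact: (HN N (leqnn N)).
exists N, (w N), ((A `\` K) `|` (V N `\` K)); split.
- exact: fset_uniq.
- exact: (measurableU _ _ (measurableD mA mK) (measurableD (mV N) mK)).
- rewrite (splitr e) EFinD; apply: (le_lt_trans (measureU2 mu (measurableD mA mK) (measurableD (mV N) mK))).
  have fV : (mu (V N) < +oo)%E.
    by apply: lt_trans HN _; rewrite -(fineK fK) -EFinD ltry.
  have VD : (mu (V N `\` K) < (e / 2)%:E)%E.
    have -> : mu (V N `\` K) = (mu (V N) - mu K)%E.
      by rewrite -[X in (_ - mu X)%E](setIidr (@KV N)); exact: (@measureD _ _ _ mu _ _ (mV N) mK fV).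
    by rewrite lteBlDl// -(fineK fK).
  exact: lteD.
- move=> x; rewrite /= => nD; split => h.
    by apply: KV; apply: contrapT => nK; apply: nD; left.
  by apply: KA; apply: contrapT => nK; apply: nD; right.
Qed.

End Regularity.

Section HaarDensity.
Context {R : realType} {X : completeNormedModType R}.
Local Notation mu := (@lebesgue_measure R).
Local Notation smeas := (strongly_measurable measurable).
Variable p : R.
Hypothesis p1 : 1 < p.
Let p0 : 0 < p := lt_trans ltr01 p1.
Local Notation nrm := (Lp_norm mu p).

(** Membership in the closure of the Haar sums. *)
Definition haar_limit (f : R -> X) : Prop := forall e : R, 0 < e ->
  exists P, (nrm (fun x => (f x - psum P x)%R) < e%:E)%E.

Lemma haar_limit_close (f : R -> X) : smeas f ->
  (forall e : R, 0 < e -> exists g, [/\ smeas g, haar_limit g &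
     (nrm (fun x => (f x - g x)%R) < e%:E)%E]) -> haar_limit f.
Proof.
move=> mf H e e0; have e20 : 0 < e / 2 by rewrite divr_gt0.
have [g [mg gl fg]] := H _ e20; have [P gP] := gl _ e20; exists P.
rewrite (eq_Lp mu p (g := fun x => (f x - g x) + (g x - psum P x))); last first.
  by move=> x; rewrite addrA subrK.
apply: (le_lt_trans (LpD mu p1 (smeasB mf mg) (smeasB mg (psum_smeas P)))).
by rewrite (splitr e) EFinD; exact: lteD.
Qed.

Lemma haar_limitD (f g : R -> X) : smeas f -> smeas g -> haar_limit f -> haar_limit g ->
  haar_limit (fun x => f x + g x).
Proof.
move=> mf mg lf lg e e0; have e20 : 0 < e / 2 by rewrite divr_gt0.
have [P fP] := lf _ e20; have [Q gQ] := lg _ e20; exists (P ++ Q).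
rewrite (eq_Lp mu p (g := fun x => (f x - psum P x) + (g x - psum Q x))); last first.
  by move=> x; rewrite psum_cat opprD addrACA.
apply: (le_lt_trans (LpD mu p1 (smeasB mf (psum_smeas P)) (smeasB mg (psum_smeas Q)))).
by rewrite (splitr e) EFinD; exact: lteD.
Qed.

Lemma haar_limit0 : haar_limit (fun=> 0 : X).
Proof.
move=> e e0; exists [::]; rewrite (eq_Lp mu p (g := fun=> 0)) ?Lp0 ?lte_fin//.
by move=> x; rewrite /psum big_nil subr0.
Qed.

Lemma haar_limit_sum (I : eqType) (r : seq I) (f : I -> R -> X) :
  (forall i, i \in r -> smeas (f i) /\ haar_limit (f i)) ->
  smeas (fun x => \sum_(i <- r) f i x) /\ haar_limit (fun x => \sum_(i <- r) f i x).
Proof.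
elim: r => [|i r IH] H.
  under eq_fun do rewrite big_nil; split; last exact: haar_limit0.
  by apply: smeas_simple; exact: finmeas_cst.
under eq_fun do rewrite big_cons.
have [|mf lf] := H i; first by rewrite mem_head.
have [|mr lr] := IH; first by move=> j jr; apply: H; rewrite in_cons jr orbT.
by split; [exact: smeasD|exact: haar_limitD].
Qed.

Lemma indic_cover N (w : seq int) (x : R) : uniq w ->
  \sum_(t <- w) \1_(ditv R (N%:Z, t)) x = \1_(cover N w) x :> R.
Proof.
move=> uw; have -> : \1_(cover N w) x = (grid N x \in w)%:R :> R.
  rewrite indicE; congr (nat_of_bool _)%:R.
  by apply/idP/idP => [/set_mem/coverE|/coverE/mem_set].
have E t : \1_(ditv R (N%:Z, t)) x = (t == grid N x)%:R :> R.
  rewrite (@indic_ditv _ N)//= /lev subrr /= eq_sym; congr (nat_of_bool (_ == _))%:R.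
  by apply/eqP; rewrite cellP expn0; lia.
under eq_bigr do rewrite E; have [xw|xw] := boolP (grid N x \in w).
  by rewrite (bigD1_seq _ xw uw)/= eqxx big1 ?addr0// => t /negbTE ->.
by rewrite big_seq big1// => t tw; case: eqVneq tw xw => // -> ->.
Qed.

Lemma haar_limit_indic (A : set R) (v : X) : measurable A ->
  (nrm (fun x => ((\1_A x : R) *: v)%R) < +oo)%E -> haar_limit (fun x => (\1_A x : R) *: v).
Proof.
move=> mA fin; have [->|v0] := eqVneq v 0.
  by under eq_fun do rewrite scaler0; exact: haar_limit0.
have vp0 : 0 < `|v| `^ p by rewrite powR_gt0 ?normr_gt0.
have fA : (mu A < +oo)%E.
  have Ip : p^-1 != 0 by rewrite invr_neq0 ?gt_eqF.
  have : ((`|v| `^ p)%:E * mu A < +oo)%E.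
    by apply: (lty_poweRy Ip); move: fin; rewrite Lp_indic.
  rewrite !ltey; apply: contra => /eqP ->.
  by rewrite gt0_muley ?lte_fin.
apply: haar_limit_close => [|e e0]; first by apply: smeas_simple; exact: indic_simple.
have d0 : 0 < e `^ p / `|v| `^ p by apply: divr_gt0 => //; exact: powR_gt0.
have [N [w [D [uw mD muD AD]]]] := dyadic_approx mA fA d0.
have mt t : smeas (fun x => (\1_(ditv R (N%:Z, t)) x : R) *: v).
  by apply: smeas_simple; apply: indic_simple; exact: ditv_measurable.
have [ms ls] := @haar_limit_sum _ w (fun t x => (\1_(ditv R (N%:Z, t)) x : R) *: v)
  (fun t _ => conj (mt t) (fun e e0 => ditv_psum p1 (N%:Z, t) v e0)).
exists (fun x => \sum_(t <- w) (\1_(ditv R (N%:Z, t)) x : R) *: v); split=> //.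
apply: (@le_lt_trans _ _ (nrm (fun x => (\1_D x : R) *: v))).
  apply: Lp_le => //.
  - by apply: smeasB => //; apply: smeas_simple; exact: indic_simple.
  - by apply: smeas_simple; exact: indic_simple.
  move=> x; rewrite -scaler_suml indic_cover// -scalerBl !normrZ ler_wpM2r//.
  rewrite !indicE; have [Dx|nDx] := boolP (x \in D).
    by rewrite normr1; do 2!case: (_ \in _); rewrite ?subrr ?subr0 ?sub0r ?normrN ?normr1 ?normr0.
  have -> : (x \in cover N w) = (x \in A); last by rewrite subrr.
  have {}/AD h : ~ D x by move=> /mem_set; rewrite (negbTE nDx).
  by apply/idP/idP => /set_mem /h /mem_set.
have fD : mu D \is a fin_num by rewrite ge0_fin_numE// (lt_trans muD)// ltry.
have -> : nrm (fun x => (\1_D x : R) *: v) = ((`|v| `^ p * fine (mu D)) `^ p^-1)%:E.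
  rewrite Lp_indic// -[RHS]poweR_EFin EFinM.
  by congr ((_ * _) `^ _)%E; exact: (esym (fineK fD)).
rewrite lte_fin; have -> : e = (e `^ p) `^ p^-1 by rewrite -powRrM divff ?powRr1 ?gt_eqF// ltW.
have fD0 : 0 <= fine (mu D) by exact: fine_ge0.
apply: gt0_ltr_powR; rewrite ?invr_gt0 ?nnegrE ?mulr_ge0 ?powR_ge0//.
by rewrite mulrC -ltr_pdivlMr// -lte_fin fineK.
Qed.

(** From indicators of dyadic intervals to those of sets of finite measure, simple functions, and
    all of L^p. *)
Lemma haar_dense (u : R -> X) (e : R) : in_Lp mu p u -> 0 < e ->
  exists L a, uniq L /\ (nrm (fun x => (u x - hsum L a x)%R) < e%:E)%E.
Proof.
move=> uL e0; suff /(_ _ e0)[P uP] : haar_limit u.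
  have [L [a [UL La]]] := psum_hsum P; exists L, a; split=> //.
  by rewrite -(eq_Lp mu p (f := fun x => u x - psum P x))// => x; rewrite La.
apply: haar_limit_close => [|e' e'0]; first by case: uL.
have [s [ss fs us]] := Lp_simple_dense p1 uL e'0.
exists s; split=> //; first exact: smeas_simple.
have [rs ms] := ss.
have sE : s = fun t => \sum_(x <- fset_set (range s)) (\1_(s @^-1` [set x]) t : R) *: x.
  apply/funext => t.
  have st : s t \in (fset_set (range s)) by rewrite in_fset_set//; apply/mem_set; exists t.
  rewrite (bigD1_seq (s t) st (fset_uniq _))/=.
  rewrite indicE mem_set// scale1r big1 ?addr0// => x xs.
  rewrite indicE memNset ?scale0r//= => e1.
  by rewrite e1 eqxx in xs.
rewrite sE; apply: (proj2 (haar_limit_sum _)) => x _.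
have sx : smeas (fun t => (\1_(s @^-1` [set x]) t : R) *: x).
  by apply: smeas_simple; exact: indic_simple.
split=> //; apply: (haar_limit_indic (ms x)); apply: le_lt_trans fs.
apply: Lp_le => //; first exact: smeas_simple.
move=> t; rewrite indicE; case: (boolP (_ \in _)) => [/set_mem /= ->|_].
  by rewrite scale1r.
by rewrite scale0r normr0.
Qed.

End HaarDensity.

(** * Haar coefficients *)

Lemma cellptsP j k t : (t \in cellpts (j, k)) = (cell j t == k).
Proof.
apply/idP/idP => [/mapP[i]|/eqP/mem_cellpts//].
rewrite mem_iota /= add0n => ij ->; rewrite cellP.
by move: ij; rewrite -ltz_nat; move: (2 ^ j)%:Z => q; lia.
Qed.

Lemma cellpts_uniq J : uniq (cellpts J).
Proof. by rewrite map_inj_uniq ?iota_uniq// => i j; lia. Qed.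

Section Orthogonality.
Context {R : realType}.

Lemma hz_out j k t : cell j t != k -> hz j k t = 0 :> R.
Proof. by rewrite /hz => /negbTE ->; rewrite mulr0. Qed.

Lemma sum_anti (w : seq int) (phi : int -> int) (f : int -> R) : uniq w ->
  involutive phi -> {in w, forall t, phi t \in w} -> {in w, forall t, f (phi t) = - f t} ->
  \sum_(t <- w) f t = 0.
Proof.
move=> uw phiK wphi fphi.
have pw : perm_eq w (map phi w).
  apply: uniq_perm => //; first by rewrite map_inj_uniq//; exact: can_inj phiK.
  move=> t; apply/idP/mapP => [tw|[s sw ->]]; last exact: wphi.
  by exists (phi t); rewrite ?phiK//; exact: wphi.
have : \sum_(t <- w) f t = - \sum_(t <- w) f t.
  rewrite {1}(perm_big _ pw) big_map -sumrN big_seq [RHS]big_seq.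
  by apply: eq_bigr => t; exact: fphi.
by move: (\sum_(t <- w) f t) => S e; lra.
Qed.

(** The exchange of the halves of the shorter interval reverses the product. *)
Lemma hz_orth i ki j kj : (0 < i)%N -> (0 < j)%N -> (i, ki) != (j, kj) ->
  \sum_(t <- cellpts (i, ki)) hz i ki t * hz j kj t = 0 :> R.
Proof.
move=> i0 j0 ne; have [ji|ij] := leqP j i.
  apply: (sum_anti (cellpts_uniq _) (hswapK kj j0)) => t.
    by rewrite !cellptsP cell_hswap ?j0.
  by move=> _; rewrite hz_anti// hz_inv ?j0// mulrN.
apply: (sum_anti (cellpts_uniq _) (hswapK ki i0)) => t.
  by rewrite !cellptsP cell_hswap ?i0 ?leqnn.
by move=> _; rewrite hz_anti// hz_inv ?i0 ?(ltnW ij)// 1?eq_sym// mulNr.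
Qed.

Lemma hz_sqr j k : \sum_(t <- cellpts (j, k)) hz j k t * hz j k t = 2 ^+ j :> R.
Proof.
rewrite (eq_big_seq (fun=> 1)); last first.
  move=> t; rewrite cellptsP /hz => ->; rewrite mulr1.
  by rewrite -expr2 sqrr_sign.
by rewrite big_map big_const_seq count_predT size_iota iter_addr_0 natrX.
Qed.

End Orthogonality.

Section HaarCoefficients.
Context {R : realType} {X : completeNormedModType R}.
Local Notation mu := (@lebesgue_measure R).
Local Notation smeas := (strongly_measurable measurable).

Lemma haar_finmeas I : finmeas (fun x : R => haar I x).
Proof.
have N1 : I.1 < `|I.1|.+1%N%:Z by lia.
rewrite (_ : (fun x => _) = (fun x => hz (lev `|I.1|.+1 I) I.2 (grid `|I.1|.+1 x) : R^o)).
  apply: (@finmeas_grid R R^o _ (cellpts (lev `|I.1|.+1 I, I.2))); first exact: cellpts_uniq.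
  by move=> t; rewrite cellptsP; exact: hz_out.
by apply/funext => x; exact: haar_grid.
Qed.

Lemma haar_smeas I (u : R -> X) : smeas u -> smeas (fun x => haar I x *: u x).
Proof.
move=> [s [ss su]]; exists (fun n x => haar I x *: s n x); split.
  by move=> n; exact: (finmeas_comp2 (fun (c : R) (x : X) => c *: x) (haar_finmeas I) (ss n)).
by move=> x; apply: cvgZr.
Qed.

Lemma haar_simple I (s : R -> X) : simple_fun measurable s ->
  simple_fun measurable (fun x => haar I x *: s x).
Proof. exact: (finmeas_comp2 (fun (c : R) (x : X) => c *: x) (haar_finmeas I)). Qed.

Lemma haar_le_indic I (x : R) : `|haar I x| <= \1_(ditv R I) x.
Proof.
have N1 : I.1 < `|I.1|.+1%N%:Z by lia.
rewrite (haar_grid x N1) (indic_ditv x (ltW N1)) /hz normrM normrX normrN1 expr1n mul1r.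
by rewrite ger0_norm.
Qed.

Variable p : R.
Hypothesis p1 : 1 < p.
Let p0 : 0 < p := lt_trans ltr01 p1.
Local Notation nrm := (Lp_norm mu p).

(** Instead of Hoelder's inequality: on the support of the Haar function, the norm of [f] is at most
    [q], or else at most [q] times the p-th power of its quotient by [q]. *)
Lemma haar_int_le I (f : R -> X) (q : R) : smeas f -> 0 < q ->
  (\int[mu]_x (`|haar I x *: f x|)%:E <=
    (q * dlen R I)%:E + (q * q^-1 `^ p)%:E * nrm f `^ p)%E.
Proof.
move=> mf q0.
have mD : measurable (ditv R I) by exact: ditv_measurable.
apply: (@le_trans _ _ (\int[mu]_x ((q%:E * (\1_(ditv R I) x)%:E) +
    (q * q^-1 `^ p)%:E * (`|f x| `^ p)%:E))%E).
  apply: ge0_le_integral => //.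
  - by apply: smeas_enorm; exact: haar_smeas.
  - apply: emeasurable_funD; apply: measurable_funeM; first exact/measurable_EFinP/measurable_indic.
    exact: smeas_norm_pow.
  move=> x _; rewrite -!EFinM -EFinD lee_fin normrZ.
  have := haar_le_indic I x; rewrite indicE; case: (_ \in _) => /= h.
    apply: (@le_trans _ _ `|f x|); first by rewrite ler_piMl.
    rewrite mulr1; have [fq|qf] := leP `|f x| q.
      by apply: (le_trans fq); rewrite lerDl mulr_ge0 ?powR_ge0 ?mulr_ge0 ?powR_ge0 ?(ltW q0).
    apply: (@le_trans _ _ (q * (q^-1 * `|f x|) `^ p)); last first.
      by rewrite powRM ?invr_ge0 ?(ltW q0)// mulrA lerDr ltW.
    rewrite -ler_pdivrMl//; apply: le1r_powR (ltW p1).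
    by rewrite ler_pdivlMl// mulr1 ltW.
  have -> : haar I x = 0 by apply/eqP; rewrite -normr_le0.
  by rewrite normr0 mul0r mulr0 add0r mulr_ge0 ?powR_ge0 ?mulr_ge0 ?powR_ge0 ?(ltW q0).
rewrite ge0_integralD//.
- rewrite !ge0_integralZl//.
  + rewrite (Lp_norm_pow _ p1) integral_indic// setIT [(q * dlen R I)%:E]EFinM leeD2r//.
    by rewrite le_eqVlt; apply/orP; left; apply/eqP; congr (_ * _)%E; exact: mu_ditv.
  + exact: smeas_norm_pow.
  + by rewrite lee_fin mulr_ge0 ?powR_ge0 ?(ltW q0).
  + exact/measurable_EFinP/measurable_indic.
  + by rewrite lee_fin ltW.
- by move=> x _; rewrite -EFinM lee_fin mulr_ge0 ?(ltW q0).
- by apply: measurable_funeM; exact/measurable_EFinP/measurable_indic.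
- by move=> x _; rewrite -EFinM lee_fin ?mulr_ge0 ?powR_ge0 ?(ltW q0).
- by apply: measurable_funeM; exact: smeas_norm_pow.
Qed.

Lemma haar_int_lty I (f : R -> X) : smeas f -> (nrm f < +oo)%E ->
  (\int[mu]_x (`|haar I x *: f x|)%:E < +oo)%E.
Proof.
move=> mf fin; apply: (le_lt_trans (haar_int_le I mf ltr01)).
have ff : nrm f \is a fin_num by rewrite ge0_fin_numE// Lp_ge0.
by rewrite -(fineK ff) poweR_EFin -EFinM -EFinD ltry.
Qed.

Lemma haar_coef_cvg I (u : R -> X) (g : nat -> R -> X) : smeas u ->
  (forall n, simple_fun measurable (g n)) -> (forall n, (nrm (g n) < +oo)%E) ->
  (forall e : R, 0 < e -> exists N, forall n, (N <= n)%N ->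
     (nrm (fun x => (u x - g n x)%R) < e%:E)%E) ->
  haar_coef (g n) I @[n --> \oo] --> haar_coef u I.
Proof.
move=> mu_ sg fg ug.
have gfin n : (\int[mu]_x (`|haar I x *: g n x|)%:E < +oo)%E.
  by apply: haar_int_lty => //; exact: smeas_simple.
have -> : (fun n => haar_coef (g n) I) = (fun n => simple_int mu (fun x => haar I x *: g n x)).
  by apply/funext => n; apply: bochner_int_simple => //; exact: haar_simple.
apply: bochner_int_cvg => //; first exact: haar_smeas.
  by move=> n; exact: haar_simple.
apply/cvge0_lt => [n|e e0]; first by apply: integral_ge0 => x _; rewrite lee_fin.
have l0 := dlen_gt0 (R := R) I.
(* The first term of [haar_int_le] is then half of [e]. *)
pose q := e / (2 * dlen R I); have q0 : 0 < q by rewrite divr_gt0// mulr_gt0.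
pose c := q * q^-1 `^ p; have c0 : 0 < c by apply: mulr_gt0 => //; apply: powR_gt0; rewrite invr_gt0.
have d0 : 0 < (e / (2 * c)) `^ p^-1 by apply: powR_gt0; rewrite divr_gt0// mulr_gt0.
have [N HN] := ug _ d0; exists N => n /HN h.
have md : smeas (fun x => u x - g n x) by apply: smeasB => //; exact: smeas_simple.
under eq_integral do rewrite -scalerBr.
apply: (le_lt_trans (haar_int_le I md q0)); rewrite -/c.
have ff : nrm (fun x => u x - g n x) \is a fin_num.
  by rewrite ge0_fin_numE ?Lp_ge0// (lt_trans h)// ltry.
move: h; rewrite -(fineK ff) poweR_EFin -EFinM -EFinD !lte_fin.
have := fine_ge0 (Lp_ge0 mu p (fun x => u x - g n x)).
move: (fine _) => y y0 yd.
have yp : y `^ p < e / (2 * c).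
  have := gt0_ltr_powR p0 _ _ yd; rewrite -powRrM mulVf ?gt_eqF// powRr1 ?nnegrE.
    by apply; rewrite // ltW.
  by rewrite ltW// divr_gt0// mulr_gt0.
have -> : q * dlen R I = e / 2 by rewrite /q; field; rewrite gt_eqF.
have : c * y `^ p < c * (e / (2 * c)) by rewrite ltr_pM2l.
have -> : c * (e / (2 * c)) = e / 2 by field; rewrite gt_eqF.
lra.
Qed.

(** Orthogonality, on a grid fine enough for all intervals that occur. *)
Lemma haar_coef_hsum L (a : dyadic -> X) I : uniq L ->
  haar_coef (hsum L a) I = if I \in L then dlen R I *: a I else 0.
Proof.
move=> uL; rewrite /haar_coef bochner_int_simple; first last.
- by apply: haar_int_lty; [exact: hsum_smeas|exact: hsum_lty].
- by apply: haar_simple; exact: hsum_simple.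
have [N HN] := fine_scale (I :: L) (ltn0Sn 0); rewrite mul1n in HN.
have {}HN J : J \in I :: L -> J.1 < N%:Z by move=> /HN; lia.
have IN := HN I (mem_head _ _).
have LN J (JL : J \in L) : J.1 < N%:Z by apply: HN; rewrite in_cons JL orbT.
have lev0 J : J.1 < N%:Z -> (0 < lev N J)%N by move=> h; rewrite /lev absz_gt0 subr_eq0 gt_eqF.
pose G t : X := hz (lev N I) I.2 t *: \sum_(J <- L) hz (lev N J) J.2 t *: a J.
have -> : (fun x : R => haar I x *: hsum L a x) = fun x => G (grid N x).
  by apply/funext => x; rewrite /G (hsum_grid _ _ LN) (haar_grid x IN).
rewrite (@simple_int_fibre _ _ _ mu _ (grid N) (cellpts (lev N I, I.2)) (cellpts_uniq _)).
- rewrite (eq_bigr (fun t => 2 ^- N *: G t)); last first.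
    by move=> t _; congr (_ *: _); rewrite -[RHS]/(fine (2 ^- N)%:E); congr fine; exact: mu_grid.
  rewrite -scaler_sumr /G; under eq_bigr do rewrite scaler_sumr.
  rewrite exchange_big/=.
  have E J : J \in L -> \sum_(t <- cellpts (lev N I, I.2))
      hz (lev N I) I.2 t *: (hz (lev N J) J.2 t *: a J) =
      if J == I then 2 ^+ N *: (dlen R I *: a I) else 0.
    move=> JL; under eq_bigr do rewrite scalerA.
    rewrite -scaler_suml; case: eqVneq => [->|JI].
      by rewrite hz_sqr scalerA lev_dlen// ltW.
    rewrite (hz_orth (lev0 _ IN) (lev0 _ (LN J JL))) ?scale0r//; apply: contra JI => /eqP e.
    by apply/eqP/esym; apply: (lev_inj IN (LN J JL) e).
  rewrite (eq_big_seq _ E) -big_mkcond/=; have [IL|IL] := boolP (I \in L).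
    rewrite -big_filter (_ : [seq J <- L | J == I] = [:: I]).
      by rewrite big_seq1 scalerK// expf_neq0.
    by rewrite filter_pred1_uniq.
  rewrite big_seq_cond big1 ?scaler0// => J /andP[JL /eqP e].
  by rewrite -e JL in IL.
- by move=> t _; exact: grid_measurable.
- by move=> t; rewrite cellptsP /G => /hz_out ->; rewrite scale0r.
- move=> t _; apply: (@le_lt_trans _ _ (2 ^- N)%:E); last exact: ltry.
  by rewrite le_eqVlt; apply/orP; left; apply/eqP; exact: mu_grid.
Qed.

End HaarCoefficients.

(** * The projection onto a class and its shift *)

Lemma geometric_lt (R : realType) (K e : R) : 0 < e -> exists n0, forall n, (n0 <= n)%N -> K * 4 ^- n < e.
Proof.
move=> e0; have c : (fun n => K * 4^-1 ^+ n) n @[n --> \oo] --> (0 : R).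
  by apply: cvg_geometric; rewrite ger0_norm// invf_lt1// ltr1n.
move/cvgrPdist_lt: c => /(_ _ e0)[n0 _ Hn]; exists n0 => n /Hn.
by rewrite /= sub0r normrN exprVn => /(le_lt_trans (ler_norm _)).
Qed.

Section Combine.
Context {R : realType} {X : completeNormedModType R}.

(** Coefficients are extended by 0 outside their list, so that sums over different lists can be
    subtracted as a sum over the joint list. *)
Definition extend0 (L : seq dyadic) (a : dyadic -> X) (I : dyadic) : X := if I \in L then a I else 0.

Lemma extend0_sum (P : pred dyadic) (F : dyadic -> R) M L a : uniq M -> uniq L -> {subset L <= M} ->
  \sum_(I <- M | P I) F I *: extend0 L a I = \sum_(I <- L | P I) F I *: a I.
Proof.
move=> uM uL LM; rewrite (bigID (mem L))/= addrC big1 => [|I /andP[_ /negbTE IL]]; last first.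
  by rewrite /extend0 IL scaler0.
rewrite add0r; under eq_bigl do rewrite andbC.
rewrite -big_filter_cond (perm_big L); last first.
  apply: uniq_perm => //; first exact: filter_uniq.
  by move=> I; rewrite mem_filter andb_idr//; exact: LM.
rewrite big_seq_cond [RHS]big_seq_cond; apply: eq_bigr => I /andP[IL _].
by rewrite /extend0 IL.
Qed.

Definition seq_union (L L' : seq dyadic) := undup (L ++ L').
Definition coef_diff L a L' a' I := extend0 L a I - extend0 L' a' I.

Lemma seq_union_uniq L L' : uniq (seq_union L L'). Proof. exact: undup_uniq. Qed.

Lemma coef_diff_sum (P : pred dyadic) (F : dyadic -> R) L a L' a' : uniq L -> uniq L' ->
  \sum_(I <- seq_union L L' | P I) F I *: coef_diff L a L' a' I =
    \sum_(I <- L | P I) F I *: a I - \sum_(I <- L' | P I) F I *: a' I.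
Proof.
move=> uL uL'; under eq_bigr do rewrite scalerBr.
rewrite sumrB !extend0_sum ?seq_union_uniq// => I; rewrite mem_undup mem_cat => ->//.
exact: orbT.
Qed.

Lemma hsum_filter (P : pred dyadic) L (a : dyadic -> X) (x : R) :
  hsum [seq I <- L | P I] a x = \sum_(I <- L | P I) haar I x *: a I.
Proof. exact: big_filter. Qed.

Lemma tsum_filter m (P : pred dyadic) L (a : dyadic -> X) (x : R) :
  tsum m [seq I <- L | P I] a x = \sum_(I <- L | P I) haar (tau m I) x *: a I.
Proof. exact: big_filter. Qed.

Lemma hsum_coef_diff P L a L' a' (x : R) : uniq L -> uniq L' ->
  hsum [seq I <- seq_union L L' | P I] (coef_diff L a L' a') x =
  hsum [seq I <- L | P I] a x - hsum [seq I <- L' | P I] a' x.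
Proof. by move=> uL uL'; rewrite !hsum_filter coef_diff_sum. Qed.

Lemma tsum_coef_diff m P L a L' a' (x : R) : uniq L -> uniq L' ->
  tsum m [seq I <- seq_union L L' | P I] (coef_diff L a L' a') x =
  tsum m [seq I <- L | P I] a x - tsum m [seq I <- L' | P I] a' x.
Proof. by move=> uL uL'; rewrite !tsum_filter coef_diff_sum. Qed.

End Combine.

Section NormBounds.
Context {d : measure_display} {T : measurableType d} {R : realType}
  {X : completeNormedModType R}.
Variables (mu : {measure set T -> \bar R}) (p : R).
Hypothesis p1 : 1 < p.
Local Notation nrm := (Lp_norm mu p).
Local Notation smeas := (@strongly_measurable d T R X measurable).

Lemma LpB_le (h f g : T -> X) (a b : R) : smeas f -> smeas g -> smeas h ->
  (nrm (fun t => (f t - h t)%R) <= a%:E)%E -> (nrm (fun t => (h t - g t)%R) <= b%:E)%E ->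
  (nrm (fun t => (f t - g t)%R) <= (a + b)%:E)%E.
Proof.
move=> mf mg mh fh hg; apply: (le_trans (LpB_tri mu p1 mf mg mh)).
by rewrite EFinD; exact: leeD.
Qed.

Lemma Lp_leD (f g : T -> X) (a : R) : smeas f -> smeas g ->
  (nrm (fun t => (f t - g t)%R) <= a%:E)%E -> (nrm f <= a%:E + nrm g)%E.
Proof.
move=> mf mg fg; rewrite (eq_Lp mu p (g := fun t => (f t - g t) + g t)); last first.
  by move=> t; rewrite subrK.
apply: (le_trans (LpD mu p1 (smeasB mf mg) mg)); exact: leeD2r.
Qed.

Lemma scaled_le (A B : \bar R) (c a : R) : 0 <= c -> (A <= c%:E * B)%E -> (B <= a%:E)%E ->
  (A <= (c * a)%:E)%E.
Proof.
by move=> c0 AB Ba; apply: (le_trans AB); rewrite EFinM lee_wpmul2l.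
Qed.

End NormBounds.

Section Assembly.
Context {R : realType} {X : completeNormedModType R}.
Local Notation mu := (@lebesgue_measure R).
Local Notation smeas := (strongly_measurable measurable).
Variables (p U : R).
Hypothesis p1 : 1 < p.
Hypothesis U1 : 1 <= U.
Hypothesis umd : sym_umd (X := X) p U.
Let p0 : 0 < p := lt_trans ltr01 p1.
Let U0 : 0 <= U := le_trans ler01 U1.
Local Notation nrm := (Lp_norm mu p).

(** For a fixed finite set of intervals, the norm of a Haar sum is continuous in the
    coefficients. *)
Lemma Lp_haar_lim (s : seq dyadic) (c : dyadic -> nat -> X) :
  (forall I, I \in s -> c I n @[n --> \oo] --> (0 : X)) ->
  forall e : R, 0 < e -> exists n0, forall n, (n0 <= n)%N ->
    (nrm (hsum s (c ^~ n)) <= e%:E)%E.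
Proof.
elim: s => [|I s IH] H e e0.
  exists 0 => n _; rewrite (eq_Lp mu p (g := fun=> 0)) ?Lp0 ?lee_fin ?(ltW e0)//.
  by move=> x; rewrite /hsum big_nil.
have e20 : 0 < e / 2 by rewrite divr_gt0.
have [|n1 H1] := IH _ _ e20; first by move=> J Js; apply: H; rewrite in_cons Js orbT.
have q0 : 0 < e / 2 / dlen R I `^ p^-1 by rewrite divr_gt0// powR_gt0 ?dlen_gt0.
have /cvgrPdist_lt/(_ _ q0)[n2 _ H2] := H I (mem_head _ _).
exists (maxn n1 n2) => n; rewrite geq_max => /andP[n1n n2n].
rewrite (eq_Lp mu p (g := fun x => hsum [:: I] (c ^~ n) x + hsum s (c ^~ n) x)); last first.
  by move=> x; rewrite /hsum big_cons big_seq1.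
apply: (le_trans (LpD mu p1 (hsum_smeas _ _) (hsum_smeas _ _))).
rewrite (splitr e) EFinD leeD ?H1//.
apply: (@le_trans _ _ (nrm (fun x => (\1_(ditv R I) x : R) *: c I n))).
  apply: Lp_le => //; first exact: hsum_smeas.
    by apply: smeas_simple; apply: indic_simple; exact: ditv_measurable.
  move=> x; rewrite /hsum big_seq1 !normrZ ler_wpM2r//.
  by apply: (le_trans (haar_le_indic _ _)); exact: ler_norm.
rewrite Lp_ditv// lee_fin powRM ?powR_ge0 ?(ltW (dlen_gt0 _))//.
rewrite -powRrM mulfV ?gt_eqF// powRr1// -ler_pdivlMr ?powR_gt0 ?dlen_gt0//.
by have := H2 _ n2n; rewrite /= sub0r normrN => /ltW.
Qed.

Variables (m : int) (B : pred dyadic) (r0 : int) (b : bool).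
Hypothesis m0 : m != 0.
Hypothesis Bclass : forall I, B I -> (I.1 %% (lam m)%:Z)%Z = r0 /\ parity m I.2 = b.

Let C := 2 * U ^+ 4.
Let C0 : 0 <= C. Proof. by rewrite mulr_ge0// exprn_ge0. Qed.

Lemma tsum_filter_le L (a : dyadic -> X) : uniq L ->
  (nrm (tsum m [seq I <- L | B I] a) <= C%:E * nrm (hsum [seq I <- L | B I] a))%E.
Proof.
move=> uL; apply: (tsum_class p1 U1 umd a m0 (filter_uniq _ uL)) => I.
by rewrite mem_filter => /andP[+ _]; exact: Bclass.
Qed.

(** [u] is approximated by Haar sums; [v] and [w] are the limits of their restrictions [V] to the
    collection and of the shifted restrictions [W]. *)
Section Approximants.
Variables (u v w : R -> X) (L : nat -> seq dyadic) (a : nat -> dyadic -> X).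
Hypothesis uL : in_Lp mu p u.
Hypothesis vL : in_Lp mu p v.
Hypothesis wL : in_Lp mu p w.
Hypothesis LU : forall n, uniq (L n).
Local Notation V n := (hsum [seq I <- L n | B I] (a n)).
Local Notation W n := (tsum m [seq I <- L n | B I] (a n)).
Hypothesis gu : forall n, (nrm (fun x => (u x - hsum (L n) (a n) x)%R) <= (4 ^- n)%:E)%E.
Hypothesis gv : forall n, (nrm (fun x => (v x - V n x)%R) <= (U * 2 * 4 ^- n)%:E)%E.
Hypothesis gw : forall n, (nrm (fun x => (w x - W n x)%R) <= (C * (U * 2) * 4 ^- n)%:E)%E.

Let mu_ : smeas u. Proof. by case: uL. Qed.
Let mv : smeas v. Proof. by case: vL. Qed.
Let mw : smeas w. Proof. by case: wL. Qed.

Lemma coef_lim I : extend0 (L n) (a n) I @[n --> \oo] --> (dlen R I)^-1 *: haar_coef u I.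
Proof.
have -> : (fun n => extend0 (L n) (a n) I) = (fun n => (dlen R I)^-1 *: haar_coef (hsum (L n) (a n)) I).
  apply/funext => n; rewrite (haar_coef_hsum p1)// /extend0; case: ifP => _; last by rewrite scaler0.
  by rewrite scalerK// gt_eqF ?dlen_gt0.
apply: cvgZr; apply: (haar_coef_cvg p1) => //.
- by move=> n; exact: hsum_simple.
- by move=> n; exact: hsum_lty.
- move=> e e0; have [n0 Hn] := geometric_lt 1 e0.
  exists n0 => n /Hn; rewrite mul1r => h; apply: (le_lt_trans (gu n)).
  by rewrite lte_fin.
Qed.

(** Both sums are restrictions of Haar sums to the same set of intervals, so that their difference is a
    restriction of the difference of the approximants [n] and [k]. *)
Lemma restrict_close (F : seq dyadic) n k : uniq F -> {subset L n <= F} ->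
  (nrm (fun x => (V n x - hsum [seq I <- F | B I] (extend0 (L k) (a k)) x)%R) <=
    (U * (4 ^- n + 4 ^- k))%:E)%E.
Proof.
move=> uF nF; pose P := [pred I | B I && (I \in F)].
rewrite (eq_Lp mu p (g := hsum [seq I <- seq_union (L n) (L k) | P I] (coef_diff (L n) (a n) (L k) (a k)))); last first.
  move=> x; rewrite hsum_coef_diff//; congr (_ - _).
    rewrite !hsum_filter big_seq_cond [RHS]big_seq_cond; apply: eq_bigl => I /=.
    by case: (boolP (I \in L n)) => //= /nF ->; rewrite andbT.
  rewrite !hsum_filter -(extend0_sum _ _ _ (seq_union_uniq F (L k)) (LU k)); last first.
    by move=> I; rewrite mem_undup mem_cat => ->; rewrite orbT.
  rewrite [RHS](eq_bigl (fun I => (I \in F) && B I)); last by move=> I; rewrite /P/= andbC.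
  rewrite -[RHS]big_filter_cond; apply: perm_big.
  apply: uniq_perm => //; first by apply: filter_uniq; exact: seq_union_uniq.
  by move=> I; rewrite mem_filter mem_undup mem_cat; case: (I \in F).
apply: (scaled_le U0 (hsum_restrict p1 U1 umd P _ (seq_union_uniq _ _))).
rewrite (eq_Lp mu p (g := fun x => hsum (L n) (a n) x - hsum (L k) (a k) x)); last first.
  by move=> x; have := hsum_coef_diff predT (a n) (a k) x (LU n) (LU k); rewrite !filter_predT.
apply: (LpB_le (mu := mu) p1 (h := u)) => //; try exact: hsum_smeas.
by rewrite LpBC.
Qed.

(** For F containing the intervals of the n-th approximant, the sum over F with the coefficients of [u]
    is the limit in k of the sums over F with the coefficients of the k-th approximant, and these
    are close to V n uniformly in F. *)
Lemma approx_projection (e : R) : 0 < e -> exists F0 : {fset dyadic},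
  forall F : {fset dyadic}, (F0 `<=` F)%fset ->
    (Lp_norm mu p (fun t => v t -
      \sum_(I <- F | B I) (haar I t / dlen R I) *: haar_coef u I)%R < e%:E)%E.
Proof.
move=> e0; have e30 : 0 < e / 3 by rewrite divr_gt0.
have [n0 Hn] := geometric_lt (4 * U) e30; have {Hn} := Hn n0 (leqnn _); move: n0 => n Hn.
exists [fset I in L n]%fset => F LF; have uF := fset_uniq F.
have nF : {subset L n <= F} by move=> I IL; apply: (fsubsetP LF); rewrite in_fset_.
pose S := hsum [seq I <- F | B I] (fun I => (dlen R I)^-1 *: haar_coef u I).
rewrite (eq_Lp mu p (g := fun x => v x - S x)); last first.
  by move=> x; rewrite /S hsum_filter; congr (_ - _); apply: eq_bigr => I _; rewrite scalerA.
have cI I : I \in [seq I <- F | B I] ->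
    (dlen R I)^-1 *: haar_coef u I - extend0 (L k) (a k) I @[k --> \oo] --> (0 : X).
  move=> _; rewrite -(subrr ((dlen R I)^-1 *: haar_coef u I)).
  by apply: cvgB; [exact: cvg_cst|exact: coef_lim].
have [k0 Hk] := Lp_haar_lim cI e30.
(* k is past both n and the index from which the coefficients on F are close to their limits. *)
pose k := maxn k0 n; have {}Hk := Hk k (leq_maxl _ _).
pose Sk := hsum [seq I <- F | B I] (extend0 (L k) (a k)).
have SkS : (nrm (fun x => (Sk x - S x)%R) <= (e / 3)%:E)%E.
  rewrite LpBC; apply: le_trans Hk; rewrite le_eqVlt; apply/orP; left; apply/eqP.
  apply: eq_Lp => x; rewrite /S /Sk /hsum -sumrB; apply: eq_bigr => I _.
  by rewrite scalerBr.
have k4 : 4 ^- k <= 4 ^- n :> R.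
  by rewrite lef_pV2 ?posrE ?exprn_gt0// ler_eXn2l ?ltr1n// leq_maxr.
have vSk : (nrm (fun x => (v x - Sk x)%R) <= (U * 2 * 4 ^- n + U * (4 ^- n + 4 ^- k))%:E)%E.
  apply: (LpB_le (mu := mu) p1 (h := V n)) => //; try exact: hsum_smeas.
  exact: restrict_close.
have vS := LpB_le (mu := mu) p1 mv (hsum_smeas _ _) (hsum_smeas _ _) vSk SkS.
apply: (le_lt_trans vS); rewrite lte_fin.
have h1 : U * (4 ^- n + 4 ^- k) <= U * (4 ^- n + 4 ^- n) by rewrite ler_wpM2l// lerD2l.
have e3 : e = e / 3 + e / 3 + e / 3 by field.
rewrite {2}e3; move: Hn h1 e30; move: (4 ^- n) => t; lra.
Qed.

(** A Haar sum close to [v] is close to some V n, so that by [tsum_bound] its image is close to W n,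
    hence to [w]. *)
Lemma approx_shift : is_shift p m v w.
Proof.
split => // e e0.
  have [n Hn] := geometric_lt (U * 2) e0.
  exists [fset I in [seq I <- L n | B I]]%fset, (a n).
  apply: (@le_lt_trans _ _ (U * 2 * 4 ^- n)%:E); last by rewrite lte_fin; exact: Hn.
  rewrite (eq_Lp mu p (g := fun x => v x - V n x))//.
  move=> x; congr (_ - _); apply: hsum_perm.
  apply: uniq_perm; [exact: fset_uniq|by apply: filter_uniq|].
  by move=> I; rewrite in_fset_.
have [CT CT0 TP] := tsum_bound p1 U1 umd m0.
have e40 : 0 < e / 4 by rewrite divr_gt0.
have r0' : 0 < e / 4 / (CT + 1) by rewrite divr_gt0// ltr_wpDl.
(* CT + 1 avoids a division by 0. *)
exists (e / 4 / (CT + 1)) => // F c Fc.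
have [n1 H1] := geometric_lt (C * (U * 2)) e40.
have [n2 H2] := geometric_lt (CT * (U * 2)) e40.
pose n := maxn n1 n2; have {}H1 := H1 n (leq_maxl _ _); have {}H2 := H2 n (leq_maxr _ _).
have uF := fset_uniq F; have uV := filter_uniq B (LU n).
have mp : smeas (haar_poly F c) by exact: hsum_smeas.
have ms : smeas (shift_haar_poly m F c) by exact: smeas_simple (tsum_simple _ _ _).
have Vf : (nrm (fun x => (V n x - haar_poly F c x)%R) <= (U * 2 * 4 ^- n + e / 4 / (CT + 1))%:E)%E.
  apply: (LpB_le (mu := mu) p1 (h := v)) => //; first exact: hsum_smeas.
    by rewrite LpBC.
  exact: ltW.
have Wf : (nrm (fun x => (W n x - shift_haar_poly m F c x)%R) <=
    (CT * (U * 2 * 4 ^- n + e / 4 / (CT + 1)))%:E)%E.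
  pose M := seq_union [seq I <- L n | B I] F.
  pose y := coef_diff [seq I <- L n | B I] (a n) F c.
  apply: (scaled_le CT0 _ Vf).
  rewrite (eq_Lp mu p (g := tsum m M y)); last first.
    by move=> x; have := tsum_coef_diff m predT (a n) c x uV uF; rewrite !filter_predT.
  rewrite [X in (_ * X)%E](eq_Lp mu p (g := hsum M y)); last first.
    by move=> x; have := hsum_coef_diff predT (a n) c x uV uF; rewrite !filter_predT.
  by apply: TP; exact: seq_union_uniq.
have wf := LpB_le (mu := mu) p1 mw ms (smeas_simple (tsum_simple _ _ _)) (gw n) Wf.
apply: (le_lt_trans wf); rewrite lte_fin.
have h : CT * (e / 4 / (CT + 1)) <= e / 4.
  by rewrite mulrA ler_pdivrMr ?ltr_wpDl// mulrC ler_wpM2l ?(ltW e40)// lerDl.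
have E : CT * (U * 2 * 4 ^- n + e / 4 / (CT + 1)) =
    CT * (U * 2) * 4 ^- n + CT * (e / 4 / (CT + 1)) by ring.
by rewrite E; move: h H1 H2 e40; lra.
Qed.

Lemma approx_bound : (nrm w <= C%:E * nrm v)%E.
Proof.
apply/lee_addgt0Pr => e e0.
have [n1 H1] := geometric_lt (C * (U * 2) + C * (U * 2)) e0; have {}H1 := H1 n1 (leqnn _).
have mW : smeas (W n1) by exact: smeas_simple (tsum_simple _ _ _).
apply: (le_trans (Lp_leD (mu := mu) p1 mw mW (gw n1))).
have hV : (nrm (V n1) <= (U * 2 * 4 ^- n1)%:E + nrm v)%E.
  by apply: (Lp_leD (mu := mu) p1) => //; [exact: hsum_smeas|rewrite LpBC].
have hW : (nrm (W n1) <= C%:E * nrm (V n1))%E by exact: tsum_filter_le.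
apply: (@le_trans _ _ ((C * (U * 2) * 4 ^- n1)%:E + C%:E * ((U * 2 * 4 ^- n1)%:E + nrm v))%E).
  by rewrite leeD2l//; apply: (le_trans hW); rewrite lee_wpmul2l.
rewrite ge0_muleDr ?Lp_ge0 ?lee_fin ?mulr_ge0 ?invr_ge0 ?exprn_ge0//.
rewrite addeA -EFinM -EFinD addeC leeD2l// lee_fin.
apply: le_trans (ltW H1); rewrite le_eqVlt; apply/orP; left; apply/eqP; ring.
Qed.

End Approximants.

(** The approximants converge geometrically, and by [hsum_restrict] and [tsum_class] so do their
    restrictions and the shifts of these. *)
Theorem shift_on_class (u : R -> X) : in_Lp mu p u -> exists v w,
  [/\ in_Lp mu p v /\ (forall e : R, 0 < e -> exists F0 : {fset dyadic},
      forall F : {fset dyadic}, (F0 `<=` F)%fset ->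
      (Lp_norm mu p (fun t => v t -
         \sum_(I <- F | B I) (haar I t / dlen R I) *: haar_coef u I)%R < e%:E)%E),
      is_shift p m v w & (nrm w <= C%:E * nrm v)%E].
Proof.
move=> uL.
have H n : exists La : seq dyadic * (dyadic -> X), uniq La.1 /\
    (nrm (fun x => (u x - hsum La.1 La.2 x)%R) < (4 ^- n)%:E)%E.
  have n0 : 0 < (4 : R) ^- n by rewrite invr_gt0 exprn_gt0.
  by have [L [a La]] := haar_dense p1 uL n0; exists (L, a).
have [f fP] := choice H; pose L n := (f n).1; pose a n := (f n).2.
have LU n : uniq (L n) by have [] := fP n.
have gu n : (nrm (fun x => (u x - hsum (L n) (a n) x)%R) <= (4 ^- n)%:E)%E.
  by have [_ /ltW] := fP n.
pose V n : R -> X := hsum [seq I <- L n | B I] (a n).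
pose W n : R -> X := tsum m [seq I <- L n | B I] (a n).
have mu_ : smeas u by case: uL.
have gg n k : (n <= k)%N ->
    (nrm (fun x => (hsum (L k) (a k) x - hsum (L n) (a n) x)%R) <= (2 * 4 ^- n)%:E)%E.
  move=> nk; have h : 4 ^- k <= 4 ^- n :> R.
    by rewrite lef_pV2 ?posrE ?exprn_gt0// ler_eXn2l ?ltr1n.
  rewrite mulr_natl mulr2n; apply: (LpB_le (mu := mu) p1 (h := u)) => //; try exact: hsum_smeas.
  by rewrite LpBC; apply: (le_trans (gu k)); rewrite lee_fin.
have VV n k : (n <= k)%N -> (nrm (fun x => (V k x - V n x)%R) <= (U * 2 * 4 ^- n)%:E)%E.
  move=> nk; rewrite -mulrA; apply: (scaled_le U0 _ (gg n k nk)).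
  rewrite (eq_Lp mu p (g := hsum [seq I <- seq_union (L k) (L n) | B I] (coef_diff (L k) (a k) (L n) (a n)))); last first.
    by move=> x; rewrite hsum_coef_diff.
  rewrite [X in (_ * X)%E](eq_Lp mu p (g := hsum (seq_union (L k) (L n)) (coef_diff (L k) (a k) (L n) (a n)))); last first.
    by move=> x; have := hsum_coef_diff predT (a k) (a n) x (LU k) (LU n); rewrite !filter_predT.
  by apply: hsum_restrict => //; exact: seq_union_uniq.
have WW n k : (n <= k)%N -> (nrm (fun x => (W k x - W n x)%R) <= (C * (U * 2) * 4 ^- n)%:E)%E.
  move=> nk; rewrite -mulrA; apply: (scaled_le C0 _ (VV n k nk)).
  rewrite (eq_Lp mu p (g := tsum m [seq I <- seq_union (L k) (L n) | B I] (coef_diff (L k) (a k) (L n) (a n)))); last first.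
    by move=> x; rewrite tsum_coef_diff.
  rewrite [X in (_ * X)%E](eq_Lp mu p (g := hsum [seq I <- seq_union (L k) (L n) | B I] (coef_diff (L k) (a k) (L n) (a n)))); last first.
    by move=> x; rewrite hsum_coef_diff.
  by apply: tsum_filter_le; exact: seq_union_uniq.
have U20 : 0 <= U * 2 by rewrite mulr_ge0.
have [v [vL gv]] := Lp_complete (mu := mu) p1 U20 (fun n => hsum_simple _ _) (fun n => hsum_lty p1 _ _) VV.
have [w [wL gw]] := Lp_complete (mu := mu) p1 (mulr_ge0 C0 U20) (fun n => tsum_simple _ _ _)
  (fun n => tsum_lty p1 _ _ _) WW.
exists v, w; split; first split=> //.
- by move=> e e0; exact: (approx_projection uL vL LU gu gv).
- exact: (approx_shift vL wL LU gv gw).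
- exact: (approx_bound vL wL LU gv gw).
Qed.

End Assembly.

(** A collection of the theorem lies in a single class: its intervals have the lengths of one residue
    modulo [lam] and the same parity. *)
Lemma Bcal_class (R : realType) (m : int) (i : nat) (delta : bool) :
  exists r0 b, forall I, I \in Bcal m R i delta -> (I.1 %% (lam m)%:Z)%Z = r0 /\ parity m I.2 = b.
Proof.
have key i' I : Acald m R i' delta I -> (I.1 %% (lam m)%:Z)%Z = (i'%:Z %% (lam m)%:Z)%Z.
  have A I' : Acal m R i' I' -> (I'.1 %% (lam m)%:Z)%Z = (i'%:Z %% (lam m)%:Z)%Z.
    move=> [j]; rewrite /dlen => /(ieexprIz (ltr0Sn R 1)) inj2.
    have /inj2 : (2 : R) != 1 by rewrite pnatr_eq1.
    by move=> /oppr_inj ->; rewrite mulrC modzMDl.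
  by rewrite /Acald; case: delta => -[/A].
rewrite /Bcal; case: ifP => iL.
  by exists (i%:Z %% (lam m)%:Z)%Z, true => I /set_mem[/key -> h].
exists ((i - (Lnum m + 1))%N%:Z %% (lam m)%:Z)%Z, false => I /set_mem[/key -> h].
by split=> //; apply/negbTE.
Qed.

(** The infimum need not be attained, but adding 1 exceeds some admissible constant. *)
Lemma UMD_constP (R : realType) (X : completeNormedModType R) (p : R) : 1 < p -> UMD X ->
  UMD_bound X p (`|UMD_const X p| + 1).
Proof.
move=> p1 /(_ p p1) [U [U0 umd]]; pose S := [set V : R | 0 <= V /\ UMD_bound X p V].
have hS : has_inf S by split; [exists U|exists 0 => V [? _]].
have [V [V0 bV] VS] := inf_adherent ltr01 hS.
move=> d Omega mu F dif n eps md; apply: (le_trans (bV _ _ _ _ _ n eps md)).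
rewrite lee_wpmul2r ?Lnorm_ge0// lee_fin (le_trans (ltW VS))// lerD2r.
exact: ler_norm.
Qed.

(** For [`|m|] at least 2, K(m) is 2 (lam - 3) + 5, and 2 ^ (lam - 3) is at most [`|m|]; for [`|m|]
    equal to 1, it is 7. *)
Lemma Knum_le (R : realType) (m : int) : m != 0 ->
  (Knum m)%:R <= 7 + 2 * (ln (1 + `|m|%:~R) / ln 2) :> R.
Proof.
move=> m0; have l2 : 0 < ln 2 :> R by rewrite ln_gt0// ltr1n.
have [m2|m1] := leqP 2 `|m|%N; last first.
  have e : `|m|%N = 1%N by move: m0; rewrite -absz_gt0; lia.
  rewrite /Knum /Lnum /lam e eqxx /= lerDl mulr_ge0// divr_ge0 ?(ltW l2)// ln_ge0//.
  by rewrite lerDl ler0z.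
have /andP[lo _] := lamP m2; have lg := lam_gt2 m.
have KE : Knum m = (2 * (lam m - 3) + 5)%N by rewrite /Knum /Lnum; lia.
rewrite KE natrD natrM.
have : (lam m - 3)%N%:R <= ln (1 + `|m|%:~R) / ln 2 :> R.
  rewrite ler_pdivlMr// mulr_natl -lnXn// ler_ln ?posrE ?exprn_gt0//.
    rewrite -natrX (le_trans (y := `|m|%N%:R))// ?ler_nat//.
    by rewrite -natr_absz lerDr.
lra.
Qed.

Theorem theorem4p3 (R : realType) :
  (exists C : R -> R,
     (forall U : R, 0 < C U) /\
     forall (p : R) (X : completeNormedModType R), 1 < p -> UMD X ->
     forall (m : int), m != 0 ->
     forall (i : nat), (i <= Knum m)%N ->
     forall (delta : bool) (u : R -> X), in_Lp (@lebesgue_measure R) p u ->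
     exists Pu TPu : R -> X,
       [/\ is_projection p m i delta u Pu,
           is_shift p m Pu TPu
         & (Lp_norm (@lebesgue_measure R) p TPu
              <= (C (UMD_const X p))%:E
                 * Lp_norm (@lebesgue_measure R) p Pu)%E]) /\
  (forall m : int, m != 0 ->
     (Knum m)%:R <= 7 + 2 * (ln (1 + `|m|%:~R) / ln 2) :> R).
Proof.
split; last exact: Knum_le.
exists (fun U => 2 * (`|U| + 1) ^+ 4); split.
  by move=> U; rewrite mulr_gt0// exprn_gt0// ltr_wpDl.
move=> p X p1 umdX m m0 i _ delta u uL.
have U1 : 1 <= `|UMD_const X p| + 1 by rewrite lerDr.
have umd := sym_umd_of_UMD p1 (le_trans ler01 U1) (UMD_constP p1 umdX).
have [r0 [b Bc]] := Bcal_class R m i delta.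
have [v [w [Pv Sv wv]]] := shift_on_class p1 U1 umd m0 Bc uL.
by exists v, w.
Qed.
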